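(* Let $\alpha>1$ be an irrational number. Suppose there exists a function $\psi:\mathbb{R}_+\to\mathbb{R}_+$ which is decreasing for all sufficiently large $x$, such that $$\int_{1}^{\infty}\frac{\psi(x)\,dx}{x}<+\infty,$$ and such that for all integers $q\ge 1$, $$q^{-1}\|q\alpha\|> e^{-q\psi(q)}.$$ Then the series $J_{\alpha}(1)=\sum_{\ell\ge 1}\frac{\widetilde{B}_1(\alpha\ell)}{\ell}$ is convergent. Further, as the integer $n\to\infty$, $$p_{\alpha}(n)\sim \frac{\exp\left(2\pi\sqrt{\frac{n}{6\alpha}}\right)}{\Lambda_{\alpha}\, n^{1-\frac{1}{4\alpha}}},$$ where, with $\gamma$ denoting the Euler–Mascheroni constant, $$\Lambda_{\alpha}=4\sqrt{3}\,(\pi e^{-\gamma})^{\frac{1}{2\alpha}}\left(\frac{\alpha}{6}\right)^{\frac{1}{4\alpha}}\prod_{\ell\ge 1}\left(1-\frac{\{\alpha \ell\}}{\alpha \ell}\right)e^{\frac{1}{2\alpha \ell}}.$$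
   Context: $\|x\|=\min_{n\in\mathbb{Z}}|x-n|$ is the distance to the nearest integer, $\lfloor x\rfloor$ is the largest integer $\le x$, $\{x\}=x-\lfloor x\rfloor$, and $\widetilde{B}_1(x)=\{x\}-\tfrac12$. $p_{\alpha}(n)$ is the number of partitions of $n$ (non-increasing sequences of positive integers with sum $n$) all of whose summands belong to the Beatty sequence $(\lfloor\alpha m\rfloor)_{m\in\mathbb{N}}$, $\mathbb{N}=\{1,2,3,\ldots\}$ (repetitions allowed). Convergence of the series and the infinite product is understood in the sense of limits of the partial sums/products over $1\le \ell\le N$ as $N\to\infty$. *)

(* Defs.v *)
From HB Require Import structures.
From mathcomp Require Import all_boot all_order all_algebra finmap.
From mathcomp Require Import all_classical all_reals all_analysis.

Set Implicit Arguments.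
Unset Strict Implicit.
Unset Printing Implicit Defensive.

Import Order.TTheory GRing.Theory Num.Theory.
Import numFieldNormedType.Exports.

Local Open Scope classical_set_scope.
Local Open Scope ring_scope.

Section NumberTheory.
Context {R : realType}.
Implicit Types (x alpha : R) (n : nat).

Definition frac x : R := x - (Num.floor x)%:~R.

(* The infimum is attained (see [dist_int_attained]), so it is a minimum. *)
Definition dist_int x : R := inf [set `|x - k%:~R| | k in [set: int]].

Definition B1 x : R := frac x - 1 / 2.

Definition beatty alpha : set nat :=
  [set k | exists2 m, (0 < m)%N & k%:Z = Num.floor (alpha * m%:R)].

Definition beatty_partitions alpha n : set (seq nat) :=
  [set s | [/\ sorted geq s, all (leq 1) s, sumn s = n
             & forall k, k \in s -> beatty alpha k]].

(* [fset_set] of an infinite set is a junk value; the set is always finite by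
   [finite_beatty_partitions]. *)
Definition p_beatty alpha n : nat := #|` fset_set (beatty_partitions alpha n)|.

Lemma dist_int_attained x : exists k : int, dist_int x = `|x - k%:~R|.
Proof.
have le_dist (k : int) : Num.min (frac x) (1 - frac x) <= `|x - k%:~R|.
  have [kx|xk] := leP k (Num.floor x).
    rewrite ge_min; apply/orP; left; rewrite /frac.
    by apply: le_trans (ler_norm _); rewrite lerD2l lerN2 ler_int.
  rewrite ge_min; apply/orP; right; rewrite /frac distrC.
  apply: le_trans (ler_norm _).
  rewrite opprB addrA lerD2r addrC -[X in _ + X]/(1%:~R) -intrD ler_int.
  by rewrite lezD1.
have fl := floor_le x; have fu := floorD1_gt x.
have att : exists k : int, Num.min (frac x) (1 - frac x) = `|x - k%:~R|.
  have [_|_] := leP (frac x) (1 - frac x).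
    by exists (Num.floor x); rewrite ger0_norm // subr_ge0.
  exists (Num.floor x + 1); rewrite distrC ger0_norm ?subr_ge0 1?ltW //.
  by rewrite /frac opprB addrA [1 + _]addrC intrD.
case: att => k Ek; exists k; rewrite -Ek; apply/eqP; rewrite eq_le; apply/andP; split.
  rewrite Ek; apply: ge_inf; last by exists k.
  by exists 0 => _ [j _ <-].
apply: lb_le_inf; first by exists `|x - k%:~R|, k.
by move=> _ [j _ <-].
Qed.

Lemma finite_beatty_partitions alpha n : finite_set (beatty_partitions alpha n).
Proof.
pose T := {k : 'I_n.+1 & k.-tuple 'I_n.+1}.
apply: (@sub_finite_set _ _ ((fun u : T => map val (tagged u)) @` [set: T])).
  move=> s [_ pos_s sum_s _].
  have size_s : (size s < n.+1)%N.
    rewrite ltnS -sum_s; elim: s pos_s {sum_s} => //= a s IH /andP[a0 /IH].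
    by move=> h; rewrite -add1n leq_add.
  have le_s : all (fun i => i < n.+1)%N s.
    apply/allP => i i_s; rewrite ltnS -sum_s.
    elim: s i_s {pos_s sum_s size_s} => //= a s IH; rewrite inE.
    by case/predU1P=> [->|/IH h]; [exact: leq_addr|exact: leq_trans h (leq_addl _ _)].
  pose t := map (fun i => inord i : 'I_n.+1) s.
  have size_t : size t == Ordinal size_s by rewrite size_map.
  exists (Tagged (fun k : 'I_n.+1 => k.-tuple 'I_n.+1) (Tuple size_t)) => //=.
  rewrite /t -map_comp -[RHS]map_id; apply/eq_in_map => i /(allP le_s) i_n /=.
  by rewrite inordK.
by apply: finite_image; exact: finite_finset.
Qed.

Definition J1_partial alpha : R^nat :=
  fun N => \sum_(1 <= l < N.+1) B1 (alpha * l%:R) / l%:R.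

Definition prod_partial alpha : R^nat :=
  fun N => \prod_(1 <= l < N.+1)
    ((1 - frac (alpha * l%:R) / (alpha * l%:R))
     * expR (1 / (2 * alpha * l%:R))).

(* [series harmonic n] is 1 + 1/2 + ... + 1/n. *)
Definition euler_gamma : R :=
  limn (fun n => series harmonic n - ln n%:R : R).

Definition Lambda alpha : R :=
  4 * Num.sqrt 3
  * (pi * expR (- euler_gamma)) `^ (1 / (2 * alpha))
  * (alpha / 6) `^ (1 / (4 * alpha))
  * limn (prod_partial alpha).

End NumberTheory.

(* Main.v *)
Require Import Defs.
From mathcomp Require Import all_boot all_order all_algebra finmap.
From mathcomp Require Import all_classical all_reals all_analysis.
From mathcomp Require Import measurable_realfun.
From mathcomp Require Import ring lra zify.

(** Let a_0 < a_1 < ... be the terms of the Beatty sequence and G(z) the product of the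
1/(1 - z^(a_i)), so that the number p(n) of partitions is the n-th coefficient of G. The
estimate is obtained by the saddle point method on the circle |z| = e^(-s), with
s = sqrt(A/n) and A = pi^2/(6 alpha). Parts larger than n do not matter, so G is replaced
by the product over the first M parts, with M of order n, and p(n) is exactly an integral
of that finite product over the circle ([fourier_inversion]).

Two facts about G are needed.

On the circle, |G(e^(-s + i th))/G(e^(-s))| is at most e^(- c th^2/s^3) for |th| <= s
([log_decay_major]) and at most e^(- c/s) on the rest ([log_decay_minor]). The second bound
says that the numbers a_i th/(2 pi) are not all close to integers; it holds because the
gaps of the sequence take two consecutive values, each of them in every window of bounded
length. With the Taylor expansions at th = 0 this gives a Gaussian integral, and thus
p(n) ~ e^(s n) G(e^(-s)) s^(3/2)/sqrt(4 pi A), provided that s is close enough to the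
saddle ([local_limit]).

On the positive axis, log G(e^(-s)) = A/s + c_1 ln s + c_0 + o(1) is known up to o(1)
([log_gf_cvg]). Each part is alpha j - {alpha j}; expanding -log(1 - e^(-x)) at x = s alpha j,
and writing {alpha j} = B1(alpha j) + 1/2, separates four sums. The sum over the progression
alpha j is evaluated by the midpoint rule with the dilogarithm as primitive, its constant
being that of Stirling's formula ([mode_log_sum_cvg]). The sum carrying 1/2 produces
Euler's constant ([bose_sum_cvg]). The sum carrying B1 is an Abel regularization of the
series J ([abel_bose_sum]). The quadratic remainder is absolutely convergent
([floor_correction_cvg]), and together with J it forms the logarithm of the infinite
product ([prod_partial_cvg]). Comparing the expansion at s and at s(1 + h) and s(1 - h), with
h of order sqrt(s), also yields the mean and the variance that the local limit theorem asks
for.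

The Diophantine hypothesis is used once, for the convergence of J. If q is the denominator
of a good rational approximation to alpha, then B1 sums to O(1) over q consecutive
multiples of alpha ([block_bound]). By hypothesis such q exist with 1/q bounded by
psi(c j)/j at the scale 2^j ([dioph_summable_denominators]), and these bounds are summable
because psi(x)/x is integrable ([sawtooth_series_cvg]). *)

Set Implicit Arguments.
Unset Strict Implicit.
Unset Printing Implicit Defensive.

Import Order.TTheory GRing.Theory Num.Theory.
Import numFieldNormedType.Exports.

Local Open Scope classical_set_scope.
Local Open Scope ring_scope.

Local Notation frac := Defs.frac.

(** * Limits of sums of growing length *)

Lemma sum_nat_cat {R : realType} (u : nat -> R) (K N : nat) : (K <= N)%N ->
  \sum_(0 <= m < N) u m = \sum_(0 <= m < K) u m + \sum_(K <= m < N) u m.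
Proof. by move=> KN; rewrite (big_cat_nat _ KN). Qed.

Lemma series_tail_le {R : realType} (b : nat -> R) (e : R) : cvgn (series b) -> 0 < e ->
  \forall K \near \oo, forall N, `|\sum_(K <= m < N) b m| <= e.
Proof.
move=> /cauchy_cvgP/cauchy_seriesP cb e0.
have [[A B] /= [[KA _ hA] [KB _ hB]] H] := cb _ e0.
exists (maxn KA KB) => // K /=; rewrite geq_max => /andP[KAK KBK] N.
have [NK|KN] := leqP N K; first by rewrite big_geq// normr0 ltW.
by apply: ltW; apply: (H (K, N)); split=> /=; [exact: hA|apply: hB => /=; rewrite (leq_trans KBK)// ltnW].
Qed.

Lemma cvg_sum_nat {R : realType} (u : nat -> nat -> R) (l : nat -> R) (K : nat) :
  (forall m, u ^~ m @ \oo --> l m) ->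
  (\sum_(0 <= m < K) u n m @[n --> \oo] --> \sum_(0 <= m < K) l m).
Proof.
move=> ul; elim: K => [|K IH].
  by rewrite big_geq//; under eq_fun do rewrite big_geq//; exact: cvg_cst.
rewrite big_nat_recr//=; under eq_fun do rewrite big_nat_recr//=.
exact: cvgD.
Qed.

(** Dominated convergence for sums whose length grows with [n]: an initial segment of
fixed length converges term by term, and the tail of the dominating series makes
the rest uniformly small. *)
Lemma tannery {R : realType} (u : nat -> nat -> R) (l b : nat -> R) (M : nat -> nat) :
  (\forall n \near \oo, forall m, (m < M n)%N -> `|u n m| <= b m) ->
  cvgn (series b) -> (forall m, u ^~ m @ \oo --> l m) ->
  (forall K, \forall n \near \oo, (K <= M n)%N) ->
  cvgn (series l) /\ (\sum_(0 <= m < M n) u n m @[n --> \oo] --> limn (series l)).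
Proof.
move=> ub cb ul Moo.
have lb m : `|l m| <= b m.
  apply: (@cvgr_to_le _ \oo _ _ (fun n => `|u n m|)).
    by apply: cvg_norm; exact: ul.
  near=> n.
  suff : forall m, (m < M n)%N -> `|u n m| <= b m by apply; near: n; apply: Moo.
  by near: n.
have b0 m : 0 <= b m by rewrite (le_trans _ (lb m)).
have cl : cvgn (series l).
  by apply: normed_cvg; apply: (series_le_cvg _ b0 lb cb) => m; rewrite normr_ge0.
split=> //; apply/cvgrPdist_le => e e0.
have e4 : 0 < e / 4 by rewrite divr_gt0.
have [K [Kb Kl]] : exists K, (forall N, `|\sum_(K <= m < N) b m| <= e / 4) /\
    `|limn (series l) - series l K| <= e / 4.
  near \oo => K; exists K; split.
    by near: K; exact: series_tail_le.
  by near: K; move/cvgrPdist_le : cl; apply.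
have /cvgrPdist_le/(_ _ e4) cK := cvg_sum_nat (K := K) ul.
near=> n.
rewrite (@sum_nat_cat _ _ K); last by near: n; exact: Moo.
have h1 : `|series l K - \sum_(0 <= m < K) u n m| <= e / 4 by near: n.
have h2 : `|\sum_(K <= m < M n) u n m| <= e / 4.
  apply: le_trans (Kb (M n)); apply: (le_trans (ler_norm_sum _ _ _)).
  rewrite [leRHS]ger0_norm ?sumr_ge0// !big_nat; apply: ler_sum => m /andP[_ mM].
  suff : forall m, (m < M n)%N -> `|u n m| <= b m by apply.
  by near: n.
move: Kl h1 h2; rewrite !ler_norml => /andP[? ?] /andP[? ?] /andP[? ?].
by apply/andP; split; lra.
Unshelve. all: by end_near. Qed.
(** Summation by parts: the block sums of [b] are at most [e], and the variations of
the decreasing weights telescope. *)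
Lemma abel_inequality {R : realType} (b k : nat -> R) (e : R) (K N : nat) :
  (forall N, `|\sum_(K <= m < N) b m| <= e) ->
  (forall m, 0 <= k m.+1 <= k m) -> 0 <= k 0%N ->
  `|\sum_(K <= m < N) b m * k m| <= e * k K.
Proof.
move=> be kd k00.
have k0 m : 0 <= k m by case: m => // m; have /andP[] := kd m.
have e0 : 0 <= e by apply: le_trans (be 0%N).
have [NK|/ltnW/subnKC <-] := leqP N K; first by rewrite big_geq// normr0 mulr_ge0.
move: (N - K)%N => j {N}.
have key : `|\sum_(K <= m < K + j) b m * k m
             - (\sum_(K <= m < K + j) b m) * k (K + j)%N| <= e * (k K - k (K + j)%N).
  elim: j => [|j IH]; first by rewrite addn0 !big_geq// mul0r !subrr normr0 mulr0.
  rewrite addnS !big_nat_recr ?leq_addr//=.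
  have := be (K + j).+1; rewrite big_nat_recr ?leq_addr//= => bj.
  have /andP[_ kj] := kd (K + j)%N.
  have h : `|(\sum_(K <= i < K + j) b i + b (K + j)%N) * (k (K + j)%N - k (K + j).+1)|
     <= e * (k (K + j)%N - k (K + j).+1).
    by rewrite normrM (ger0_norm (_ : 0 <= _ - _)) ?subr_ge0// ler_wpM2r// subr_ge0.
  have := lerD IH h; rewrite -mulrDr => /(le_trans (ler_normD _ _)).
  rewrite (_ : (_ - _ + _)%R = (\sum_(K <= i < K + j) b i * k i + b (K + j)%N * k (K + j)%N -
   (\sum_(K <= i < K + j) b i + b (K + j)%N) * k (K + j).+1)); last by ring.
  by rewrite (_ : k K - _ + _ = k K - k (K + j).+1) //; ring.
have h := ler_wpM2r (k0 (K + j)%N) (be (K + j)%N).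
move: key h; rewrite -{3}(ger0_norm (k0 (K + j)%N)) -normrM !ler_norml.
by move=> /andP[? ?] /andP[? ?]; apply/andP; split; lra.
Qed.

(** Abel's limit theorem. It serves the sawtooth series, which converges only
conditionally: monotone weights take the place of a dominating series. *)
Lemma abel_summation_limit {R : realType} (b : nat -> R) (k : nat -> nat -> R) (M : nat -> nat) :
  cvgn (series b) ->
  (\forall n \near \oo, (forall m, 0 <= k n m.+1 <= k n m) /\ 0 <= k n 0%N <= 1) ->
  (forall m, k ^~ m @ \oo --> (1 : R)) ->
  (forall K, \forall n \near \oo, (K <= M n)%N) ->
  \sum_(0 <= m < M n) b m * k n m @[n --> \oo] --> limn (series b).
Proof.
move=> cb kd k1 Moo; apply/cvgrPdist_le => e e0.
have e4 : 0 < e / 4 by rewrite divr_gt0.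
have [K [Kb Kl]] : exists K, (forall N, `|\sum_(K <= m < N) b m| <= e / 4) /\
    `|limn (series b) - series b K| <= e / 4.
  near \oo => K; exists K; split.
    by near: K; exact: series_tail_le.
  by near: K; move/cvgrPdist_le : cb; apply.
have bk m : (fun n => b m * k n m) @ \oo --> b m.
  by rewrite -[X in _ --> X]mulr1; apply: cvgM; [exact: cvg_cst|exact: k1].
have /cvgrPdist_le/(_ _ e4) cK := cvg_sum_nat (K := K) bk.
near=> n.
rewrite (@sum_nat_cat _ _ K); last by near: n; exact: Moo.
have h1 : `|series b K - \sum_(0 <= m < K) b m * k n m| <= e / 4 by near: n.
have [kdn /andP[kn0 kn1]] : (forall m, 0 <= k n m.+1 <= k n m) /\ 0 <= k n 0%N <= 1 by near: n.
have : forall j, k n j <= 1.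
  by elim=> // j; apply: le_trans; have /andP[] := kdn j.
move=> /(_ K) kK.
have := abel_inequality (M n) Kb kdn kn0.
have : e / 4 * k n K <= e / 4 by rewrite ler_piMr// ltW.
move=> h3 /le_trans/(_ h3) h2.
move: Kl h1 h2; rewrite !ler_norml => /andP[? ?] /andP[? ?] /andP[? ?].
by apply/andP; split; lra.
Unshelve. all: by end_near. Qed.

(** * Convergence of the sawtooth series *)

Lemma frac_ge0 {R : realType} (x : R) : 0 <= frac x.
Proof. by rewrite /frac subr_ge0 floor_le. Qed.

Lemma frac_lt1 {R : realType} (x : R) : frac x < 1.
Proof. by rewrite /frac ltrBlDr addrC -[X in _ + X]/(1%:~R) -?intrD; have := floorD1_gt x; rewrite intrD. Qed.

Lemma frac_id {R : realType} (x : R) : 0 <= x < 1 -> frac x = x.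
Proof. by move=> h; rewrite /frac (@floor_def _ _ 0) ?subr0// add0r. Qed.

Lemma fracDz {R : realType} (x : R) (k : int) : frac (x + k%:~R) = frac x.
Proof. by rewrite /frac floorDrz ?intr_int// intrKfloor intrD; ring. Qed.
(** Pigeonhole on fractional parts; cancelling the common divisor of [q] and [p] divides
the error as well. *)
Lemma dirichlet_approximation {R : realType} (alpha : R) (N : nat) : 0 < alpha -> (0 < N)%N ->
  exists q p : nat, [/\ (0 < q <= N)%N, coprime p q & `|q%:R * alpha - p%:R| < N%:R^-1].
Proof.
move=> a0 N0; have N0' : 0 < N%:R :> R by rewrite ltr0n.
have lt (l : nat) : (Num.truncn (N%:R * frac (l%:R * alpha)) < N)%N.
  by rewrite truncn_lt_nat ?mulr_ge0 ?frac_ge0// gtr_pMr// frac_lt1.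
pose F (l : 'I_N.+1) : 'I_N := Ordinal (lt l).
have [l1 [l2 [l12 eF]]] : exists l1 l2 : 'I_N.+1, (l1 < l2)%N /\ F l1 = F l2.
  have : ~ injective F by move=> /leq_card; rewrite !card_ord ltnn.
  move=> /existsNP[l1 /existsNP[l2 /not_implyP[eF /eqP]]].
  rewrite -val_eqE /= neq_ltn => /orP[h|h]; first by exists l1, l2.
  by exists l2, l1.
have {}eF : Num.truncn (N%:R * frac (l1%:R * alpha)) = Num.truncn (N%:R * frac (l2%:R * alpha)).
  exact: (congr1 val eF).
pose q0 := (l2 - l1)%N.
pose p0 : int := Num.floor (l2%:R * alpha) - Num.floor (l1%:R * alpha).
have q00 : (0 < q0)%N by rewrite subn_gt0.
have q0N : (q0 <= N)%N by rewrite (leq_trans (leq_subr _ _))// -ltnS.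
have h0 : `|q0%:R * alpha - p0%:~R| < N%:R^-1.
  rewrite /q0 natrB 1?ltnW// /p0 intrB.
  rewrite (_ : _ - _ = frac (l2%:R * alpha) - frac (l1%:R * alpha)); last by rewrite /frac; ring.
  rewrite -(ltr_pM2l N0') divff ?gt_eqF// -{1}(ger0_norm (ltW N0')) -normrM mulrBr.
  have /andP[] := truncn_itv (mulr_ge0 (ltW N0') (frac_ge0 (l1%:R * alpha))).
  have /andP[] := truncn_itv (mulr_ge0 (ltW N0') (frac_ge0 (l2%:R * alpha))).
  by rewrite eF -natr1 ltr_norml => *; apply/andP; split; lra.
have p00 : 0 <= p0.
  rewrite leNgt; apply/negP => p0n.
  have : p0%:~R <= -1 :> R by rewrite -[X in _ <= X]/((-1)%:~R) ler_int; lia.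
  have : 0 < q0%:R * alpha by rewrite mulr_gt0// ltr0n.
  move: h0; rewrite ltr_norml => /andP[_ h0].
  have : N%:R^-1 <= 1 :> R by rewrite invf_le1// ler1n.
  lra.
pose p1 := `|p0|%N; have p1E : p0%:~R = p1%:R :> R by rewrite -{1}(gez0_abs p00).
rewrite p1E in h0.
pose d := gcdn p1 q0.
have d0 : (0 < d)%N by rewrite gcdn_gt0 q00 orbT.
exists (q0 %/ d)%N, (p1 %/ d)%N; split.
- by rewrite divn_gt0// dvdn_leq// ?dvdn_gcdr// (leq_trans (leq_div _ _)).
- by rewrite coprime_sym /coprime -(eqn_pmul2r d0) muln_gcdl mul1n !divnK ?dvdn_gcdr ?dvdn_gcdl// gcdnC.
- apply: le_lt_trans h0.
  have e1 : q0%:R = (q0 %/ d)%:R * d%:R :> R by rewrite -natrM divnK// dvdn_gcdr.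
  have e2 : p1%:R = (p1 %/ d)%:R * d%:R :> R by rewrite -natrM divnK// dvdn_gcdl.
  rewrite [in leRHS]e1 [in leRHS]e2.
  rewrite (_ : _ * d%:R * alpha - _ = d%:R * ((q0 %/ d)%:R * alpha - (p1 %/ d)%:R)); last by ring.
  by rewrite normrM normr_nat ler_peMl// ler1n.
Qed.

Section Blocks.
Context {R : realType}.

(** Moving [x] by [1/q] permutes the sampling points modulo 1. *)
Lemma sum_shift_periodic (F : R -> R) (q : nat) (x : R) (k : int) : (0 < q)%N ->
  (forall y (k : int), F (y + k%:~R) = F y) ->
  \sum_(j < q) F (x + k%:~R / q%:R + j%:R / q%:R) = \sum_(j < q) F (x + j%:R / q%:R).
Proof.
move=> q0 F1; have qn0 : q%:R != 0 :> R by rewrite pnatr_eq0 -lt0n.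
have shift1 y : \sum_(j < q) F (y + 1 / q%:R + j%:R / q%:R) = \sum_(j < q) F (y + j%:R / q%:R).
  rewrite -!(big_mkord xpredT (fun j => F (_ + j%:R / q%:R))).
  case: q q0 qn0 => // q _ qn0; rewrite big_nat_recr//= [RHS]big_nat_recl//= addrC; congr (_ + _).
    rewrite mul0r addr0 -[RHS](F1 _ 1); congr F.
    by rewrite -addrA -mulrDl [1 + _]addrC natr1 divff.
  by apply: eq_bigr => i _; congr F; rewrite -addrA -mulrDl [1 + _]addrC natr1.
have shiftn (n : nat) y : \sum_(j < q) F (y + n%:R / q%:R + j%:R / q%:R) = \sum_(j < q) F (y + j%:R / q%:R).
  elim: n y => [|n IH] y; first by rewrite mul0r addr0.
  rewrite -[RHS]shift1 -[RHS]IH; apply: eq_bigr => i _; congr (F (_ + _)).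
  by rewrite -addrA -mulrDl [1 + _]addrC natr1.
case: k => n; first exact: shiftn.
rewrite NegzE mulrNz mulNr -[RHS](_ : \sum_(j < q) F (x - n.+1%:R / q%:R + n.+1%:R / q%:R + j%:R / q%:R) = _).
  by rewrite shiftn.
by apply: eq_bigr => i _; rewrite subrK.
Qed.

(** Multiplication by [p] permutes the residues modulo [q]. *)
Lemma sum_coprime_shifts (F : R -> R) (q p : nat) (x : R) : (0 < q)%N -> coprime p q ->
  (forall y (k : int), F (y + k%:~R) = F y) ->
  \sum_(l < q) F (x + l%:R * p%:R / q%:R) = \sum_(j < q) F (x + j%:R / q%:R).
Proof.
move=> q0 pq F1; have qn0 : q%:R != 0 :> R by rewrite pnatr_eq0 -lt0n.
pose h (l : 'I_q) : 'I_q := Ordinal (ltn_pmod (l * p) q0).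
have hinj : injective h.
  move=> l1 l2 /(congr1 val)/= /eqP.
  wlog l12 : l1 l2 / (l1 <= l2)%N.
    by move=> W; case/orP: (leq_total l1 l2) => [/W//|/W W' /eqP/esym/eqP/W'].
  rewrite eq_sym eqn_mod_dvd ?leq_mul2r ?l12 ?orbT// -mulnBl Gauss_dvdl 1?coprime_sym//.
  move=> /dvdnP[c ce]; apply/val_inj => /=.
  have := ltn_ord l2; case: c ce => [|c] ce; first lia.
  by rewrite mulSn in ce; lia.
rewrite [RHS](reindex_inj hinj); apply: eq_bigr => l _ /=.
rewrite -natrM {1}(divn_eq (l * p) q) natrD natrM mulrDl mulfK// [(_ %/ _)%:R + _]addrC addrA.
by rewrite -[((l * p) %/ q)%:R]/(((l * p) %/ q)%N%:Z%:~R) F1.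
Qed.
End Blocks.

Section BlockBound.
Context {R : realType}.
Implicit Types (x y e alpha beta : R) (q p N : nat).

Lemma frac_periodic y (k : int) : frac (y + k%:~R) = frac y.
Proof. exact: fracDz. Qed.

Lemma frac_addE y e : frac (y + e) = frac (frac y + e).
Proof. by rewrite -[LHS](fracDz _ (- Num.floor y)) mulrNz; congr (Defs.frac _); rewrite /frac; ring. Qed.

(** A perturbation by at most [d] changes the fractional part by at most [d], unless
the point sits within [d] of the jump; the indicator pays for the jump. *)
Lemma frac_perturb_le y e (d : R) : `|e| <= d ->
  frac (y + e) <= frac y + d + (frac y < d)%R%:R.
Proof.
rewrite ler_norml => /andP[e1 e2]; rewrite frac_addE.
have f0 := frac_ge0 y; have f1 := frac_lt1 (frac y + e).
have [z0|z0] := leP 0 (frac y + e).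
  have : 0 <= (Num.floor (frac y + e))%:~R :> R by rewrite ler0z floor_ge0.
  have : frac (frac y + e) = frac y + e - (Num.floor (frac y + e))%:~R by [].
  case: (_ < _) => /=; lra.
by rewrite (_ : frac y < d) /=; lra.
Qed.

Lemma frac_perturb_ge y e (d : R) : `|e| <= d ->
  frac y - d - (1 - d <= frac y)%R%:R <= frac (y + e).
Proof.
rewrite ler_norml => /andP[e1 e2]; rewrite frac_addE.
have f0 := frac_lt1 y; have f1 := frac_ge0 (frac y + e).
have [z0|z0] := ltP (frac y + e) 1.
  have : (Num.floor (frac y + e))%:~R <= 0 :> R.
    by rewrite -[leRHS]/(0%:~R) ler_int -ltzD1 floor_lt_int.
  have : frac (frac y + e) = frac y + e - (Num.floor (frac y + e))%:~R by [].
  case: (1 - d <= _) => /=; lra.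
by rewrite (_ : 1 - d <= frac y) /=; lra.
Qed.

(** The points [x + j/q] are one in each interval of length [1/q], so only one of them is
close enough to the jump on either side; the rest is an arithmetic progression. *)
Lemma sum_frac_block_le q x : (0 < q)%N -> 0 <= x < q%:R^-1 ->
  \sum_(j < q) (frac (x + j%:R / q%:R) + q%:R^-1 + (frac (x + j%:R / q%:R) < q%:R^-1)%R%:R)
    <= q%:R / 2 + 3 /\
  q%:R / 2 - 3 <=
  \sum_(j < q) (frac (x + j%:R / q%:R) - q%:R^-1 - (1 - q%:R^-1 <= frac (x + j%:R / q%:R))%R%:R).
Proof.
move=> q0 /andP[x0 x1]; have qn0 : 0 < q%:R :> R by rewrite ltr0n.
have fE (j : 'I_q) : frac (x + j%:R / q%:R) = x + j%:R / q%:R.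
  rewrite frac_id// addr_ge0 ?divr_ge0//=.
  have : x + j%:R / q%:R < q%:R^-1 + j%:R / q%:R by rewrite ltrD2r.
  move/lt_le_trans; apply; rewrite -{1}[q%:R^-1]mul1r -mulrDl nat1r ler_pdivrMr// mul1r ler_nat.
  exact: ltn_ord.
have sumE : \sum_(j < q) (x + j%:R / q%:R) = q%:R * x + (q%:R - 1) / 2.
  rewrite big_split/= sumr_const card_ord -(mulr_natl x) -mulr_suml; congr (_ + _).
  apply: (@mulIf _ q%:R); first by rewrite gt_eqF.
  rewrite divfK ?gt_eqF//; elim: {fE x1 qn0} q q0 => // -[|q] IH _.
    by rewrite big_ord_recr big_ord0/=; lra.
  by rewrite big_ord_recr/= IH// -!natr1; field.
have qx : q%:R * x <= 1 by rewrite -ler_pdivlMl// mulr1 ltW.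
have qx0 : 0 <= q%:R * x by rewrite mulr_ge0.
have qq : \sum_(j < q) q%:R^-1 = 1 :> R.
  by rewrite sumr_const card_ord -[LHS]mulr_natl divff// gt_eqF.
split.
  under eq_bigr do rewrite fE.
  rewrite big_split/= big_split/= sumE qq.
  have : \sum_(j < q) (x + j%:R / q%:R < q%:R^-1)%R%:R <= 1 :> R.
    case: q q0 qn0 {x1 fE sumE qx qx0 qq} => // q _ qn0; rewrite big_ord_recl big1 ?addr0.
      by case: (_ < _).
    move=> i _; rewrite (_ : (_ < _) = false)//; apply/negbTE; rewrite -leNgt.
    have -> : (lift ord0 i)%:R = i%:R + 1 :> R by rewrite lift0 natr1.
    rewrite mulrDl mul1r.
    have : 0 <= i%:R / q.+1%:R :> R by rewrite divr_ge0.
    by move: (_^-1) (i%:R / _) => a b; lra.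
  lra.
under eq_bigr do rewrite fE.
rewrite sumrB sumrB sumE qq.
have : \sum_(j < q) (1 - q%:R^-1 <= x + j%:R / q%:R)%R%:R <= 1 :> R.
  case: q q0 qn0 x1 {fE sumE qx qx0 qq} => // q _ qn0 x1; rewrite big_ord_recr/= big1 ?add0r.
    by rewrite -[X in _ <= X]/(1%:R) ler_nat leq_b1.
  move=> i _; rewrite (_ : (_ <= _) = false)//; apply/negbTE; rewrite -ltNge.
  have /= iq := ltn_ord i.
  have : i%:R / q.+1%:R <= (q.+1%:R - 2) / q.+1%:R :> R.
    rewrite ler_wpM2r ?invr_ge0 ?(ltW qn0)//.
    have : i%:R + 1 <= q%:R :> R by rewrite natr1 ler_nat.
    have : q.+1%:R = q%:R + 1 :> R by rewrite natr1.
    lra.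
  have -> : (q.+1%:R - 2) / q.+1%:R = 1 - 2 / q.+1%:R :> R by field; rewrite gt_eqF//.
  by move: x1; move: (_^-1) (i%:R / _) => a b; lra.
lra.
Qed.

(** Over [q] consecutive terms [l alpha] stays within [1/q] of [l p/q], and the [l p/q] run
through a complete residue system, on which [B1] sums to [O(1)]. *)
Lemma block_bound alpha beta q p : (0 < q)%N -> coprime p q ->
  `|q%:R * alpha - p%:R| <= q%:R^-1 ->
  `|\sum_(l < q) B1 (beta + l%:R * alpha)| <= 3.
Proof.
move=> q0 pq h; have qn0 : 0 < q%:R :> R by rewrite ltr0n.
pose e (l : 'I_q) := l%:R * (q%:R * alpha - p%:R) / q%:R.
have eE (l : 'I_q) : beta + l%:R * alpha = (beta + l%:R * p%:R / q%:R) + e l.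
  by rewrite /e; field; rewrite gt_eqF.
have eb (l : 'I_q) : `|e l| <= q%:R^-1.
  rewrite /e !normrM normr_nat (@ger0_norm _ q%:R^-1) ?invr_ge0 ?(ltW qn0)// ler_pdivrMr// mulVf ?gt_eqF//.
  apply: (@le_trans _ _ (q%:R * q%:R^-1)); last by rewrite divff ?gt_eqF.
  by apply: ler_pM => //; rewrite ler_nat ltnW.
pose k := Num.floor (q%:R * beta).
pose x := beta - k%:~R / q%:R.
have betaE : beta = x + k%:~R / q%:R by rewrite /x subrK.
have xI : 0 <= x < q%:R^-1.
  rewrite /x -(pmulr_rge0 _ qn0) -(ltr_pM2l qn0) mulrBr mulrCA divff ?gt_eqF// mulr1.
  by rewrite frac_ge0 frac_lt1.
have red (F : R -> R) : (forall y (k : int), F (y + k%:~R) = F y) ->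
  \sum_(l < q) F (beta + l%:R * p%:R / q%:R) = \sum_(j < q) F (x + j%:R / q%:R).
  by move=> F1; rewrite sum_coprime_shifts// betaE sum_shift_periodic.
have [up lo] := sum_frac_block_le q0 xI.
rewrite sumrB sumr_const card_ord -(mulr_natl (1 / 2)).
have U : \sum_(l < q) frac (beta + l%:R * alpha) <= q%:R / 2 + 3.
  apply: le_trans up.
  rewrite -(red (fun y => frac y + q%:R^-1 + (frac y < q%:R^-1)%R%:R)); last first.
    by move=> y j; rewrite frac_periodic.
  by apply: ler_sum => l _; rewrite eE; exact: frac_perturb_le.
have L : q%:R / 2 - 3 <= \sum_(l < q) frac (beta + l%:R * alpha).
  apply: le_trans lo _.
  rewrite -(red (fun y => frac y - q%:R^-1 - (1 - q%:R^-1 <= frac y)%R%:R)); last first.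
    by move=> y j; rewrite frac_periodic.
  by apply: ler_sum => l _; rewrite eE; exact: frac_perturb_ge.
by rewrite ler_norml; apply/andP; split; lra.
Qed.

Lemma abs_B1_le x : `|B1 x| <= 1.
Proof. by rewrite /B1 ler_norml; have := frac_ge0 x; have := frac_lt1 x; lra. Qed.

(** Cut the range into blocks whose length [q <= N] is the denominator of a good
approximation and recurse on the remainder: [N mod q <= N/2], so the costs
[3 N/q <= 3 H N] add up geometrically. *)
Lemma B1_sum_bound alpha (H : R) (T N : nat) beta : (0 < T)%N -> 0 <= H ->
  (forall x : nat, (T <= x)%N -> exists q p : nat,
     [/\ (0 < q <= x)%N, coprime p q, `|q%:R * alpha - p%:R| < x%:R^-1 & q%:R^-1 <= H]) ->
  `|\sum_(l < N) B1 (beta + l%:R * alpha)| <= T%:R + 6 * H * N%:R.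
Proof.
move=> T0 H0 hH; elim/ltn_ind: N beta => N IH beta.
have [NT|TN] := ltnP N T.
  apply: (@le_trans _ _ N%:R).
    apply: (le_trans (ler_norm_sum _ _ _)); have -> : N%:R = \sum_(l < N) 1 :> R by rewrite sumr_const card_ord.
    by apply: ler_sum => i _; exact: abs_B1_le.
  have : N%:R <= T%:R :> R by rewrite ler_nat ltnW.
  have : 0 <= H * N%:R by rewrite mulr_ge0.
  lra.
have [q [p [/andP[q0 qN] pq hq qH]]] := hH _ TN.
have N0 : (0 < N)%N by exact: leq_trans q0 qN.
have hq' : `|q%:R * alpha - p%:R| <= q%:R^-1.
  by rewrite (le_trans (ltW hq))// lef_pV2 ?posrE ?ltr0n// ler_nat.
have blocks k : `|\sum_(l < k * q) B1 (beta + l%:R * alpha)| <= 3 * k%:R.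
  elim: k => [|k IHk]; first by rewrite mul0n big_ord0 normr0 mulr0.
  rewrite mulSn addnC big_split_ord/=.
  apply: (le_trans (ler_normD _ _)); rewrite -[k.+1%:R]natr1 mulrDr mulr1 lerD//.
  under eq_bigr => i _ do rewrite natrD mulrDl addrA.
  exact: block_bound hq'.
rewrite (_ : \sum_(l < N) _ = \sum_(l < N %/ q * q + N %% q) B1 (beta + l%:R * alpha)); last first.
  by rewrite -(divn_eq N q).
rewrite big_split_ord/=.
under [X in `|_ + X|]eq_bigr => i _ do rewrite natrD mulrDl addrA.
apply: (le_trans (ler_normD _ _)).
have rq := ltn_pmod N q0.
have rN : (N %% q < N)%N := leq_trans rq qN.
have k1 : (0 < N %/ q)%N by rewrite divn_gt0.
have := lerD (blocks (N %/ q)%N) (IH _ rN (beta + (N %/ q * q)%:R * alpha)).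
move/le_trans; apply.
have h1 : (N %/ q)%N%:R <= N%:R * H.
  apply: (@le_trans _ _ (N%:R / q%:R)); last by rewrite ler_wpM2l.
  by rewrite ler_pdivlMr ?ltr0n// -natrM ler_nat leq_trunc_div.
have h2 : 2 * (N %% q)%N%:R <= N%:R :> R.
  rewrite -natrM ler_nat {2}(divn_eq N q).
  have : (q <= N %/ q * q)%N by rewrite leq_pmull.
  lia.
have := ler_wpM2l H0 h2.
lra.
Qed.
End BlockBound.

Lemma nonneg_series_cvg {R : realType} (u : nat -> R) (B : R) : (forall n, 0 <= u n) ->
  (forall n, \sum_(0 <= k < n) u k <= B) -> cvgn (series u).
Proof.
move=> u0 uB; apply: nondecreasing_is_cvgn.
  by apply/nondecreasing_seqP => n; rewrite /series/= big_nat_recr//= lerDl.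
by exists B => _ [n _ <-]; exact: uB.
Qed.

Section IntegralTest.
Context {R : realType}.
Local Notation mu := (@lebesgue_measure R).

Lemma ge0_le_restrict_integral (f g : R -> \bar R) (D E : set R) :
  (forall x, D x -> 0 <= f x)%E -> (forall x, E x -> 0 <= g x)%E ->
  D `<=` E -> (forall x, D x -> f x <= g x)%E ->
  (\int[mu]_(x in D) f x <= \int[mu]_(x in E) g x)%E.
Proof.
move=> f0 g0 DE fg; rewrite !ge0_integralE//; apply: le_ereal_sup => _ [h /= hf <-].
exists h => // x; apply: le_trans (hf x) _; rewrite /patch.
case: ifPn => [/set_mem Dx|_]; first by rewrite mem_set ?fg//; exact: DE.
by case: ifPn => // /set_mem/g0.
Qed.

Lemma sum_le_integral (g : R -> R) (a c : R) (J : nat) :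
  nonincreasing_fun g -> (forall x, 0 <= g x) -> 0 < c ->
  ((\sum_(0 <= j < J) g (a + c * j.+1%:R) * c)%:E <= \int[mu]_(x in `]a, +oo[) (g x)%:E)%E.
Proof.
move=> gd g0 c0.
have mg (D : set R) : measurable D -> measurable_fun D g.
  by move=> mD; exact: nonincreasing_measurable.
pose S (j : nat) : set R := `]a, (a + c * j%:R)]%classic.
pose U (j : nat) : set R := `](a + c * j%:R), (a + c * j.+1%:R)]%classic.
apply: (@le_trans _ _ (\int[mu]_(x in S J) (g x)%:E)%E); last first.
  apply: ge0_le_restrict_integral => //= x; rewrite ?lee_fin//.
  by rewrite /S/= !in_itv/= => /andP[-> _].
elim: J => [|J IH].
  by rewrite big_geq// integral_ge0// => x _; rewrite lee_fin.
rewrite big_nat_recr//= EFinD.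
have cJ : c * J.+1%:R = c * J%:R + c by rewrite -natr1 mulrDr mulr1.
have cJ0 : 0 <= c * J%:R by rewrite mulr_ge0// ltW.
have -> : S J.+1 = S J `|` U J.
  by rewrite /S /U -itv_bndbnd_setU// bnd_simp; lra.
have mS : measurable (S J) by exact: measurable_itv.
have mU : measurable (U J) by exact: measurable_itv.
rewrite ge0_integral_setU//=; first last.
- rewrite disj_set2E; apply/eqP/seteqP; split => // x [/=]; rewrite /S /U/= !in_itv/=.
  by move=> /andP[_ h1] /andP[h2 _]; have := lt_le_trans h2 h1; rewrite ltxx.
- by move=> x _; rewrite lee_fin.
- apply/measurable_EFinP; apply: (mg (S J `|` U J)); exact: measurableU.
apply: leeD => //.
apply: (@le_trans _ _ (\int[mu]_(x in U J) (cst (g (a + c * J.+1%:R))%:E x))%E).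
  rewrite integral_cst//= /U lebesgue_measure_itv/= lte_fin cJ ifT; last lra.
  by rewrite -EFinB -EFinM lee_fin; rewrite (_ : _ - _ = c) //; ring.
apply: ge0_le_restrict_integral => //= x; rewrite ?lee_fin// /U/= in_itv/=.
by move=> /andP[_ h]; exact: gd.
Qed.
End IntegralTest.

Section Diophantine.
Context {R : realType}.
Variables (alpha : R) (psi : R -> R).
Hypotheses (alpha_gt0 : 0 < alpha)
  (psi_ge0 : forall x, 0 < x -> 0 <= psi x)
  (psi_decr : exists X : R, forall x y, X <= x -> x <= y -> psi y <= psi x)
  (psi_int : (\int[lebesgue_measure]_(x in `[1%R, +oo[) (psi x / x)%:E < +oo)%E)
  (alpha_dioph : forall q : nat, (1 <= q)%N ->
     q%:R^-1 * dist_int (q%:R * alpha) > expR (- (q%:R * psi q%:R))).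

Lemma psi_bounded_nat : exists2 C : R, 0 < C & forall q, (0 < q)%N -> psi q%:R <= C.
Proof.
have [X hX] := psi_decr.
pose K := (Num.truncn `|X|).+1.
have XK : X <= K%:R.
  by rewrite (le_trans (ler_norm X))// ltW// /K; have /andP[] := truncn_itv (normr_ge0 X).
have s0 N : 0 <= \sum_(q < N) psi q.+1%:R by rewrite sumr_ge0// => i _; rewrite psi_ge0.
exists (1 + \sum_(q < K) psi q.+1%:R) => [|[//|q] _]; first by rewrite ltr_wpDr.
have [qK|Kq] := ltnP q K.
  rewrite (bigD1 (Ordinal qK))//= addrCA lerDl addr_ge0// sumr_ge0// => i _.
  by rewrite psi_ge0.
apply: (@le_trans _ _ (psi K%:R)); first by rewrite hX// ler_nat ltnW.
have : 0 <= \sum_(q < K.-1) psi q.+1%:R by [].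
by rewrite /K big_ord_recr/= => h; rewrite addrA lerDr addr_ge0.
Qed.

(** Dirichlet's theorem puts [q alpha] within [1/x] of an integer; the Diophantine
hypothesis then forces [e^(- q psi(q)) < 1/x]. *)
Lemma dioph_denominator (x : nat) : (0 < x)%N -> exists q p : nat,
  [/\ (0 < q <= x)%N, coprime p q, `|q%:R * alpha - p%:R| < x%:R^-1
    & ln x%:R < q%:R * psi q%:R].
Proof.
move=> x0; have [q [p [qx pq h]]] := dirichlet_approximation alpha_gt0 x0.
exists q, p; split=> //; have /andP[q0 _] := qx.
have x0' : 0 < x%:R :> R by rewrite ltr0n.
have d1 : dist_int (q%:R * alpha) < x%:R^-1.
  apply: le_lt_trans h; rewrite /dist_int; apply: ge_inf.
    by exists 0 => _ [k _ <-].
  by exists (Posz p).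
have d0 : 0 <= dist_int (q%:R * alpha).
  by have [k ->] := dist_int_attained (q%:R * alpha).
have : expR (- (q%:R * psi q%:R)) < expR (- ln x%:R).
  rewrite [ltRHS]expRN lnK ?posrE//.
  apply: lt_le_trans (alpha_dioph q0) _.
  apply: le_trans (ltW d1); rewrite ler_piMl// invf_le1 ?ltr0n// ler1n//.
by rewrite ltr_expR ltrN2.
Qed.

(** Take [H j] to be [psi(c j)/(j ln 2)]. For [x >= 2^j] the denominator satisfies
[q psi(q) > j ln 2]; as [psi] is bounded on the integers this gives [q >= c j], and then
[1/q < psi(q)/(j ln 2) <= H j] by monotonicity. The sum of the [H j] is a Riemann sum of
the integral of [psi(x)/x]. *)
Lemma dioph_summable_denominators : exists H : nat -> R,
  [/\ cvgn (series H), forall j, 0 <= H j &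
   forall j x : nat, (2 ^ j <= x)%N -> exists q p : nat,
  [/\ (0 < q <= x)%N, coprime p q, `|q%:R * alpha - p%:R| < x%:R^-1
    & q%:R^-1 <= H j]].
Proof.
have [X hX] := psi_decr; have [C C0 hC] := psi_bounded_nat.
have ln2 : 0 < ln 2 :> R by rewrite ln_gt0// ltr1n.
pose c := ln 2 / C; have c0 : 0 < c by rewrite divr_gt0.
have [X1 [X11 XX1]] : exists X1 : R, 1 <= X1 /\ X <= X1.
  by exists (Num.max 1 X); rewrite !le_max !lexx orbT.
have X10 : 0 < X1 by apply: lt_le_trans X11.
pose j1 := (Num.truncn (X1 / c)).+1.
have j1X : X1 <= c * j1%:R.
  rewrite mulrC -ler_pdivrMr// ltW//.
  by have /andP[] := truncn_itv (divr_ge0 (ltW X10) (ltW c0)).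
(* The first terms are set to 1, because [psi] decreases only from some point on. *)
pose H j := if (j <= j1)%N then 1 else psi (c * j%:R) / (j%:R * ln 2).
have H0 j : 0 <= H j.
  rewrite /H; case: ifPn => //; rewrite -ltnNge => j0.
  have j00 : 0 < j%:R :> R by rewrite ltr0n; case: j j0.
  by apply: divr_ge0; [rewrite psi_ge0// mulr_gt0|rewrite ltW// mulr_gt0].
exists H; split => //.
- pose g (x : R) := psi (Num.max X1 x) / Num.max X1 x.
  have m0 x : 0 < Num.max X1 x by rewrite lt_max X10.
  have g0 x : 0 <= g x by rewrite divr_ge0 ?psi_ge0 ?ltW.
  have gd : nonincreasing_fun g.
    move=> x y xy; have mxy : Num.max X1 x <= Num.max X1 y by rewrite ge_max !le_max lexx xy orbT.
    rewrite /g ler_pM ?psi_ge0 ?invr_ge0 ?(ltW (m0 _))//; last by rewrite lef_pV2 ?posrE.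
    by rewrite hX// le_max XX1.
  pose I := (\int[lebesgue_measure]_(x in `[1%R, +oo[) (psi x / x)%:E)%E.
  have I0 : (0 <= I)%E.
    apply: integral_ge0 => x /=; rewrite in_itv/= andbT => x1; rewrite lee_fin.
    have x0 : 0 < x by exact: lt_le_trans x1.
    by rewrite divr_ge0 ?psi_ge0 ?ltW.
  have If : I \is a fin_num by rewrite ge0_fin_numE.
  have key J : \sum_(0 <= j < J) psi (c * (j1.+1 + j)%:R) / (j1.+1 + j)%:R <= fine I.
    rewrite -lee_fin fineK//.
    pose Ej : set R := `](c * j1%:R), +oo[%classic.
    apply: (@le_trans _ _ (\int[lebesgue_measure]_(x in Ej) (g x)%:E)%E).
      apply: le_trans (sum_le_integral (c * j1%:R) J gd g0 c0).
      rewrite lee_fin; apply: ler_sum => j _.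
      have E : c * j1%:R + c * j.+1%:R = c * (j1.+1 + j)%:R by rewrite -mulrDr -natrD addSnnS.
      have j0 : 0 < (j1.+1 + j)%:R :> R by rewrite ltr0n.
      rewrite E /g max_r; last first.
        by rewrite (le_trans j1X)// ler_wpM2l ?(ltW c0)// ler_nat addSn ltnW// ltnS leq_addr.
      rewrite le_eqVlt; apply/orP; left; apply/eqP; field.
      by rewrite !gt_eqF// ?divr_gt0.
    apply: ge0_le_restrict_integral => /=.
    + by move=> x _; rewrite lee_fin.
    + move=> x; rewrite in_itv/= andbT => x1; rewrite lee_fin.
      by rewrite divr_ge0 ?psi_ge0 ?(lt_le_trans _ x1)// (le_trans _ x1).
    + move=> x /=; rewrite /Ej/= !in_itv/= !andbT => h; apply: le_trans (ltW h).
      by apply: le_trans j1X.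
    + move=> x; rewrite /Ej/= in_itv/= andbT => h; rewrite lee_fin /g max_r//.
      exact: le_trans j1X (ltW h).
  apply: (@nonneg_series_cvg _ _ (j1.+1%:R + fine I / ln 2)) => // N.
  apply: (@le_trans _ _ (\sum_(0 <= k < j1.+1 + N) H k)).
    by rewrite [leRHS](@sum_nat_cat _ _ N) ?leq_addl// lerDl sumr_ge0.
  rewrite (@sum_nat_cat _ _ j1.+1) ?leq_addr//; apply: lerD.
    rewrite big_nat (eq_bigr (fun=> 1)); last by move=> i; rewrite ltnS /H => /= ->.
    by rewrite -big_nat sumr_const_nat subn0.
  rewrite -{1}[j1.+1]add0n big_addn addKn.
  rewrite ler_pdivlMr// mulr_suml; apply: le_trans (key N); apply: ler_sum => j _.
  rewrite /H ifF; last by apply/negbTE; rewrite -ltnNge addnS ltnS leq_addl.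
  rewrite addnC le_eqVlt; apply/orP; left; apply/eqP; field.
  by rewrite !gt_eqF// -addrA ltr_pwDl// addr_ge0.
- move=> j x jx.
  have x0 : (0 < x)%N by rewrite (leq_trans _ jx)// expn_gt0.
  have [q [p [qx pq h lq]]] := dioph_denominator x0.
  exists q, p; split => //; have /andP[q0 _] := qx.
  have q0' : 0 < q%:R :> R by rewrite ltr0n.
  have x0' : 0 < x%:R :> R by rewrite ltr0n.
  rewrite /H; case: ifPn => [_|]; first by rewrite invf_le1// ler1n.
  rewrite -ltnNge => jj1.
  have j0 : 0 < j%:R :> R by rewrite ltr0n; case: j jj1 {jx}.
  have lx : j%:R * ln 2 <= ln x%:R :> R.
    rewrite mulr_natl -lnXn// ler_ln ?posrE ?exprn_gt0//.
    by rewrite -natrX ler_nat.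
  have cq : c * j%:R <= q%:R.
    rewrite /c mulrAC ler_pdivrMr// mulrC.
    by rewrite (le_trans lx)// (le_trans (ltW lq))// ler_wpM2l ?hC ?ltW.
  have Xc : X <= c * j%:R.
    apply: (le_trans XX1).
    by rewrite (le_trans j1X)// ler_wpM2l ?(ltW c0)// ler_nat ltnW.
  rewrite ler_pdivlMr ?mulr_gt0// mulrC ler_pdivrMr// [leRHS]mulrC.
  rewrite (le_trans lx)// (le_trans (ltW lq))// ler_wpM2l ?(ltW q0')//.
  exact: hX.
Qed.
End Diophantine.

Section SawtoothSeries.
Context {R : realType}.
Variables (alpha : R) (H : nat -> R).
Hypotheses (H_cvg : cvgn (series H)) (H_ge0 : forall j, 0 <= H j)
  (H_denom : forall j x : nat, (2 ^ j <= x)%N -> exists q p : nat,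
  [/\ (0 < q <= x)%N, coprime p q, `|q%:R * alpha - p%:R| < x%:R^-1
    & q%:R^-1 <= H j]).

Let S (N : nat) : R := \sum_(0 <= l < N) B1 (alpha * l.+1%:R).

Let S_bound j N : `|S N| <= 2 ^+ j + 6 * H j * N%:R.
Proof.
have := B1_sum_bound N alpha (T := (2 ^ j)%N) _ (H_ge0 j) (@H_denom j).
rewrite expn_gt0/= natrX => /(_ isT); rewrite /S big_mkord.
by under eq_bigr do rewrite mulrC -{1}[alpha]mulr1 -mulrDr nat1r.
Qed.

Let b (m : nat) : R := B1 (alpha * m.+1%:R) / m.+1%:R.

Let series_bE N : series b N =
  S N / N.+1%:R + \sum_(0 <= m < N) S m.+1 / (m.+1%:R * m.+2%:R).
Proof.
elim: N => [|N IH]; first by rewrite /series/= /S !big_geq// mul0r addr0.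
have -> : series b N.+1 = series b N + b N by rewrite /series/= big_nat_recr.
have SS : S N.+1 = S N + B1 (alpha * N.+1%:R) by rewrite /S big_nat_recr.
rewrite IH [in RHS]big_nat_recr//= SS /b.
move: (S N) (\sum_(_ <= _ < _) _) (B1 _) => x y z.
rewrite -[N.+2%:R]natr1 -[N.+1%:R]natr1; have : 0 <= N%:R :> R by [].
move: N%:R => n n0; field.
by rewrite !gt_eqF//; lra.
Qed.

(** On [4^j <= n < 4^(j+1)] the bound [|S n| <= 2^j + 6 H_j n] is used: with the threshold
[2^j], of the order of the square root of [n], both terms are summable after division
by [n^2]. *)
Let block_sum_le (J : nat) :
  \sum_(1 <= n < 4 ^ J) `|S n| / n%:R ^+ 2 <= \sum_(0 <= j < J) (3 * 2^-1 ^+ j + 18 * H j).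
Proof.
elim: J => [|J IH]; first by rewrite !big_geq.
have J1 : (1 <= 4 ^ J)%N by rewrite expn_gt0.
have JJ : (4 ^ J <= 4 ^ J.+1)%N by rewrite leq_exp2l.
rewrite (big_cat_nat J1 JJ)/= [leRHS]big_nat_recr//= lerD//.
have p4 : 0 < 4 ^+ J :> R by rewrite exprn_gt0.
have p2 : 0 < 2 ^+ J :> R by rewrite exprn_gt0.
have E4 : 4 ^+ J = 2 ^+ J * 2 ^+ J :> R by rewrite -exprMn; congr (_ ^+ _); lra.
apply: (@le_trans _ _ (\sum_(4 ^ J <= n < 4 ^ J.+1) ((2 ^+ J) / (4 ^+ J) ^+ 2 + 6 * H J / 4 ^+ J))).
  rewrite !big_nat; apply: ler_sum => n /andP[Jn _].
  have nJ : 4 ^+ J <= n%:R :> R by rewrite -natrX ler_nat.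
  have n0 : 0 < n%:R :> R by exact: lt_le_trans nJ.
  apply: (@le_trans _ _ ((2 ^+ J + 6 * H J * n%:R) / n%:R ^+ 2)).
    by rewrite ler_wpM2r ?S_bound// invr_ge0 sqr_ge0.
  rewrite mulrDl; apply: lerD.
    have nJ2 : (4 ^+ J) ^+ 2 <= n%:R ^+ 2 :> R by rewrite !expr2 ler_pM// ltW.
    by rewrite ler_wpM2l ?(ltW p2)// lef_pV2 ?posrE ?exprn_gt0.
  rewrite expr2 invfM mulrA mulfK ?gt_eqF//.
  by rewrite ler_wpM2l ?mulr_ge0// lef_pV2 ?posrE.
rewrite sumr_const_nat -[leLHS]mulr_natl natrB// !natrX exprS.
rewrite exprVn E4 le_eqVlt; apply/orP; left; apply/eqP; field.
by rewrite gt_eqF.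
Qed.

Let abs_series_cvg : cvgn (series (fun m => S m.+1 / (m.+1%:R * m.+2%:R))).
Proof.
apply: normed_cvg.
apply: (@nonneg_series_cvg _ _ (6 + 18 * limn (series H))) => [n|N]; first exact: normr_ge0.
have hb : \sum_(0 <= k < N) `|S k.+1 / (k.+1%:R * k.+2%:R)| <= \sum_(1 <= n < N.+1) `|S n| / n%:R ^+ 2.
  rewrite big_add1/=; apply: ler_sum => k _.
  have k0 : 0 < k.+1%:R :> R by [].
  rewrite normrM ler_wpM2l// normfV ger0_norm ?mulr_ge0// lef_pV2 ?posrE ?exprn_gt0 ?mulr_gt0//.
  by rewrite expr2 ler_wpM2l ?ler_nat.
apply: (le_trans hb).
have N4 : (N.+1 <= 4 ^ N.+1)%N by rewrite ltnW// ltn_expl.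
apply: (@le_trans _ _ (\sum_(1 <= n < 4 ^ N.+1) `|S n| / n%:R ^+ 2)).
  rewrite [leRHS](big_cat_nat (ltn0Sn N) N4)/= lerDl; apply: sumr_ge0 => i _.
  by rewrite divr_ge0 ?sqr_ge0.
apply: (le_trans (block_sum_le N.+1)).
rewrite big_split/= -!mulr_sumr lerD//.
  have : series (geometric 1 (2^-1 : R)) N.+1 <= 2.
    rewrite geometric_seriesE; last by lra.
    have : 0 <= (2^-1 : R) ^+ N.+1 by rewrite exprn_ge0// invr_ge0.
    rewrite /= mul1r ler_pdivrMr; last lra.
    by move: (_ ^+ _) => x; lra.
  rewrite /series/=; under eq_bigr do rewrite mul1r.
  lra.
rewrite ler_wpM2l//; apply: (nondecreasing_cvgn_le (u_ := series H)) => //.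
by apply/nondecreasing_seqP => n; rewrite /series/= big_nat_recr//= lerDl.
Qed.

Let S_div_cvg0 : (fun N => S N / N.+1%:R) @ \oo --> (0 : R).
Proof.
apply/cvgrPdist_le => e e0.
have /cvgrPdist_lt/(_ (e / 12)) := cvg_series_cvg_0 H_cvg.
have e12 : 0 < e / 12 by rewrite divr_gt0.
move=> /(_ e12)[j _ /(_ j (leqnn j))]; rewrite sub0r normrN ger0_norm// => Hj.
near=> N.
rewrite sub0r normrN normrM normfV normr_nat ler_pdivrMr//.
apply: (le_trans (S_bound j N)).
have hN : 2 ^+ j / (e / 2) <= N%:R.
  near: N; exact: nbhs_infty_ger.
rewrite ler_pdivrMr ?divr_gt0// in hN.
have : H j * N%:R <= e / 12 * N%:R by rewrite ler_wpM2r// ltW.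
rewrite -[N.+1%:R]natr1; have : 0 <= N%:R :> R by [].
lra.
Unshelve. all: by end_near. Qed.

(** Summation by parts: the boundary term [S N/(N+1)] tends to 0 and the series of the
[S m/(m(m+1))] converges absolutely. *)
Lemma sawtooth_series_cvg : cvgn (series b).
Proof.
have -> : series b = (fun N => S N / N.+1%:R + \sum_(0 <= m < N) S m.+1 / (m.+1%:R * m.+2%:R)).
  by apply/funext => N; exact: series_bE.
apply: is_cvgD; last exact: abs_series_cvg.
by apply/cvg_ex; exists 0; exact: S_div_cvg0.
Qed.
End SawtoothSeries.

Lemma J1_partialE {R : realType} (alpha : R) :
  J1_partial alpha = series (fun m => B1 (alpha * m.+1%:R) / m.+1%:R).
Proof. by apply/funext => N; rewrite /J1_partial big_add1. Qed.

(** * Partitions into terms of a sequence *)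

Section PartitionCount.
Variable a : nat -> nat.

Definition partitions_first (k n : nat) : set (seq nat) :=
  [set s | [/\ sorted geq s, all (leq 1) s, sumn s = n
             & forall x, x \in s -> exists2 i, (i < k)%N & x = a i]].

Definition partition_count (k n : nat) : nat := #|` fset_set (partitions_first k n)|.

End PartitionCount.

Section PartitionCount.
Context {R : realType}.
Variable a : nat -> nat.
Hypotheses (a_gt0 : forall i, (0 < a i)%N) (a_incr : forall i j, (i < j)%N -> (a i < a j)%N).

Let finite_pf k n : finite_set (partitions_first a k n).
Proof.
apply: (@sub_finite_set _ _ (beatty_partitions (1 : R) n)); last first.
  exact: finite_beatty_partitions.
move=> s [ss s1 sn _]; split => // x xs; exists x; first exact: (allP s1).
by rewrite mul1r -[RHS]/(Num.floor ((x%:Z)%:~R : R)) intrKfloor.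
Qed.

Lemma partition_count0 n : partition_count a 0 n = (n == 0)%N.
Proof.
rewrite /partition_count; case: eqVneq => [->|n0].
  rewrite (_ : partitions_first _ _ _ = [set [::]]) ?fset_set1 ?cardfs1//.
  apply/seteqP; split => [[|x s] [_ _ _ h]//|s -> //].
  by have [i] := h x (mem_head _ _).
rewrite (_ : partitions_first _ _ _ = set0) ?fset_set0 ?cardfs0//.
apply/seteqP; split => // -[|x s] [_ _ sn h]; first by rewrite -sn eqxx in n0.
by have [i] := h x (mem_head _ _).
Qed.

Let a_inj i j : a i = a j -> i = j.
Proof. by move=> e; case: (ltngtP i j) => // /a_incr; rewrite e ltnn. Qed.

(** A partition into the first [k+1] terms either avoids [a k], or is a partition of
[n - a k] with one more copy of [a k]; since [a] increases, [a k] is then the head. *)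
Lemma partition_countS k n : partition_count a k.+1 n =
  (partition_count a k n + (if a k <= n then partition_count a k.+1 (n - a k) else 0))%N.
Proof.
have geq_tr : transitive geq by move=> x y z /= yx xz; exact: leq_trans xz yx.
rewrite /partition_count.
pose C := (if a k <= n then cons (a k) @` partitions_first a k.+1 (n - a k) else set0)%N.
have finC : finite_set C.
  by rewrite /C; case: ifP => // _; apply: finite_image; exact: finite_pf.
have E : partitions_first a k.+1 n = partitions_first a k n `|` C.
  apply/seteqP; split => [s [ss s1 sn sh]|s].
    have [kx|kx] := boolP (a k \in s); last first.
      left; split => // x xs; have [i ik xi] := sh _ xs.
      exists i => //; move: ik; rewrite ltnS leq_eqVlt => /orP[/eqP ik|//].
      by move: kx; rewrite -ik -xi xs.
    right; case: s ss s1 sn sh kx => // x s ss s1 sn sh kx.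
    have xk : x = a k.
      have [i ik xi] := sh _ (mem_head x s).
      have : (a k <= x)%N.
        move: kx; rewrite inE => /predU1P[->//|kx].
        by move: ss; rewrite /= path_sortedE// => /andP[/allP/(_ _ kx)].
      rewrite xi leq_eqVlt => /orP[/eqP->//|/ltnW h].
      move: ik; rewrite ltnS leq_eqVlt => /orP[/eqP->//|/a_incr].
      by rewrite ltnNge h.
    rewrite /C; move: sn => /= sn.
    rewrite ifT; last by rewrite -sn xk leq_addr.
    exists s; last by rewrite xk.
    split.
    - by move: ss => /= /path_sorted.
    - by move: s1 => /= /andP[].
    - by rewrite -sn xk addKn.
    - by move=> y ys; apply: sh; rewrite inE ys orbT.
  move=> [[ss s1 sn sh]|].
    by split => // x /sh[i ik ->]; exists i => //; exact: ltnW.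
  rewrite /C; case: ifP => // akn [t [ts t1 tn th] <-]; split.
  - rewrite /= path_sortedE// ts andbT; apply/allP => x /th[i ik ->] /=.
    by move: ik; rewrite ltnS leq_eqVlt => /orP[/eqP->//|/a_incr/ltnW].
  - by rewrite /= t1 a_gt0.
  - by rewrite /= tn subnKC.
  - by move=> x; rewrite inE => /predU1P[->|/th//]; exists k.
have D : partitions_first a k n `&` C = set0.
  apply/seteqP; split => // s [[_ _ _ sh]]; rewrite /C; case: ifP => // _ [t _ st].
  have /sh[i ik /a_inj ki] : a k \in s by rewrite -st mem_head.
  by move: ik; rewrite ki ltnn.
rewrite E fset_setU//; have := cardfsUI (fset_set (partitions_first a k n)) (fset_set C).
rewrite -fset_setI// D fset_set0 cardfs0 addn0 => ->; congr (_ + _)%N.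
rewrite /C; case: ifP => _; last by rewrite fset_set0 cardfs0.
by rewrite fset_set_image// card_imfset//= => x y [].
Qed.
End PartitionCount.

Section BeattyCount.
Context {R : realType}.
Variable alpha : R.
Hypothesis alpha_gt1 : 1 < alpha.

Definition beatty_part (i : nat) : nat := Num.truncn (alpha * i.+1%:R).

Let alpha_gt0 : 0 < alpha. Proof. exact: lt_trans alpha_gt1. Qed.

Lemma beatty_part_frac i : (beatty_part i)%:R = alpha * i.+1%:R - frac (alpha * i.+1%:R).
Proof.
have h : 0 <= alpha * i.+1%:R by rewrite mulr_ge0// ltW.
rewrite /beatty_part truncn_floor h /frac -[LHS]/((Posz _)%:~R).
rewrite gez0_abs ?floor_ge0//; ring.
Qed.

Lemma beatty_part_incr i j : (i < j)%N -> (beatty_part i < beatty_part j)%N.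
Proof.
move=> ij; rewrite -(ltr_nat R) !beatty_part_frac.
have ij' : i.+1%:R + 1 <= j.+1%:R :> R by rewrite natr1 ler_nat.
have := frac_ge0 (alpha * i.+1%:R); have := frac_lt1 (alpha * j.+1%:R).
have : alpha * (i.+1%:R + 1) <= alpha * j.+1%:R by rewrite ler_wpM2l// ltW.
rewrite mulrDr mulr1; move: alpha_gt1.
move: (alpha * i.+1%:R) (alpha * j.+1%:R) => x y.
by move: (frac x) (frac y) => z t; lra.
Qed.

Lemma beatty_part_ge i : (i.+1 <= beatty_part i)%N.
Proof.
rewrite truncn_ge_nat ?mulr_ge0 ?(ltW alpha_gt0)//.
by rewrite ler_peMl// ltW.
Qed.

Lemma beatty_part_gt0 i : (0 < beatty_part i)%N.
Proof. exact: leq_trans (beatty_part_ge i). Qed.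

(** The [i]-th part exceeds [i], so no part beyond the first [M] can occur when [n <= M]. *)
Lemma p_beattyE (M n : nat) : (n <= M)%N -> p_beatty alpha n = partition_count beatty_part M n.
Proof.
move=> nM; rewrite /p_beatty /partition_count; congr (#|` fset_set _|).
have bE k : beatty alpha k <-> exists i, k = beatty_part i.
  split=> [[[//|m] _ e]|[i ->]].
    exists m; rewrite /beatty_part truncn_floor mulr_ge0 ?(ltW alpha_gt0)//.
    by rewrite -e.
  exists i.+1 => //; rewrite /beatty_part truncn_floor mulr_ge0 ?(ltW alpha_gt0)//.
  by rewrite gez0_abs// floor_ge0 mulr_ge0// ltW.
apply/seteqP; split => s [ss s1 sn sh]; split => // x xs.
  have /bE[i xi] := sh _ xs; exists i => //.
  rewrite (leq_trans (beatty_part_ge i))// -xi (leq_trans _ nM)// -sn.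
  elim: {ss s1 sn sh} s xs => //= y s IH; rewrite inE => /predU1P[->|/IH h].
    exact: leq_addr.
  exact: leq_trans h (leq_addl _ _).
by have [i _ ->] := sh _ xs; apply/bE; exists i.
Qed.
End BeattyCount.

(** * Fourier inversion *)

Lemma sin_natmul_pi {R : realType} (n : nat) : sin (n%:R * pi) = 0 :> R.
Proof.
rewrite mulr_natl -[_ *+ _]add0r (alternatingn (@sinDpi R)).
by rewrite sin0 mulr0.
Qed.

Lemma sin_intmul_pi {R : realType} (n : int) : sin (n%:~R * pi) = 0 :> R.
Proof.
case: n => n; first exact: sin_natmul_pi.
by rewrite NegzE mulrNz mulNr sinN (@sin_natmul_pi R n.+1) oppr0.
Qed.

Lemma continuous_itv_integrable {R : realType} (f : R -> R) (c d : R) : continuous f ->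
  (@lebesgue_measure R).-integrable `[c, d]%classic (EFin \o f).
Proof.
move=> cf; apply: continuous_compact_integrable; first exact: segment_compact.
exact: continuous_subspaceT.
Qed.

Lemma integral_cos_symmetric {R : realType} (T c : R) : 0 < T -> c != 0 -> sin (c * T) = 0 ->
  (\int[lebesgue_measure]_(x in `[- T, T]) cos (c * x) = 0)%R.
Proof.
move=> T0 c0 sT.
pose F (x : R) := c^-1 * sin (c * x).
have dF (x : R) : is_derive x 1 F (cos (c * x)).
  have -> : F = c^-1 *: (sin \o (c *: (id : R -> R))) by apply/funext.
  apply: is_derive_eq; rewrite -[LHS]/(c^-1 * (cos (c * x) * (c * 1))).
  by rewrite mulr1 mulrCA mulVf// mulr1.
have cc : continuous (fun x : R => cos (c * x)).
  by move=> x; apply: continuous_comp; [exact: mulrl_continuous|exact: continuous_cos].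
have cF : continuous F by move=> x; apply: differentiable_continuous; apply/derivable1_diffP; apply: ex_derive.
rewrite /Rintegral (@continuous_FTC2 _ _ F)//.
- by rewrite /F mulrN sinN sT oppr0 mulr0 sube0.
- lra.
- exact: continuous_subspaceT.
- split; first by move=> x _; apply: ex_derive.
  + exact: cvg_at_right_filter (cF _).
  + exact: cvg_at_left_filter (cF _).
- by move=> x _; rewrite derive1E; exact: derive_val.
Qed.

Section FourierInversion.
Context {R : realType}.
Variables (a : nat -> nat) (s delta : R).
Hypotheses (a_gt0 : forall i, (0 < a i)%N) (a_incr : forall i j, (i < j)%N -> (a i < a j)%N)
  (s_gt0 : 0 < s) (delta_gt0 : 0 < delta).
Local Notation mu := (@lebesgue_measure R).

Definition radius (i : nat) : R := expR (- (s * (a i)%:R)).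
(** [|1 - r e^(i u)|^2] for [r] the radius and [u = a_i th]. *)
Definition sqdist (i : nat) (th : R) : R :=
  1 - 2 * radius i * cos ((a i)%:R * th) + radius i ^+ 2.
(** Modulus of the product of the factors [1/(1 - r_i e^(i a_i th))]; its argument is the
phase below. Keeping both as real functions makes every integral a real one. *)
Definition gf_modulus (k : nat) (th : R) : R := \prod_(i < k) (Num.sqrt (sqdist i th))^-1.
Definition gf_phase (k : nat) (th : R) : R :=
  \sum_(i < k) atan (radius i * sin ((a i)%:R * th) / (1 - radius i * cos ((a i)%:R * th))).

Lemma radius_itv i : 0 < radius i < 1.
Proof. by rewrite expR_gt0 expR_lt1 oppr_lt0 mulr_gt0// ltr0n. Qed.

Lemma radius_cos_lt1 i x : 0 < 1 - radius i * cos x.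
Proof.
have /andP[r0 r1] := radius_itv i.
rewrite subr_gt0 (le_lt_trans _ r1)// ler_piMr ?cos_le1 ?ltW//.
Qed.

Lemma sqdist_gt0 i th : 0 < sqdist i th.
Proof.
have /andP[r0 r1] := radius_itv i; rewrite /sqdist.
have := cos_le1 ((a i)%:R * th); rewrite -(ler_pM2l r0) mulr1 => h.
have : 0 < (1 - radius i) ^+ 2 by rewrite exprn_gt0// subr_gt0.
rewrite expr2; lra.
Qed.

(** Multiplying the factor [1/(1 - w)], whose argument is [psi], back by [1 - w], and
taking real parts. *)
Lemma gf_factor_identity i th x :
  let psi := atan (radius i * sin ((a i)%:R * th) / (1 - radius i * cos ((a i)%:R * th))) in
  (Num.sqrt (sqdist i th))^-1 * (cos (x + psi) - radius i * cos (x + psi + (a i)%:R * th)) = cos x.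
Proof.
set r := radius i; set u := (a i)%:R * th; set y := (_ / _) => psi.
have w0 : 0 < 1 - r * cos u by exact: radius_cos_lt1.
have D0 : 0 < sqdist i th by exact: sqdist_gt0.
have q0 : 0 < Num.sqrt (sqdist i th) by rewrite sqrtr_gt0.
have cs := cos2Dsin2 u.
have DE : sqdist i th = (1 - r * cos u) ^+ 2 + (r * sin u) ^+ 2.
  transitivity (1 - 2 * r * cos u + r ^+ 2 * (cos u ^+ 2 + sin u ^+ 2)); last by ring.
  by rewrite cs mulr1.
have cpsi : cos psi = (1 - r * cos u) / Num.sqrt (sqdist i th).
  rewrite /psi cos_atan.
  have -> : 1 + y ^+ 2 = sqdist i th / (1 - r * cos u) ^+ 2.
    by rewrite DE /y; field; rewrite gt_eqF.
  rewrite sqrtrM ?(ltW D0)// sqrtrV ?sqr_ge0// sqrtr_sqr ger0_norm ?(ltW w0)//.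
  by rewrite invfM invrK mulrC.
have spsi : sin psi = (r * sin u) / Num.sqrt (sqdist i th).
  have c0 : cos psi != 0 by rewrite cpsi mulf_neq0 ?invr_eq0// gt_eqF.
  have : tan psi = y by rewrite atanK.
  rewrite /tan => /(canRL (divfK c0)) ->; rewrite cpsi /y.
  by field; rewrite !gt_eqF.
have E2 : Num.sqrt (sqdist i th) ^+ 2 = (1 - r * cos u) ^+ 2 + (r * sin u) ^+ 2.
  by rewrite sqr_sqrtr ?(ltW D0).
rewrite !cosD sinD cpsi spsi; move: q0 E2; move: (Num.sqrt _) => q q0 E2.
have su : sin u ^+ 2 = 1 - cos u ^+ 2 by rewrite -cs addrC addKr.
have -> : q^-1 * (cos x * ((1 - r * cos u) / q) - sin x * (r * sin u / q) -
   r * ((cos x * ((1 - r * cos u) / q) - sin x * (r * sin u / q)) * cos u -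
        (sin x * ((1 - r * cos u) / q) + cos x * (r * sin u / q)) * sin u)) =
   cos x * (((1 - r * cos u) ^+ 2 + r ^+ 2 * sin u ^+ 2) / q ^+ 2).
  by field; rewrite gt_eqF.
by rewrite -exprMn -E2 divff ?mulr1// expf_neq0// gt_eqF.
Qed.

Let contMl (c : R) : continuous (fun x : R => c * x).
Proof. exact: mulrl_continuous. Qed.

Lemma continuous_gf_modulus k : continuous (gf_modulus k).
Proof.
elim: k => [|k IH] x.
  rewrite (_ : gf_modulus 0 = cst 1); first exact: cvg_cst.
  by apply/funext => y; rewrite /gf_modulus big_ord0.
rewrite (_ : gf_modulus k.+1 = gf_modulus k \* (fun th => (Num.sqrt (sqdist k th))^-1)); last first.
  by apply/funext => y; rewrite /gf_modulus big_ord_recr.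
apply: continuousM; first exact: IH.
apply: continuousV; first by rewrite gt_eqF// sqrtr_gt0 sqdist_gt0.
apply: (continuous_comp (f := sqdist k) (g := @Num.sqrt R)); last exact: sqrt_continuous.
apply: continuousD; last exact: cvg_cst.
apply: continuousB; first exact: cvg_cst.
apply: continuousM; first exact: cvg_cst.
by apply: continuous_comp; [exact: contMl|exact: continuous_cos].
Qed.

Lemma continuous_gf_phase k : continuous (gf_phase k).
Proof.
elim: k => [|k IH] x.
  rewrite (_ : gf_phase 0 = cst 0); first exact: cvg_cst.
  by apply/funext => y; rewrite /gf_phase big_ord0.
rewrite (_ : gf_phase k.+1 = gf_phase k \+ (fun th => atan (radius k * sin ((a k)%:R * th) / (1 - radius k * cos ((a k)%:R * th))))); last first.
  by apply/funext => y; rewrite /gf_phase big_ord_recr.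
apply: continuousD; first exact: IH.
apply: (continuous_comp (f := fun th : R => radius k * sin ((a k)%:R * th) / (1 - radius k * cos ((a k)%:R * th))) (g := @atan R)); last exact: continuous_atan.
apply: continuousM.
  apply: continuousM; first exact: cvg_cst.
  by apply: continuous_comp; [exact: contMl|exact: continuous_sin].
apply: continuousV; first by rewrite gt_eqF// radius_cos_lt1.
apply: continuousB; first exact: cvg_cst.
apply: continuousM; first exact: cvg_cst.
by apply: continuous_comp; [exact: contMl|exact: continuous_cos].
Qed.

Definition fourier_integrand k (n : int) (t : R) : R :=
  gf_modulus k (delta * t) * cos (gf_phase k (delta * t) - n%:~R * (delta * t)).

Lemma continuous_fourier_integrand k n : continuous (fourier_integrand k n).
Proof.
move=> t; apply: (continuous_comp (f := fun t : R => delta * t)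
  (g := fun th : R => gf_modulus k th * cos (gf_phase k th - n%:~R * th))); first exact: contMl.
apply: continuousM; first exact: continuous_gf_modulus.
apply: (continuous_comp (f := fun th : R => gf_phase k th - n%:~R * th)); last exact: continuous_cos.
by apply: continuousB; [exact: continuous_gf_phase|exact: contMl].
Qed.

Let T_gt0 : 0 < pi / delta. Proof. by rewrite divr_gt0// pi_gt0. Qed.

Definition fourier_coef k (n : int) : R := \int[mu]_(t in `[- (pi / delta), pi / delta]) fourier_integrand k n t.

Let intble f : continuous f -> mu.-integrable `[- (pi / delta), pi / delta]%classic (EFin \o f).
Proof. exact: continuous_itv_integrable. Qed.

Lemma fourier_coef0 n : fourier_coef 0 n = if n == 0 then 2 * pi / delta else 0.
Proof.
rewrite /fourier_coef /fourier_integrand.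
under eq_Rintegral => t _ do rewrite /gf_modulus /gf_phase !big_ord0 mul1r sub0r cosN mulrA.
case: eqVneq => [->|n0].
  under eq_Rintegral => t _ do rewrite mul0r mul0r cos0.
  have TT := T_gt0.
  pose I : set R := `[- (pi / delta), pi / delta]%classic.
  rewrite [LHS](_ : _ = 1 * fine (mu I)); last exact: Rintegral_cst.
  rewrite lebesgue_measure_itv/= lte_fin ifT; last lra.
  by rewrite mul1r/= ; lra.
apply: integral_cos_symmetric => //.
  by rewrite mulf_neq0 ?intr_eq0// gt_eqF.
have -> : n%:~R * delta * (pi / delta) = n%:~R * pi by field; rewrite gt_eqF.
exact: sin_intmul_pi.
Qed.

(** Multiplying the generating function by [1 - w_k] removes its last factor; on Fourier
coefficients this is the recursion of the partition counts. *)
Lemma fourier_coefS k n :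
  fourier_coef k.+1 n - radius k * fourier_coef k.+1 (n - (a k)%:Z) = fourier_coef k n.
Proof.
have ci := continuous_fourier_integrand.
rewrite /fourier_coef -RintegralZl//; last exact/intble/ci.
have c2 : continuous (fun t : R => radius k * fourier_integrand k.+1 (n - (a k)%:Z) t).
  move=> t; apply: (continuous_comp (f := fourier_integrand k.+1 (n - (a k)%:Z))); first exact: ci.
  exact: contMl.
rewrite -RintegralB//; [|exact/intble/ci|exact/intble/c2].
apply: eq_Rintegral => t _; rewrite /fourier_integrand /gf_modulus /gf_phase !big_ord_recr/=.
rewrite -[in RHS](gf_factor_identity k (delta * t)) -/(radius k).
set p := \prod_(i < k) _; set w := \sum_(i < k) _; set ps := atan _.
rewrite intrB -[((a k)%:Z)%:~R]/((a k)%:R).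
rewrite (_ : w + ps - n%:~R * (delta * t) = w - n%:~R * (delta * t) + ps); last by ring.
rewrite (_ : w + ps - (n%:~R - (a k)%:R) * (delta * t) = w - n%:~R * (delta * t) + ps + (a k)%:R * (delta * t)); last by ring.
ring.
Qed.

Lemma fourier_coef_bounded k : exists B, forall n, `|fourier_coef k n| <= B.
Proof.
exists (\int[mu]_(t in `[- (pi / delta), pi / delta]) gf_modulus k (delta * t)) => n.
have cm : continuous (fun t => gf_modulus k (delta * t)).
  move=> t; apply: (continuous_comp (f := fun t : R => delta * t)); first exact: contMl.
  exact: continuous_gf_modulus.
have ci := @continuous_fourier_integrand k n.
apply: le_trans (le_normr_Rintegral _ _) _ => //; first exact: intble.
apply: le_Rintegral => //.
- by apply: intble => t; apply: continuous_comp; [exact: ci|exact: norm_continuous].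
- exact: intble.
- move=> t _; rewrite /fourier_integrand normrM ger0_norm.
    by rewrite ler_piMr ?cos_max// prodr_ge0// => i _; rewrite invr_ge0 sqrtr_ge0.
  by rewrite prodr_ge0// => i _; rewrite invr_ge0 sqrtr_ge0.
Qed.

Let target k (n : int) : R :=
  if n is Posz m then 2 * pi / delta * (expR (- (s * m%:R)) * (partition_count a k m)%:R) else 0.

Let targetS k n : target k.+1 n - radius k * target k.+1 (n - (a k)%:Z) = target k n.
Proof.
case: n => [m|m]; last first.
  by rewrite /target (_ : Negz m - (a k)%:Z = Negz (m + a k)) ?mulr0 ?subr0//; lia.
rewrite /target (@partition_countS R a a_gt0 a_incr); case: leqP => [am|ma].
  rewrite (_ : m%:Z - (a k)%:Z = (m - a k)%N%:Z); last by rewrite subzn.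
  have -> : expR (- (s * m%:R)) = radius k * expR (- (s * (m - a k)%:R)).
    by rewrite /radius -expRD natrB//; congr expR; ring.
  rewrite natrD; ring.
rewrite (_ : m%:Z - (a k)%:Z = Negz (a k - m).-1) ?mulr0 ?subr0 ?addn0//; lia.
Qed.

(** Both sides obey the same recursion in [k], so their difference satisfies
[D(n) = r_k^j D(n - j a_k)] for every [j]. It is bounded, and [r_k < 1], so it vanishes.
Negative indices [n] have to be included for this descent. *)
Lemma fourier_inversion k (n : nat) :
  fourier_coef k n = 2 * pi / delta * (expR (- (s * n%:R)) * (partition_count a k n)%:R).
Proof.
rewrite -[RHS]/(target k n); move: (n : int) => {n}.
elim: k => [|k IH] n.
  rewrite fourier_coef0; case: n => [[|n]|n] //=; rewrite partition_count0.
    by rewrite mulr0 oppr0 expR0 !mulr1.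
  by rewrite !mulr0.
pose D n := fourier_coef k.+1 n - target k.+1 n.
have Dstep m : D m = radius k * D (m - (a k)%:Z).
  have := IH m; rewrite -fourier_coefS -targetS /D => /eqP.
  by rewrite -subr_eq0 => /eqP h; apply/eqP; rewrite -subr_eq0; apply/eqP; rewrite -[RHS]h; ring.
have Diter j m : D m = radius k ^+ j * D (m - (j * a k)%:Z).
  elim: j m => [|j IHj] m; first by rewrite mul0n subr0 expr0 mul1r.
  rewrite Dstep IHj exprS mulrA; congr (_ * D _).
  by rewrite mulSn PoszD opprD addrA.
have [B hB] := fourier_coef_bounded k.+1.
have /andP[r0 r1] := radius_itv k.
have Dle : forall j, (`|n| < j)%N -> `|D n| <= B * radius k ^+ j.
  move=> j nj; rewrite (Diter j) normrM ger0_norm ?exprn_ge0 ?(ltW r0)// mulrC.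
  rewrite ler_wpM2r ?exprn_ge0 ?(ltW r0)// /D.
  have [m ->] : exists m, n - (j * a k)%:Z = Negz m.
    have : (j <= j * a k)%N by rewrite leq_pmulr.
    by move=> h; exists (`|n - (j * a k)%:Z|.-1)%N; lia.
  by rewrite /target subr0.
apply/eqP; rewrite -subr_eq0 -normr_le0 -/(D n).
have : (fun j => B * radius k ^+ j) @ \oo --> (0 : R).
  by apply: (@cvg_geometric _ B (radius k)); rewrite ger0_norm ?ltW.
move/(ler_cvg_to (cvg_cst `|D n|)); apply.
by exists `|n|.+1 => // j /= nj; apply: Dle.
Qed.
End FourierInversion.

(** * Elementary expansions *)

Lemma mean_value_origin {R : realType} (f df : R -> R) (h0 x : R) :
  (forall y : R, `|y| <= h0 -> is_derive y 1 f (df y)) -> f 0 = 0 -> `|x| <= h0 ->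
  exists2 c, `|c| <= `|x| & f x = df c * x.
Proof.
move=> fd f0 xh.
have dcont (c d : R) : (forall y, c <= y <= d -> `|y| <= h0) -> {within `[c, d], continuous f}.
  move=> cd; apply: derivable_within_continuous => y; rewrite in_itv/= => /cd yh.
  by apply: ex_derive; exact: fd.
have [x0|/ltW x0] := leP 0 x.
  have sub y : 0 <= y <= x -> `|y| <= `|x|.
    by move=> /andP[y0 yx]; rewrite !ger0_norm.
  have sub' y : 0 <= y <= x -> `|y| <= h0 by move=> /sub/le_trans; apply.
  have der (y : R) : y \in `]0, x[ -> is_derive y 1 f (df y).
    by rewrite in_itv/= => /andP[/ltW y0 /ltW yx]; apply: fd; apply: sub'; rewrite y0.
  have [c] := MVT_segment x0 der (dcont _ _ sub').
  by rewrite in_itv/= f0 !subr0 => /sub cx ->; exists c.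
have sub y : x <= y <= 0 -> `|y| <= `|x|.
  by move=> /andP[y0 yx]; rewrite !ler0_norm// lerN2.
have sub' y : x <= y <= 0 -> `|y| <= h0 by move=> /sub/le_trans; apply.
have der (y : R) : y \in `]x, 0[ -> is_derive y 1 f (df y).
  by rewrite in_itv/= => /andP[/ltW y0 /ltW yx]; apply: fd; apply: sub'; rewrite y0.
have [c] := MVT_segment x0 der (dcont _ _ sub').
rewrite in_itv/= f0 !sub0r => /sub cx /eqP; rewrite eqr_oppLR mulrN opprK => /eqP ->.
by exists c.
Qed.

Lemma mvt_pow {R : realType} (f df : R -> R) (C h0 : R) (n : nat) (x : R) :
  (forall y : R, `|y| <= h0 -> is_derive y 1 f (df y)) -> f 0 = 0 -> 0 <= C ->
  (forall y, `|y| <= h0 -> `|df y| <= C * `|y| ^+ n) -> `|x| <= h0 ->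
  `|f x| <= C * `|x| ^+ n.+1.
Proof.
move=> fd f0 C0 dfC xh; have [c cx ->] := mean_value_origin fd f0 xh.
rewrite normrM exprSr mulrA ler_wpM2r//; apply: le_trans (dfC _ (le_trans cx xh)) _.
by rewrite ler_wpM2l// lerXn2r.
Qed.

Section TrigBounds.
Context {R : realType}.
Implicit Types x : R.

Let pow (f df : R -> R) n x : (forall y : R, is_derive y 1 f (df y)) -> f 0 = 0 ->
  (forall y, `|df y| <= `|y| ^+ n) -> `|f x| <= `|x| ^+ n.+1.
Proof.
move=> fd f0 h; rewrite -[leRHS]mul1r; apply: (@mvt_pow R f df 1 `|x| n x) => // y _.
by rewrite mul1r.
Qed.

Lemma abs_sin_le x : `|sin x| <= `|x|.
Proof.
apply: (@pow sin cos 0%N x) => [|y]; first exact: sin0.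
by rewrite expr0 cos_max.
Qed.

Lemma one_sub_cos_le x : `|1 - cos x| <= `|x| ^+ 2.
Proof.
apply: (@pow (fun y => 1 - cos y) sin 1%N x) => [y||y]; last exact: abs_sin_le.
  apply: is_derive_eq; rewrite /GRing.scale/=. ring.
by rewrite cos0 subrr.
Qed.

Lemma sub_sin_le x : `|x - sin x| <= `|x| ^+ 3.
Proof.
apply: (@pow (fun y => y - sin y) (fun y => 1 - cos y) 2%N x) => [|y]; last exact: one_sub_cos_le.
by rewrite sin0 subrr.
Qed.

Lemma cos_taylor2 x : `|cos x - 1 + x ^+ 2 / 2| <= `|x| ^+ 4.
Proof.
apply: (@pow (fun y => cos y - 1 + y ^+ 2 / 2) (fun y => y - sin y) 3%N x) => [y||y]; last exact: sub_sin_le.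
  by apply: is_derive_eq; rewrite /GRing.scale/=; field.
by rewrite cos0; ring.
Qed.

Lemma ln1Dx_ge x : 0 <= x -> x / (1 + x) <= ln (1 + x).
Proof.
move=> x0; have x1 : 0 < 1 + x by lra.
have h : -1 < - (x / (1 + x)) by rewrite ltrN2 ltr_pdivrMr//; lra.
have := le_ln1Dx h.
have -> : 1 + - (x / (1 + x)) = (1 + x)^-1 by field; rewrite gt_eqF.
by rewrite lnV ?posrE// lerN2.
Qed.

Lemma ln1Dx_quadratic x : 0 <= x -> `|ln (1 + x) - x| <= x ^+ 2.
Proof.
move=> x0; have x1 : 0 < 1 + x by lra.
have h1 : ln (1 + x) <= x by apply: le_ln1Dx; lra.
have h2 := ln1Dx_ge x0.
have h3 : x - x ^+ 2 <= x / (1 + x).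
  have : 0 <= x ^+ 2 * x by rewrite mulr_ge0 ?sqr_ge0.
  by rewrite ler_pdivlMr//; lra.
by have := sqr_ge0 x; rewrite ler_norml; lra.
Qed.

Lemma ln1Dx_ge_half x : 0 <= x <= 1 -> x / 2 <= ln (1 + x).
Proof.
move=> /andP[x0 x1]; apply: le_trans (ln1Dx_ge x0).
by rewrite ler_wpM2l// lef_pV2 ?posrE; lra.
Qed.

Lemma taylor_order2 (f f1 f2 f3 : R -> R) (x h0 C h : R) : 0 <= C ->
  (forall y : R, `|y| <= h0 -> is_derive (x + y) 1 f (f1 (x + y))) ->
  (forall y : R, `|y| <= h0 -> is_derive (x + y) 1 f1 (f2 (x + y))) ->
  (forall y : R, `|y| <= h0 -> is_derive (x + y) 1 f2 (f3 (x + y))) ->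
  (forall y, `|y| <= h0 -> `|f3 (x + y)| <= C) -> `|h| <= h0 ->
  `|f (x + h) - f x - f1 x * h - f2 x * h ^+ 2 / 2| <= C * `|h| ^+ 3.
Proof.
move=> C0 d1 d2 d3 fC hh.
have sh (g g' : R -> R) : (forall y : R, `|y| <= h0 -> is_derive (x + y) 1 g (g' (x + y))) ->
  forall y : R, `|y| <= h0 -> is_derive y 1 (fun y => g (x + y)) (g' (x + y)).
  move=> dg y yh; have dgy := dg y yh.
  have dgy' : is_derive ((fun z : R => x + z) y) 1 g (g' (x + y)) by [].
  rewrite (_ : (fun _ => _) = g \o (fun z : R => x + z))//.
  by apply: is_derive_eq; rewrite /GRing.scale/=; ring.
have e2 y : `|y| <= h0 -> `|f2 (x + y) - f2 x| <= C * `|y| ^+ 1.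
  apply: (@mvt_pow R (fun y => f2 (x + y) - f2 x) (fun y => f3 (x + y)) C h0 0 y) => //.
  - move=> z /(sh _ _ d3) dz; apply: is_derive_eq; ring.
  - by rewrite addr0 subrr.
  - by move=> z zh; rewrite expr0 mulr1 fC.
have e1 y : `|y| <= h0 -> `|f1 (x + y) - f1 x - f2 x * y| <= C * `|y| ^+ 2.
  apply: (@mvt_pow R (fun y => f1 (x + y) - f1 x - f2 x * y) (fun y => f2 (x + y) - f2 x) C h0 1 y) => //.
  - move=> z /(sh _ _ d2) dz; apply: is_derive_eq; rewrite /GRing.scale/=; ring.
  - by rewrite addr0; ring.
apply: (@mvt_pow R (fun y => f (x + y) - f x - f1 x * y - f2 x * y ^+ 2 / 2)
  (fun y => f1 (x + y) - f1 x - f2 x * y) C h0 2 h) => //.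
- by move=> z /(sh _ _ d1) dz; apply: is_derive_eq; rewrite /GRing.scale/=; field.
- by rewrite addr0; ring.
Qed.
End TrigBounds.

Section TermBounds.
Context {R : realType}.
Implicit Types x y u : R.

Lemma one_sub_expN_ge x : 0 <= x -> x / (1 + x) <= 1 - expR (- x).
Proof.
move=> x0; have x1 : 0 < 1 + x by lra.
have -> : x / (1 + x) = 1 - (1 + x)^-1 by field; rewrite gt_eqF.
by rewrite lerD2l lerN2 expRN lef_pV2 ?posrE ?expR_gt0// expR_ge1Dx.
Qed.

Lemma expN_lt1 x : 0 < x -> 0 < 1 - expR (- x).
Proof. by move=> x0; rewrite subr_gt0 expR_lt1 oppr_lt0. Qed.

(** [1/(1 - e^(-x)) <= (1 + x)/x], and half of the exponential absorbs the powers of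
[1 + x]. *)
Lemma radius_weight_bound : exists2 K : R, 0 < K & forall (p : nat) x, (p <= 4)%N -> 0 < x ->
  expR (- x) / (1 - expR (- x)) ^+ p <= K * expR (- (x / 2)) / x ^+ p.
Proof.
have [K K0 KE] : exists2 K : R, 0 < K & K = 8 ^+ 4 by exists (8 ^+ 4); rewrite ?exprn_gt0.
exists K => // p x p4 x0; have q0 := expN_lt1 x0.
have x1 : 1 <= 1 + x by lra.
have x1p : 0 < 1 + x by lra.
have h1 : (1 + x) ^+ p <= (1 + x) ^+ 4 by exact: ler_weXn2l.
have h2 : (1 + x) ^+ 4 <= K * expR (x / 2).
  have -> : expR (x / 2) = expR (x / 8) ^+ 4 by rewrite -expRM_natl; congr expR; field.
  rewrite KE -exprMn lerXn2r ?nnegrE ?mulr_ge0 ?expR_ge0 ?(ltW x1p)//.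
  by have := expR_ge1Dx (x / 8); lra.
have h3 : (x / (1 + x)) ^+ p <= (1 - expR (- x)) ^+ p.
  rewrite lerXn2r ?nnegrE ?(ltW q0)//; last exact/one_sub_expN_ge/ltW.
  by rewrite divr_ge0 ?ltW.
have eE : expR (- x) = expR (- (x / 2)) * (expR (x / 2))^-1.
  by rewrite -expRN -expRD; congr expR; field.
move: q0 h3; rewrite [X in X / _ <= _]eE.
move: (1 - expR (- x)) => q q0 h3.
have e0 := expR_gt0 (- (x / 2)); have f0 := expR_gt0 (x / 2).
move: (expR (- (x / 2))) (expR (x / 2)) e0 f0 h2 => E F E0 F0 h2.
rewrite ler_pdivrMr ?exprn_gt0//.
apply: (@le_trans _ _ (K * E / x ^+ p * (x / (1 + x)) ^+ p)); last first.
  by apply: ler_wpM2l => //; apply: divr_ge0; rewrite ?exprn_ge0 ?mulr_ge0 ?(ltW x0) ?(ltW K0) ?(ltW E0).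
have -> : K * E / x ^+ p * (x / (1 + x)) ^+ p = E * (K / (1 + x) ^+ p).
  by rewrite expr_div_n; field; rewrite !expf_neq0 ?gt_eqF.
apply: ler_wpM2l; first exact: ltW.
rewrite ler_pdivlMr ?exprn_gt0// mulrC ler_pdivrMr//.
exact: le_trans h1 h2.
Qed.

Lemma sum_expN_le (a : nat -> nat) y (k : nat) : (forall i, (i < a i)%N) -> 0 < y ->
  \sum_(i < k) expR (- (y * (a i)%:R)) <= y^-1.
Proof.
move=> ia y0.
have key : y * \sum_(i < k) expR (- (y * (a i)%:R)) <= 1 - expR (- (y * k%:R)).
  elim: k => [|k IH]; first by rewrite big_ord0 !mulr0 oppr0 expR0 subrr.
  rewrite big_ord_recr/= mulrDr.
  have h1 : expR (- (y * (a k)%:R)) <= expR (- (y * k.+1%:R)).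
    by rewrite ler_expR lerN2 ler_wpM2l ?ler_nat// ltW.
  have h2 : expR (- (y * k%:R)) = expR (- (y * k.+1%:R)) * expR y.
    by rewrite -expRD -natr1; congr expR; ring.
  have h3 := ler_wpM2l (ltW y0) h1.
  have h4 : y * expR (- (y * k.+1%:R)) <= (expR y - 1) * expR (- (y * k.+1%:R)).
    by rewrite ler_wpM2r ?expR_ge0//; have := expR_ge1Dx y; lra.
  rewrite h2 in IH; move: IH h3 h4; move: (expR (- (y * k.+1%:R))) (\sum_(_ < _) _) (expR (- _)) => E S F.
  lra.
rewrite -(ler_pM2l y0) divff ?gt_eqF//; apply: (le_trans key).
by rewrite gerBl expR_ge0.
Qed.

(** The argument of the logarithm is [|1 - r e^(iu)|^2/(1 - r)^2], so this expands the
decay of one factor of the generating function away from the positive axis. *)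
Lemma ln_modulus_term x u (r := expR (- x)) : 0 < x ->
  `|ln (1 + 2 * r * (1 - cos u) / (1 - r) ^+ 2) - r * u ^+ 2 / (1 - r) ^+ 2|
  <= 6 * (r * `|u| ^+ 4 / (1 - r) ^+ 4).
Proof.
move=> x0; have q0 : 0 < 1 - r := expN_lt1 x0.
have r0 : 0 < r by exact: expR_gt0.
have r1 : r < 1 by rewrite -subr_gt0.
set y := _ / _ ^+ 2.
have c0 : 0 <= 1 - cos u by rewrite subr_ge0 cos_le1.
have q2 : 0 < (1 - r) ^+ 2 by exact: exprn_gt0.
have y0 : 0 <= y by rewrite divr_ge0 ?(ltW q2)// mulr_ge0// mulr_ge0// ltW.
have h1 := ln1Dx_quadratic y0.
have u4 : 0 <= `|u| ^+ 4 by [].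
have h2 : y ^+ 2 <= 4 * (r * `|u| ^+ 4 / (1 - r) ^+ 4).
  have hc : (1 - cos u) ^+ 2 <= `|u| ^+ 4.
    rewrite (exprM _ 2 2) lerXn2r ?nnegrE//.
    by have := one_sub_cos_le u; rewrite ger0_norm.
  have -> : y ^+ 2 = 4 * (r ^+ 2 * (1 - cos u) ^+ 2 / (1 - r) ^+ 4).
    by rewrite /y; field; rewrite gt_eqF.
  rewrite ler_wpM2l// ler_wpM2r ?invr_ge0 ?exprn_ge0 ?(ltW q0)//.
  by rewrite ler_pM ?sqr_ge0// expr2 ler_piMr ?ltW.
have h3 : `|y - r * u ^+ 2 / (1 - r) ^+ 2| <= 2 * (r * `|u| ^+ 4 / (1 - r) ^+ 4).
  have -> : y - r * u ^+ 2 / (1 - r) ^+ 2 = 2 * (r * (- (cos u - 1 + u ^+ 2 / 2)) / (1 - r) ^+ 2).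
    by rewrite /y; field; rewrite gt_eqF.
  rewrite !normrM normrN normfV (ger0_norm (ltW r0)) (ger0_norm (ltW q2)) ger0_norm//.
  rewrite ler_wpM2l// ler_pM ?mulr_ge0 ?invr_ge0 ?(ltW q2) ?(ltW r0)//.
    by rewrite ler_wpM2l ?cos_taylor2// ltW.
  rewrite lef_pV2 ?posrE ?exprn_gt0//.
  by apply: ler_wiXn2l => //; rewrite ?(ltW q0)// lerBlDr lerDl ltW.
move: h1 h2 h3; rewrite !ler_norml => /andP[? ?] ? /andP[? ?]; apply/andP; split; lra.
Qed.

Lemma atan_phase_term x u (r := expR (- x)) : 0 < x ->
  `|atan (r * sin u / (1 - r * cos u)) - r / (1 - r) * u| <= 2 * (r * `|u| ^+ 3 / (1 - r) ^+ 3).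
Proof.
move=> x0; have q0 : 0 < 1 - r := expN_lt1 x0.
have r0 : 0 < r by exact: expR_gt0.
have r1 : r < 1 by rewrite -subr_gt0.
have w0 v : 0 < 1 - r * cos v.
  by rewrite subr_gt0 (le_lt_trans _ r1)// ler_piMr ?cos_le1 ?ltW.
pose D v : R := (1 - r * cos v) ^+ 2 + (r * sin v) ^+ 2.
have D0 v : (1 - r) ^+ 2 <= D v.
  have -> : D v = 1 - 2 * r * cos v + r ^+ 2 * (cos v ^+ 2 + sin v ^+ 2) by rewrite /D; ring.
  rewrite cos2Dsin2; have := cos_le1 v; rewrite -(ler_pM2l r0) mulr1 => h.
  lra.
have q2 : 0 < (1 - r) ^+ 2 by exact: exprn_gt0.
have Dp v : 0 < D v by exact: lt_le_trans (D0 v).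
pose f (v : R) := atan (r * sin v / (1 - r * cos v)) - r / (1 - r) * v.
pose df v := (r * (cos v - r * (cos v ^+ 2 + sin v ^+ 2))) / D v - r / (1 - r).
have fd (v : R) : is_derive v 1 f (df v).
  have wn : (fun t : R => 1 - r * cos t) v != 0 by rewrite gt_eqF.
  apply: is_derive_eq; rewrite /df /GRing.scale/= /D.
  have := Dp v; rewrite /D => Dv; field.
  by rewrite !gt_eqF//= addrC.
have dfE v : df v = - (r * (1 + r) * (1 - cos v) / ((1 - r) * D v)).
  rewrite /df cos2Dsin2 mulr1.
  have E : D v = 1 - 2 * r * cos v + r ^+ 2.
    by transitivity (1 - 2 * r * cos v + r ^+ 2 * (cos v ^+ 2 + sin v ^+ 2)); rewrite /D; [ring|rewrite cos2Dsin2 mulr1].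
  have := Dp v; rewrite E => Dv; field.
  by rewrite !gt_eqF.
have dfb v : `|df v| <= 2 * (r / (1 - r) ^+ 3) * `|v| ^+ 2.
  have c0 : 0 <= 1 - cos v by rewrite subr_ge0 cos_le1.
  have c1 : 1 - cos v <= `|v| ^+ 2 by have := one_sub_cos_le v; rewrite ger0_norm.
  have p0 : 0 <= r * (1 + r) * (1 - cos v) by rewrite !mulr_ge0 ?(ltW r0)//; lra.
  rewrite dfE normrN ger0_norm; last by apply: divr_ge0 => //; rewrite mulr_ge0 ?(ltW q0) ?(ltW (Dp v)).
  apply: (@le_trans _ _ (r * (1 + r) * (1 - cos v) / (1 - r) ^+ 3)).
    rewrite ler_wpM2l// lef_pV2 ?posrE ?mulr_gt0 ?exprn_gt0//.
    by rewrite exprS ler_wpM2l ?(ltW q0).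
  rewrite [leRHS](_ : _ = (r * 2 * `|v| ^+ 2) / (1 - r) ^+ 3); last by ring.
  rewrite ler_wpM2r ?invr_ge0 ?exprn_ge0 ?(ltW q0)//.
  apply: ler_pM => //; first by rewrite mulr_ge0; lra.
  by rewrite ler_wpM2l ?(ltW r0)//; lra.
rewrite (_ : 2 * _ = 2 * (r / (1 - r) ^+ 3) * `|u| ^+ 3); last by ring.
apply: (@mvt_pow R f df _ `|u| 2 u) => //.
- by rewrite /f sin0 mulr0 mul0r atan0 mulr0 subr0.
- by rewrite mulr_ge0// divr_ge0 ?exprn_ge0 ?(ltW r0) ?(ltW q0).
Qed.

Lemma log_gf_term_taylor : exists2 K : R, 0 < K & forall x h (r := expR (- x)), 0 < x -> `|h| <= x / 2 ->
  `|- ln (1 - expR (- (x + h))) + ln (1 - r) + r / (1 - r) * h - r / (1 - r) ^+ 2 * h ^+ 2 / 2|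
   <= K * expR (- (x / 4)) / x ^+ 3 * `|h| ^+ 3.
Proof.
have [K0 K00 hK0] := radius_weight_bound.
have [K Kp KE] : exists2 K : R, 0 < K & K = 2 * 8 * K0 by exists (2 * 8 * K0); rewrite // !mulr_gt0.
exists K; first exact: Kp.
move=> x h r x0 hx.
pose f (v : R) := - ln (1 - expR (- v)).
pose f1 (v : R) := - (expR (- v) / (1 - expR (- v))).
pose f2 (v : R) := expR (- v) / (1 - expR (- v)) ^+ 2.
pose f3 (v : R) := - (expR (- v) * (1 + expR (- v)) / (1 - expR (- v)) ^+ 3).
have pos y : `|y| <= x / 2 -> x / 2 <= x + y by rewrite ler_norml => /andP[? ?]; lra.
have q0 v : x / 2 <= v -> 0 < 1 - expR (- v) by move=> h0; apply: expN_lt1; lra.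
have d1 (v : R) : x / 2 <= v -> is_derive v 1 f (f1 v).
  move=> /q0 vq.
  have lnD : is_derive ((fun z : R => 1 - expR (- z)) v) 1 (@ln R) (1 - expR (- v))^-1.
    exact: is_derive1_ln.
  have -> : f = (fun z => - ((@ln R) \o (fun z : R => 1 - expR (- z))) z) by [].
  by apply: is_derive_eq; rewrite /f1 /GRing.scale/=; field; rewrite gt_eqF.
have d2 (v : R) : x / 2 <= v -> is_derive v 1 f1 (f2 v).
  move=> /q0 vq.
  have wn : (fun z : R => 1 - expR (- z)) v != 0 by rewrite gt_eqF.
  by apply: is_derive_eq; rewrite /f2 /GRing.scale/=; field; rewrite gt_eqF.
have d3 (v : R) : x / 2 <= v -> is_derive v 1 f2 (f3 v).
  move=> /q0 vq.
  have wn : (fun z : R => (1 - expR (- z)) ^+ 2) v != 0 by rewrite expf_neq0// gt_eqF.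
  by apply: is_derive_eq; rewrite /f3 /GRing.scale/=; field; rewrite gt_eqF.
have C0 : 0 <= K * expR (- (x / 4)) / x ^+ 3.
  by apply: divr_ge0; rewrite ?exprn_ge0 ?mulr_ge0 ?expR_ge0 ?(ltW x0) ?(ltW Kp).
have := @taylor_order2 R f f1 f2 f3 x (x / 2) (K * expR (- (x / 4)) / x ^+ 3) h C0
  (fun y yh => d1 _ (pos y yh)) (fun y yh => d2 _ (pos y yh)) (fun y yh => d3 _ (pos y yh)) _ hx.
rewrite {1 2}/f {1}/f1 {1}/f2 -/r => H.
rewrite (_ : _ - _ = - ln (1 - expR (- (x + h))) - - ln (1 - r) - - (r / (1 - r)) * h -
   r / (1 - r) ^+ 2 * h ^+ 2 / 2); last by ring.
apply: H.
move=> y /pos xy; have v0 : 0 < x + y by lra.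
  have yq := q0 _ xy.
  have e1 : expR (- (x + y)) <= 1 by rewrite expR_le1; lra.
  rewrite /f3 normrN ger0_norm; last first.
    by rewrite divr_ge0 ?exprn_ge0 ?(ltW yq)// mulr_ge0 ?expR_ge0// addr_ge0 ?expR_ge0.
  have b1 := hK0 3%N _ isT v0.
  apply: (@le_trans _ _ (2 * (expR (- (x + y)) / (1 - expR (- (x + y))) ^+ 3))).
    rewrite mulrA ler_wpM2r ?invr_ge0 ?exprn_ge0 ?(ltW yq)// [leRHS]mulrC.
    by rewrite ler_wpM2l ?expR_ge0//; lra.
  apply: (@le_trans _ _ (2 * (K0 * expR (- (x / 4)) / (x / 2) ^+ 3))); last first.
    by rewrite KE le_eqVlt; apply/orP; left; apply/eqP; field; rewrite gt_eqF.
  rewrite ler_wpM2l//; apply: (le_trans b1).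
  rewrite ler_pM ?mulr_ge0 ?invr_ge0 ?exprn_ge0 ?expR_ge0 ?(ltW v0) ?(ltW K00)//.
    by rewrite ler_wpM2l ?(ltW K00)// ler_expR; lra.
  rewrite lef_pV2 ?posrE ?exprn_gt0//; last lra.
  by rewrite lerXn2r ?nnegrE//; lra.
Qed.
End TermBounds.

(** * Cumulant expansion of the generating function *)

Section GfSums.
Context {R : realType}.
Variable a : nat -> nat.
Hypothesis a_ge : forall i, (i < a i)%N.
Implicit Types (s th d : R) (k : nat).

Definition log_gf s k : R := \sum_(i < k) - ln (1 - radius a s i).
(** Mean of the sum of the parts of a random partition weighted by [e^(-s n)]; it is minus
the [s]-derivative of the logarithm of the generating function, and [gf_var] the second
derivative. *)
Definition gf_mean s k : R :=
  \sum_(i < k) (a i)%:R * (radius a s i / (1 - radius a s i)).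
Definition gf_var s k : R :=
  \sum_(i < k) (a i)%:R ^+ 2 * (radius a s i / (1 - radius a s i) ^+ 2).
(** [2 log (G(|z|)/|G(z)|)] at [z = e^(-s + i th)]. *)
Definition log_decay s k th : R :=
  \sum_(i < k) ln (1 + 2 * radius a s i * (1 - cos ((a i)%:R * th)) / (1 - radius a s i) ^+ 2).

Let a_gt0 i : 0 < (a i)%:R :> R. Proof. by rewrite ltr0n (leq_ltn_trans _ (a_ge i)). Qed.

Let sa_gt0 s i : 0 < s -> 0 < s * (a i)%:R. Proof. by move=> s0; rewrite mulr_gt0. Qed.

Lemma one_sub_radius_gt0 s i : 0 < s -> 0 < 1 - radius a s i.
Proof. by move=> s0; rewrite /radius expN_lt1// sa_gt0. Qed.

Lemma decay_term_ge0 s i th : 0 < s ->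
  0 <= 2 * radius a s i * (1 - cos ((a i)%:R * th)) / (1 - radius a s i) ^+ 2.
Proof.
move=> s0; rewrite divr_ge0 ?exprn_ge0 ?(ltW (one_sub_radius_gt0 i s0))//.
by rewrite mulr_ge0 ?subr_ge0 ?cos_le1// mulr_ge0// ltW// expR_gt0.
Qed.

Lemma gf_modulusE s k th : 0 < s ->
  gf_modulus a s k th = expR (log_gf s k - log_decay s k th / 2).
Proof.
move=> s0; rewrite /gf_modulus /log_gf /log_decay mulr_suml -sumrB expR_sum.
apply: eq_bigr => i _; have q0 := one_sub_radius_gt0 i s0.
have y0 := decay_term_ge0 i th s0.
set y := (_ / _ ^+ 2) in y0 *; have y1 : 0 < 1 + y by lra.
have -> : sqdist a s i th = (1 - radius a s i) ^+ 2 * (1 + y).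
  by rewrite /sqdist /y; field; rewrite gt_eqF.
rewrite sqrtrM ?exprn_ge0 ?(ltW q0)// sqrtr_sqr ger0_norm ?(ltW q0)//.
have -> : Num.sqrt (1 + y) = expR (ln (1 + y) / 2).
  rewrite -[1 + y in LHS]lnK ?posrE// {1}(_ : ln (1 + y) = ln (1 + y) / 2 * 2%:R); last by field.
  by rewrite expRM_natr sqrtr_sqr ger0_norm ?expR_ge0.
by rewrite expRD !expRN lnK ?posrE// invfM.
Qed.

Let sum_bound (F : nat -> R) s (C c : R) k : 0 < s -> 0 <= C -> 0 < c ->
  (forall i, `|F i| <= C * expR (- (c * s * (a i)%:R))) -> `|\sum_(i < k) F i| <= C / (c * s).
Proof.
move=> s0 C0 c0 FC; apply: (le_trans (ler_norm_sum _ _ _)).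
apply: (@le_trans _ _ (\sum_(i < k) C * expR (- (c * s * (a i)%:R)))); first exact: ler_sum.
by rewrite -mulr_sumr ler_wpM2l// sum_expN_le// mulr_gt0.
Qed.

(** Termwise expansion: about [1/s] parts, of size about [1/s], have a noticeable weight,
and each contributes a remainder [O(th^4/s^4)]. *)
Lemma log_decay_quadratic : exists2 K : R, 0 < K & forall s k th, 0 < s ->
  `|log_decay s k th - gf_var s k * th ^+ 2| <= K * `|th| ^+ 4 / s ^+ 5.
Proof.
have [K0 K00 hK] := @radius_weight_bound R; exists (12 * K0) => [|s k th s0].
  by rewrite mulr_gt0.
rewrite /log_decay /gf_var mulr_suml -sumrB.
have -> : 12 * K0 * `|th| ^+ 4 / s ^+ 5 = (6 * K0 * `|th| ^+ 4 / s ^+ 4) / (2^-1 * s).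
  by field; rewrite gt_eqF.
have C0 : 0 <= 6 * K0 * `|th| ^+ 4 / s ^+ 4.
  by apply: divr_ge0; rewrite ?exprn_ge0 ?mulr_ge0 ?(ltW s0) ?(ltW K00).
have half : 0 < 2^-1 :> R by [].
apply: (sum_bound (F := fun i => ln (1 + 2 * radius a s i * (1 - cos ((a i)%:R * th)) / (1 - radius a s i) ^+ 2)
  - (a i)%:R ^+ 2 * (radius a s i / (1 - radius a s i) ^+ 2) * th ^+ 2) k s0 C0 half) => i.
have := ln_modulus_term ((a i)%:R * th) (sa_gt0 i s0); rewrite -/(radius a s i).
have -> : radius a s i * ((a i)%:R * th) ^+ 2 / (1 - radius a s i) ^+ 2 =
  (a i)%:R ^+ 2 * (radius a s i / (1 - radius a s i) ^+ 2) * th ^+ 2 by ring.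
move/le_trans; apply.
have := hK 4%N _ isT (sa_gt0 i s0); rewrite -/(radius a s i) => h.
have A0 := a_gt0 i.
have p0 : 0 <= 6 * `|(a i)%:R * th| ^+ 4 by rewrite mulr_ge0.
rewrite (_ : 6 * (radius a s i * `|(a i)%:R * th| ^+ 4 / (1 - radius a s i) ^+ 4) =
  6 * `|(a i)%:R * th| ^+ 4 * (radius a s i / (1 - radius a s i) ^+ 4)); last by ring.
apply: (le_trans (ler_wpM2l p0 h)).
rewrite normrM normr_nat (_ : - (s * (a i)%:R / 2) = - (2^-1 * s * (a i)%:R)); last by ring.
by rewrite le_eqVlt; apply/orP; left; apply/eqP; field; rewrite !gt_eqF.
Qed.

Lemma gf_phase_linear : exists2 K : R, 0 < K & forall s k th, 0 < s ->
  `|gf_phase a s k th - gf_mean s k * th| <= K * `|th| ^+ 3 / s ^+ 4.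
Proof.
have [K0 K00 hK] := @radius_weight_bound R; exists (4 * K0) => [|s k th s0].
  by rewrite mulr_gt0.
rewrite /gf_phase /gf_mean mulr_suml -sumrB.
have -> : 4 * K0 * `|th| ^+ 3 / s ^+ 4 = (2 * K0 * `|th| ^+ 3 / s ^+ 3) / (2^-1 * s).
  by field; rewrite gt_eqF.
have C0 : 0 <= 2 * K0 * `|th| ^+ 3 / s ^+ 3.
  by apply: divr_ge0; rewrite ?exprn_ge0 ?mulr_ge0 ?(ltW s0) ?(ltW K00).
have half : 0 < 2^-1 :> R by [].
apply: (sum_bound (F := fun i => atan (radius a s i * sin ((a i)%:R * th) / (1 - radius a s i * cos ((a i)%:R * th)))
  - (a i)%:R * (radius a s i / (1 - radius a s i)) * th) k s0 C0 half) => i.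
have := atan_phase_term ((a i)%:R * th) (sa_gt0 i s0); rewrite -/(radius a s i).
have -> : radius a s i / (1 - radius a s i) * ((a i)%:R * th) =
  (a i)%:R * (radius a s i / (1 - radius a s i)) * th by ring.
move/le_trans; apply.
have := hK 3%N _ isT (sa_gt0 i s0); rewrite -/(radius a s i) => h.
have A0 := a_gt0 i.
have p0 : 0 <= 2 * `|(a i)%:R * th| ^+ 3 by rewrite mulr_ge0.
rewrite (_ : 2 * (radius a s i * `|(a i)%:R * th| ^+ 3 / (1 - radius a s i) ^+ 3) =
  2 * `|(a i)%:R * th| ^+ 3 * (radius a s i / (1 - radius a s i) ^+ 3)); last by ring.
apply: (le_trans (ler_wpM2l p0 h)).
rewrite normrM normr_nat (_ : - (s * (a i)%:R / 2) = - (2^-1 * s * (a i)%:R)); last by ring.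
by rewrite le_eqVlt; apply/orP; left; apply/eqP; field; rewrite !gt_eqF.
Qed.

(** This allows mean and variance to be recovered from values of [log_gf] at nearby
points, so that an asymptotic formula for [log_gf] alone determines the saddle point. *)
Lemma log_gf_taylor : exists2 K : R, 0 < K & forall s k d, 0 < s -> `|d| <= s / 2 ->
  `|log_gf (s + d) k - log_gf s k + gf_mean s k * d - gf_var s k * d ^+ 2 / 2|
  <= K * `|d| ^+ 3 / s ^+ 4.
Proof.
have [K0 K00 hK] := @log_gf_term_taylor R; exists (4 * K0) => [|s k d s0 ds].
  by rewrite mulr_gt0.
have -> : 4 * K0 * `|d| ^+ 3 / s ^+ 4 = (K0 * `|d| ^+ 3 / s ^+ 3) / (4^-1 * s).
  by field; rewrite gt_eqF.
have C0 : 0 <= K0 * `|d| ^+ 3 / s ^+ 3.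
  by apply: divr_ge0; rewrite ?exprn_ge0 ?mulr_ge0 ?(ltW s0) ?(ltW K00).
have quarter : 0 < 4^-1 :> R by [].
rewrite /log_gf /gf_mean /gf_var !mulr_suml -sumrB -big_split/= -sumrB.
apply: (sum_bound (F := fun i => - ln (1 - radius a (s + d) i) - - ln (1 - radius a s i)
  + (a i)%:R * (radius a s i / (1 - radius a s i)) * d
  - (a i)%:R ^+ 2 * (radius a s i / (1 - radius a s i) ^+ 2) * d ^+ 2 / 2) k s0 C0 quarter) => i.
have A0 := a_gt0 i.
have hd : `|(a i)%:R * d| <= s * (a i)%:R / 2.
  rewrite normrM normr_nat (_ : s * (a i)%:R / 2 = (a i)%:R * (s / 2)); last by ring.
  by rewrite ler_wpM2l// ltW.
have := hK _ _ (sa_gt0 i s0) hd; rewrite -/(radius a s i).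
rewrite (_ : s * (a i)%:R + (a i)%:R * d = (s + d) * (a i)%:R); last by ring.
rewrite -/(radius a (s + d) i).
rewrite [X in `|X| <= _](_ : _ = - ln (1 - radius a (s + d) i) - - ln (1 - radius a s i)
  + (a i)%:R * (radius a s i / (1 - radius a s i)) * d
  - (a i)%:R ^+ 2 * (radius a s i / (1 - radius a s i) ^+ 2) * d ^+ 2 / 2); last by ring.
move/le_trans; apply.
rewrite normrM normr_nat (_ : - (s * (a i)%:R / 4) = - (4^-1 * s * (a i)%:R)); last by ring.
by rewrite le_eqVlt; apply/orP; left; apply/eqP; field; rewrite !gt_eqF.
Qed.
End GfSums.

Section ShiftSums.
Context {R : realType}.
Implicit Types (S : nat -> R).

Lemma sin_sq_sub_le (x y : R) : sin (x - y) ^+ 2 <= 2 * (sin x ^+ 2 + sin y ^+ 2).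
Proof.
rewrite sinB; have := cos2Dsin2 x; have := cos2Dsin2 y.
move: (sin x) (sin y) (cos x) (cos y) => a b c d h1 h2.
have d2 : d ^+ 2 <= 1 by rewrite -h1 lerDl sqr_ge0.
have c2 : c ^+ 2 <= 1 by rewrite -h2 lerDl sqr_ge0.
have e1 : (a * d) ^+ 2 <= a ^+ 2 by rewrite exprMn ler_piMr ?sqr_ge0.
have e2 : (c * b) ^+ 2 <= b ^+ 2 by rewrite exprMn ler_piMl ?sqr_ge0.
have := sqr_ge0 (a * d + c * b).
have -> : (a * d - c * b) ^+ 2 = 2 * (a * d) ^+ 2 + 2 * (c * b) ^+ 2 - (a * d + c * b) ^+ 2 by ring.
lra.
Qed.

Lemma sum_shift_le S (m h l : nat) : (forall i, 0 <= S i) -> (l <= h)%N ->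
  \sum_(i < m - h) S (i + l)%N <= \sum_(i < m) S i.
Proof.
move=> S0 lh; have [mh|/ltnW hm] := leqP m h.
  by rewrite (eqP (_ : m - h == 0)%N) ?subn_eq0// big_ord0 sumr_ge0.
rewrite -(big_mkord xpredT S) -(big_mkord xpredT (fun i => S (i + l)%N)).
have -> : \sum_(0 <= i < m - h) S (i + l)%N = \sum_(l <= i < m - h + l) S i.
  by rewrite [RHS](_ : _ = \sum_(0 + l <= i < m - h + l) S i)// [in RHS]big_addn addnK.
have l1 : (l <= m - h + l)%N by exact: leq_addl.
have l2 : (m - h + l <= m)%N by rewrite -[leqRHS](subnK hm) leq_add2l.
rewrite [leRHS](big_cat_nat (leq0n l) (leq_trans l1 l2))/=.
rewrite [X in _ <= _ + X](big_cat_nat l1 l2)/= addrCA lerDl.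
by apply: addr_ge0; apply: sumr_ge0 => i _; exact: S0.
Qed.
End ShiftSums.

(** * Minor arcs *)

Section MinorArcs.
Context {R : realType}.
Variable alpha : R.
Hypotheses (alpha_gt1 : 1 < alpha) (alpha_irr : irrational alpha).
Local Notation a := (beatty_part alpha).
Implicit Types (th s : R) (m i j h l : nat).

Let alpha_gt0 : 0 < alpha. Proof. exact: lt_trans alpha_gt1. Qed.

Let S th i : R := sin ((a i)%:R * th / 2) ^+ 2.
Let S_ge0 th i : 0 <= S th i. Proof. exact: sqr_ge0. Qed.

Let a_shift i h : (a (i + h))%:R - (a i)%:R =
  alpha * h%:R + (frac (alpha * i.+1%:R) - frac (alpha * (i + h).+1%:R)) :> R.
Proof.
rewrite !beatty_part_frac// -addSn natrD mulrDr; ring.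
Qed.

Let a_shift_itv i h : alpha * h%:R - 1 < (a (i + h))%:R - (a i)%:R < alpha * h%:R + 1.
Proof.
rewrite a_shift; have := frac_ge0 (alpha * i.+1%:R); have := frac_lt1 (alpha * i.+1%:R).
have := frac_ge0 (alpha * (i + h).+1%:R); have := frac_lt1 (alpha * (i + h).+1%:R).
move: (frac _) (frac _) (alpha * h%:R) => x y z; lra.
Qed.

Lemma sin_ge_half (w : R) : 0 <= w <= 2^-1 -> w / 2 <= sin w.
Proof.
move=> /andP[w0 w1]; have := sub_sin_le w; rewrite ler_norml (ger0_norm w0) => /andP[_ h].
have : w ^+ 3 <= w / 4.
  rewrite exprS ler_wpM2l//; have : w ^+ 2 <= 2^-1 ^+ 2 by rewrite lerXn2r ?nnegrE.
  lra.
lra.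
Qed.

Let sin_pair (x y : R) (e : R) : 0 <= e -> e <= sin (x - y) ->
  e ^+ 2 / 2 <= sin x ^+ 2 + sin y ^+ 2.
Proof.
move=> e0 h; have : e ^+ 2 <= sin (x - y) ^+ 2 by rewrite lerXn2r ?nnegrE ?(le_trans e0).
have := sin_sq_sub_le x y; lra.
Qed.

(** Two parts that are [h] steps apart, with [alpha h th] near [1/4], have angles
[a_i th/2] whose difference stays between [1/16] and [1/2]; their sines cannot both be
small. *)
Lemma minor_arc_small m th : (8 <= m)%N -> 0 < th -> th <= (4 * (alpha + 1))^-1 ->
  (alpha * m.+1%:R)^-1 <= th -> 32^-1 ^+ 2 / 8 * m%:R <= \sum_(i < m) S th i.
Proof.
move=> m8 th0 th1 th2; have ag1 := alpha_gt1.
have ap1 : 0 < alpha + 1 by rewrite addr_gt0.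
have th1' : (alpha + 1) * th <= 4^-1.
  have := ler_wpM2l (ltW ap1) th1; move=> /le_trans; apply; by rewrite le_eqVlt; apply/orP; left; apply/eqP; field; rewrite gt_eqF.
have m1 : 0 < m.+1%:R :> R by [].
have th2' : 1 <= alpha * th * m.+1%:R.
  have := ler_wpM2l (ltW (mulr_gt0 alpha_gt0 m1)) th2; rewrite divff; last by rewrite gt_eqF// mulr_gt0.
  by move/le_trans; apply; rewrite le_eqVlt; apply/orP; left; apply/eqP; ring.
clear th1 th2.
have th8 : th <= 8^-1.
  have : 2 * th <= (alpha + 1) * th by rewrite ler_wpM2r ?(ltW th0)//; lra.
  lra.
pose q := (4 * alpha * th)^-1.
have at0 : 0 < alpha * th by rewrite mulr_gt0.
have qE : alpha * th * q = 4^-1 by rewrite /q; field; rewrite !gt_eqF.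
have q0 : 0 <= q by rewrite invr_ge0 -mulrA mulr_ge0 ?(ltW at0).
pose h := (Num.truncn q).+1.
have /andP[hq1 hq2] := truncn_itv q0.
have hq : h%:R <= q + 1 by rewrite /h -natr1 lerD2r.
have at1 : alpha * th * h%:R <= 4^-1 + alpha * th.
  by have := ler_wpM2l (ltW at0) hq; rewrite mulrDr mulr1 qE.
have at2 : 4^-1 < alpha * th * h%:R by rewrite -qE ltr_pM2l.
have qm : q <= m.+1%:R / 4.
  rewrite -(ler_pM2l at0) qE.
  have -> : alpha * th * (m.+1%:R / 4) = alpha * th * m.+1%:R / 4 by ring.
  by rewrite -[leLHS]mul1r ler_wpM2r.
have hm : h%:R <= m%:R / 2 :> R.
  have m8' : 8 <= m%:R :> R by rewrite ler_nat.
  move: qm; rewrite -natr1; lra.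
have hm' : (h <= m)%N.
  have : h%:R <= m%:R :> R by have : 0 <= m%:R :> R by []; lra.
  by rewrite ler_nat.
have pairS i : 32^-1 ^+ 2 / 2 <= S th (i + h) + S th i.
  apply: sin_pair; first by rewrite invr_ge0.
  have -> : (a (i + h))%:R * th / 2 - (a i)%:R * th / 2 = ((a (i + h))%:R - (a i)%:R) * th / 2 by ring.
  have /andP[d1 d2] := a_shift_itv i h.
  set D := ((a (i + h))%:R - (a i)%:R : R) in d1 d2 *.
  have e1 : alpha * th * h%:R - th <= D * th.
    rewrite (_ : _ - _ = (alpha * h%:R - 1) * th); last by ring.
    by rewrite ler_wpM2r ?ltW.
  have e2 : D * th <= alpha * th * h%:R + th.
    rewrite (_ : _ + _ = (alpha * h%:R + 1) * th); last by ring.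
    by rewrite ler_wpM2r ?ltW.
  have e3 : alpha * th + th <= 4^-1 by rewrite -{2}[th]mul1r -mulrDl.
  have w1 : 16^-1 <= D * th / 2 by move: e1 at2 th8; move: (alpha * th * h%:R) (D * th) => X Y; lra.
  have w2 : D * th / 2 <= 2^-1.
    by move: e2 at1 e3; move: (alpha * th * h%:R) (D * th) (alpha * th) => X Y Z; lra.
  have := @sin_ge_half (D * th / 2).
  move: w1 w2; move: (D * th / 2) => w w1 w2 H.
  have w0 : 0 <= w by apply: le_trans w1; rewrite invr_ge0.
  by have := H ltac:(by rewrite w0); move: w1; move: (sin w) => sw; lra.
have sumS : \sum_(i < m - h) (32^-1 ^+ 2 / 2) <= \sum_(i < m - h) (S th (i + h) + S th i).
  by apply: ler_sum => i _; exact: pairS.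
rewrite big_split/= in sumS.
have s1 := sum_shift_le (S := S th) m (S_ge0 th) (leqnn h).
have s2 := sum_shift_le (S := S th) m (S_ge0 th) (leq0n h).
rewrite (eq_bigr (fun i : 'I_(m - h) => S th i)) in s2; last by move=> i _; rewrite addn0.
move: sumS; rewrite sumr_const card_ord -[X in X <= _]mulr_natl natrB// => sumS.
have := le_trans sumS (lerD s1 s2).
have c0 : 0 <= 32^-1 ^+ 2 :> R by exact: sqr_ge0.
have hm2 : m%:R / 2 <= m%:R - h%:R :> R by move: hm; lra.
have := ler_wpM2l c0 hm2.
move: (32^-1 ^+ 2) (\sum_(i < m) _) c0 => c T c0; lra.
Qed.

Let k := Num.truncn alpha.

Let k_itv : k%:R < alpha < k.+1%:R.
Proof.
have /andP[h1 h2] := truncn_itv (ltW alpha_gt0); rewrite h2 andbT lt_neqAle h1 andbT.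
apply/eqP => e; apply: alpha_irr; apply/rationalP; exists (Posz k), 1%N.
by rewrite divr1 -e.
Qed.

Let step i : a i.+1 = (a i + k)%N \/ a i.+1 = (a i + k.+1)%N.
Proof.
have /andP[k1 k2] := k_itv; have /andP[] := a_shift_itv i 1; rewrite addn1 mulr1 => h1 h2.
have : (a i + k < a i.+1 + 1)%N by rewrite -(ltr_nat R) !natrD; lra.
have : (a i.+1 < a i + k.+1 + 1)%N by rewrite -(ltr_nat R) !natrD; lra.
rewrite !addn1 !ltnS addnS leq_eqVlt => /orP[/eqP|]; first by right.
by rewrite ltnS => u v; left; apply/eqP; rewrite eqn_leq u.
Qed.

(** A run of [L] equal gaps would move [a (i + L) - a i] away from [alpha L] by 1 or more,
since [alpha] lies strictly between the two possible gaps [k] and [k + 1]. *)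
Let both_steps : exists L, forall i, (exists2 j, (j < L)%N & a (i + j).+1 = (a (i + j) + k)%N) /\
  (exists2 j, (j < L)%N & a (i + j).+1 = (a (i + j) + k.+1)%N).
Proof.
have /andP[k1 k2] := k_itv.
have [L [L1 L2]] : exists L : nat, 1 <= (alpha - k%:R) * L%:R /\ 1 <= (k.+1%:R - alpha) * L%:R.
  have p1 : 0 < alpha - k%:R by lra.
  have p2 : 0 < k.+1%:R - alpha by lra.
  near \oo => L; exists L; split.
    by rewrite mulrC -ler_pdivrMr//; near: L; exact: nbhs_infty_ger.
  by rewrite mulrC -ler_pdivrMr//; near: L; exact: nbhs_infty_ger.
exists L => i; have /andP[A1 A2] := a_shift_itv i L.
split; apply: contrapT => N.
  have H j : (j <= L)%N -> a (i + j) = (a i + k.+1 * j)%N.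
    elim: j => [|j IH] jL; first by rewrite addn0 muln0 addn0.
    rewrite addnS; case: (step (i + j)) => e; first by case: N; exists j.
    by rewrite e IH ?(ltnW jL)// mulnS; ring.
  move: A2; rewrite (H _ (leqnn L)) natrD natrM.
  move: L2; rewrite mulrBl; move: (k.+1%:R * L%:R) (alpha * L%:R) => x y; lra.
have H j : (j <= L)%N -> a (i + j) = (a i + k * j)%N.
  elim: j => [|j IH] jL; first by rewrite addn0 muln0 addn0.
  rewrite addnS; case: (step (i + j)) => e; last by case: N; exists j.
  by rewrite e IH ?(ltnW jL)// mulnS; ring.
move: A1; rewrite (H _ (leqnn L)) natrD natrM.
move: L1; rewrite mulrBl; move: (k%:R * L%:R) (alpha * L%:R) => x y; lra.
Unshelve. all: by end_near. Qed.

(** If all angles [a_i th/2] in a window were near multiples of [pi], so would be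
[k th/2] and [(k + 1) th/2], hence [th/2], whose sine is at least [sin (th0/2)]. This is
where the irrationality of [alpha] enters: parts in a proper progression
would resonate. *)
Lemma minor_arc_large th0 : 0 < th0 <= pi -> exists2 c, 0 < c & exists M0, forall m th, (M0 <= m)%N ->
  th0 <= th <= pi -> c * m%:R <= \sum_(i < m) S th i.
Proof.
move=> /andP[t0 tpi]; have [L hL] := both_steps.
pose c0 := sin (th0 / 2) ^+ 2.
have s0 : 0 < sin (th0 / 2) by apply: sin_gt0_pi; lra.
have c00 : 0 < c0 by rewrite exprn_gt0.
exists (c0 / 32 / L.+1%:R); first by rewrite !divr_gt0.
exists (2 * L)%N => m th mL /andP[th1 th2].
pose w i := \sum_(l < L.+1) S th (i + l).
have Sw i l : (l <= L)%N -> S th (i + l) <= w i.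
  move=> lL; rewrite /w (bigD1 (inord l))//= inordK// lerDl sumr_ge0//.
have w_ge i : c0 / 16 <= w i.
  have [[j1 j1L e1] [j2 j2L e2]] := hL i.
  have hs : c0 <= sin (th / 2) ^+ 2.
    rewrite lerXn2r ?nnegrE ?(ltW s0)//.
      by apply: sin_ge0_pi; have := @pi_gt0 R; lra.
    have [->//|ne] := eqVneq th0 th.
    have hlt : th0 < th by rewrite lt_neqAle ne.
    have hpi := @pi_gt0 R.
    have i1 : th0 / 2 \in `[- (pi / 2), pi / 2] by rewrite in_itv/=; lra.
    have i2 : th / 2 \in `[- (pi / 2), pi / 2] by rewrite in_itv/=; lra.
    by apply: ltW; rewrite ltr_sin//; lra.
  have d1 : (a (i + j1).+1)%:R * th / 2 - (a (i + j1))%:R * th / 2 = k%:R * th / 2.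
    by rewrite e1 natrD; ring.
  have d2 : (a (i + j2).+1)%:R * th / 2 - (a (i + j2))%:R * th / 2 = k%:R * th / 2 + th / 2.
    by rewrite e2 natrD -natr1; ring.
  have b1 := sin_sq_sub_le ((a (i + j1).+1)%:R * th / 2) ((a (i + j1))%:R * th / 2).
  have b2 := sin_sq_sub_le ((a (i + j2).+1)%:R * th / 2) ((a (i + j2))%:R * th / 2).
  have b3 := sin_sq_sub_le (k%:R * th / 2 + th / 2) (k%:R * th / 2).
  rewrite d1 in b1; rewrite d2 in b2; rewrite addrC addKr in b3.
  have u1 := Sw i j1 (ltnW j1L); have u2 := Sw i j2 (ltnW j2L).
  have u3 := Sw i j1.+1 j1L; have u4 := Sw i j2.+1 j2L.
  rewrite addnS in u3; rewrite addnS in u4; rewrite /S in u1 u2 u3 u4.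
  lra.
have sum_w : \sum_(i < m - L) w i <= L.+1%:R * \sum_(i < m) S th i.
  rewrite /w exchange_big/= -[X in X * _](_ : \sum_(l < L.+1) 1 = _); last by rewrite sumr_const card_ord.
  rewrite mulr_suml; apply: ler_sum => l _; rewrite mul1r.
  by apply: sum_shift_le => //; rewrite -ltnS.
have sum_c : \sum_(i < m - L) (c0 / 16) <= \sum_(i < m - L) w i by apply: ler_sum => i _.
have Lm : (L <= m)%N by apply: leq_trans mL; rewrite leq_pmull.
move: (le_trans sum_c sum_w); rewrite sumr_const card_ord -[X in X <= _]mulr_natl natrB// => H.
have mL' : 2 * L%:R <= m%:R :> R by rewrite -natrM ler_nat.
rewrite mulrAC ler_pdivrMr// mulrC [leRHS]mulrC; apply: le_trans H.
have : (m%:R / 2) * (c0 / 16) <= (m%:R - L%:R) * (c0 / 16).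
  by rewrite ler_wpM2r ?divr_ge0 ?(ltW c00)//; lra.
lra.
Qed.

Lemma minor_arc : exists2 c, 0 < c & exists M0, forall m th, (M0 <= m)%N ->
  (alpha * m.+1%:R)^-1 <= `|th| <= pi -> c * m%:R <= \sum_(i < m) sin ((a i)%:R * th / 2) ^+ 2.
Proof.
have ag1 := alpha_gt1.
have t0 : 0 < (4 * (alpha + 1))^-1 by rewrite invr_gt0; lra.
have tpi : (4 * (alpha + 1))^-1 <= pi.
  have := @pi_ge2 R; have : (4 * (alpha + 1))^-1 <= 1 by rewrite invf_le1; lra.
  lra.
have [|c c0 [M0 H]] := @minor_arc_large (4 * (alpha + 1))^-1; first by rewrite t0.
have c1 : 0 < 32^-1 ^+ 2 / 8 :> R by rewrite divr_gt0// exprn_gt0.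
exists (Num.min c (32^-1 ^+ 2 / 8)); first by rewrite lt_min c0.
exists (maxn 8 M0) => m th; rewrite geq_max => /andP[m8 mM] /andP[h1 h2].
have -> : \sum_(i < m) sin ((a i)%:R * th / 2) ^+ 2 = \sum_(i < m) S `|th| i.
  apply: eq_bigr => i _; rewrite /S; have [_|_] := ger0P th; first by [].
  by rewrite mulrN mulNr sinN sqrrN.
have th0 : 0 < `|th| by apply: lt_le_trans h1; rewrite invr_gt0 mulr_gt0.
have [u|/ltW u] := leP `|th| (4 * (alpha + 1))^-1.
  apply: le_trans (minor_arc_small m8 th0 u h1).
  by rewrite ler_wpM2r// ge_min lexx orbT.
apply: (@le_trans _ _ (c * m%:R)); first by rewrite ler_wpM2r// ge_min lexx.
by apply: H => //; rewrite u.
Qed.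
End MinorArcs.

(** * Decay of the generating function on the circle *)

Section DecayBounds.
Context {R : realType}.
Implicit Types (x u s th : R).

Lemma decay_term_lower x u (r := expR (- x)) : 0 < x <= 1 ->
  sin (u / 2) ^+ 2 / x ^+ 2 <= 2 * r * (1 - cos u) / (1 - r) ^+ 2.
Proof.
move=> /andP[x0 x1]; have q0 : 0 < 1 - r := expN_lt1 x0.
have cE : 1 - cos u = 2 * sin (u / 2) ^+ 2.
  have -> : cos u = cos ((u / 2) *+ 2) by congr cos; rewrite -mulr_natr; field.
  by rewrite cos_mulr2n cos2sin2 -mulr_natr; ring.
have r4 : 4^-1 <= r.
  have -> : r = expR (- (x / 2)) ^+ 2 by rewrite -expRM_natl; congr expR; field.
  have -> : 4^-1 = 2^-1 ^+ 2 :> R by field.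
  rewrite lerXn2r ?nnegrE ?expR_ge0//.
  by have := expR_ge1Dx (- (x / 2)); lra.
have qx : 1 - r <= x by have := expR_ge1Dx (- x); rewrite -/r; lra.
rewrite cE; apply: ler_pM.
- exact: sqr_ge0.
- by rewrite invr_ge0 exprn_ge0 ?(ltW x0).
- have := sqr_ge0 (sin (u / 2)); rewrite (_ : 2 * r * _ = 4 * r * sin (u / 2) ^+ 2); last by ring.
  by move=> h; rewrite ler_peMl//; lra.
- by rewrite lef_pV2 ?posrE ?exprn_gt0// lerXn2r ?nnegrE ?(ltW x0) ?(ltW q0).
Qed.

Lemma sin_sq_ge (w : R) : `|w| <= 2^-1 -> (w / 2) ^+ 2 <= sin w ^+ 2.
Proof.
move=> hw; have -> : sin w ^+ 2 = sin `|w| ^+ 2.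
  by have [_|_] := ger0P w; rewrite // sinN sqrrN.
have -> : (w / 2) ^+ 2 = (`|w| / 2) ^+ 2 by rewrite !exprMn real_normK ?num_real.
have h : `|w| / 2 <= sin `|w| by apply: sin_ge_half; rewrite normr_ge0.
by rewrite lerXn2r ?nnegrE ?(le_trans _ h)//; rewrite divr_ge0.
Qed.

Variable alpha : R.
Hypotheses (alpha_gt1 : 1 < alpha) (alpha_irr : irrational alpha).
Local Notation a := (beatty_part alpha).
Let alpha_gt0 : 0 < alpha. Proof. exact: lt_trans alpha_gt1. Qed.
Let a_pos i : 0 < (a i)%:R :> R. Proof. by rewrite ltr0n beatty_part_gt0. Qed.

Let sum_lower s k m th (F : nat -> R) : 0 < s -> (m <= k)%N -> alpha * s * m%:R <= 1 ->
  (forall i, s * (a i)%:R <= 1 -> F i <= ln (1 + 2 * radius a s i * (1 - cos ((a i)%:R * th)) / (1 - radius a s i) ^+ 2)) ->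
  \sum_(i < m) F i <= log_decay a s k th.
Proof.
move=> s0 mk sm FL.
have ln_ge i : 0 <= ln (1 + 2 * radius a s i * (1 - cos ((a i)%:R * th)) / (1 - radius a s i) ^+ 2).
  rewrite ln_ge0// lerDl; apply: decay_term_ge0 => // j.
  exact: beatty_part_ge.
rewrite /log_decay -(big_mkord xpredT F).
rewrite -(big_mkord xpredT (fun i => ln (1 + 2 * radius a s i * (1 - cos ((a i)%:R * th)) / (1 - radius a s i) ^+ 2))).
rewrite [leRHS](@sum_nat_cat _ _ m k mk) -[leLHS]addr0 lerD//; last exact: sumr_ge0.
rewrite !big_nat; apply: ler_sum => i /andP[_ im]; apply: FL.
apply: le_trans sm; rewrite (mulrC alpha) -mulrA ler_wpM2l ?(ltW s0)//.
rewrite beatty_part_frac//.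
have : alpha * i.+1%:R <= alpha * m%:R by rewrite ler_wpM2l ?ler_nat ?(ltW alpha_gt0).
by have := frac_ge0 (alpha * i.+1%:R); move: (alpha * i.+1%:R) (alpha * m%:R) => p q; move: (frac p) => t; lra.
Qed.

Let trunc_facts s : 0 < s -> 2 * alpha * s <= 1 ->
  let m := Num.truncn (alpha * s)^-1 in
  [/\ alpha * s * m%:R <= 1, (alpha * m.+1%:R)^-1 <= s & (alpha * s)^-1 / 2 <= m%:R].
Proof.
move=> s0 s1 m.
have as0 : 0 < alpha * s by exact: mulr_gt0.
have q0 : 0 <= (alpha * s)^-1 by rewrite invr_ge0 ltW.
have /andP[h1 h2] := truncn_itv q0; rewrite -/m in h1 h2.
have q2 : 2 <= (alpha * s)^-1.
  by rewrite -[leLHS]invrK lef_pV2 ?posrE ?invr_gt0//; move: s1; rewrite -mulrA; lra.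
split.
- by rewrite mulrC -ler_pdivlMr// div1r.
- have m1 : 0 < m.+1%:R :> R by [].
  rewrite -[leRHS]invrK lef_pV2 ?posrE ?invr_gt0 ?mulr_gt0//.
  have -> : s^-1 = alpha * (alpha * s)^-1 by field; rewrite !gt_eqF.
  by rewrite ler_wpM2l ?(ltW alpha_gt0) ?(ltW h2).
- by move: h2 q2; rewrite -natr1; move: (_^-1) (m%:R) => q M; lra.
Qed.

(** Already the parts up to [1/s], about [1/(alpha s)] in number, give this: for them
[sin (a_i th/2)] is of the order of [a_i th]. *)
Lemma log_decay_major : exists2 c, 0 < c & forall s k th, 0 < s -> 2 * alpha * s <= 1 ->
  (alpha * s)^-1 <= k%:R -> `|th| <= s -> c * th ^+ 2 / s ^+ 3 <= log_decay a s k th.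
Proof.
exists (64 * alpha)^-1 => [|s k th s0 s1 sk ths]; first by rewrite invr_gt0 mulr_gt0.
have [f1 f2 f3] := trunc_facts s0 s1.
set m := Num.truncn _ in f1 f2 f3.
have as0 : 0 < alpha * s by exact: mulr_gt0.
have mk : (m <= k)%N.
  rewrite -(ler_nat R) (le_trans _ sk)// truncn_le invr_ge0 ltW//.
have z0 : 0 <= th ^+ 2 / (16 * s ^+ 2).
  by rewrite divr_ge0 ?sqr_ge0// mulr_ge0// sqr_ge0.
have z1 : th ^+ 2 / (16 * s ^+ 2) <= 1.
  rewrite ler_pdivrMr ?mulr_gt0 ?exprn_gt0// mul1r.
  have : th ^+ 2 <= s ^+ 2 by rewrite -real_normK ?num_real// lerXn2r ?nnegrE ?(ltW s0).
  by have := sqr_ge0 s; move: (s ^+ 2) (th ^+ 2) => p q; lra.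
have := sum_lower (th := th) (F := fun=> th ^+ 2 / (16 * s ^+ 2) / 2) s0 mk f1.
rewrite sumr_const card_ord -[X in X <= _]mulr_natl => H.
apply: le_trans (H _); last first.
  move=> i sai; apply: (@le_trans _ _ (ln (1 + th ^+ 2 / (16 * s ^+ 2)))).
    by apply: ln1Dx_ge_half; rewrite z0.
  have sa0 : 0 < s * (a i)%:R by rewrite mulr_gt0.
  have := @decay_term_lower (s * (a i)%:R) ((a i)%:R * th); rewrite sa0 sai => /(_ isT) D.
  have h : th ^+ 2 / (16 * s ^+ 2) <= 2 * radius a s i * (1 - cos ((a i)%:R * th)) / (1 - radius a s i) ^+ 2.
    apply: le_trans D.
    have w : `|(a i)%:R * th / 2| <= 2^-1.
      rewrite !normrM normr_nat normfV normr_nat -[leRHS]mul1r ler_wpM2r// (le_trans _ sai)//.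
      by rewrite mulrC ler_wpM2r.
    have := sin_sq_ge w => /(ler_wpM2r (_ : 0 <= (s * (a i)%:R) ^- 2)).
    rewrite invr_ge0 sqr_ge0 => /(_ isT); apply: le_trans.
    rewrite le_eqVlt; apply/orP; left; apply/eqP; field.
    by rewrite !gt_eqF.
  rewrite ler_ln ?posrE ?lerD2l//; first by rewrite ltr_wpDr.
  by rewrite ltr_wpDr// (le_trans z0).
apply: (@le_trans _ _ ((alpha * s)^-1 / 2 * (th ^+ 2 / (16 * s ^+ 2) / 2))); last first.
  by rewrite ler_wpM2r// divr_ge0.
by rewrite le_eqVlt; apply/orP; left; apply/eqP; field; rewrite !gt_eqF.
Qed.

(** The parts up to [1/s] suffice: their number is of order [1/s], and on the minor arcs
a positive proportion of [sin^2 (a_i th/2)] is bounded below on average. *)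
Lemma log_decay_minor : exists2 c, 0 < c & exists2 s0, 0 < s0 & forall s k th, 0 < s <= s0 ->
  (alpha * s)^-1 <= k%:R -> s <= `|th| <= pi -> c / s <= log_decay a s k th.
Proof.
have [c c0 [M0 H]] := minor_arc alpha_gt1 alpha_irr.
exists (c / (4 * alpha)); first by rewrite divr_gt0// mulr_gt0.
have M02 : 0 < M0.+2%:R :> R by [].
exists (alpha * M0.+2%:R)^-1; first by rewrite invr_gt0 mulr_gt0.
move=> s k th /andP[s0 s1] sk /andP[sth thpi].
have as0 : 0 < alpha * s by exact: mulr_gt0.
have sM : M0.+2%:R * (alpha * s) <= 1.
  have := ler_wpM2l (ltW (mulr_gt0 alpha_gt0 M02)) s1; rewrite divff ?gt_eqF ?mulr_gt0//.
  by apply: le_trans; rewrite mulrA [_ * alpha]mulrC.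
have s2 : 2 * alpha * s <= 1.
  by apply: le_trans sM; rewrite -mulrA ler_wpM2r ?(ltW as0)// ler_nat.
have [f1 f2 f3] := trunc_facts s0 s2.
set m := Num.truncn _ in f1 f2 f3.
have mk : (m <= k)%N.
  rewrite -(ler_nat R) (le_trans _ sk)// truncn_le invr_ge0 ltW//.
have mM : (M0 <= m)%N.
  have : M0.+2%:R <= (alpha * s)^-1 by rewrite -[leRHS]div1r ler_pdivlMr.
  move=> h; rewrite /m truncn_ge_nat ?invr_ge0 ?(ltW as0)// (le_trans _ h)// ler_nat.
  by rewrite -addn2 leq_addr.
have := H m th mM; rewrite thpi andbT (le_trans f2 sth) => /(_ isT) Hm.
have hs : \sum_(i < m) sin ((a i)%:R * th / 2) ^+ 2 / 2 <= log_decay a s k th.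
  apply: (sum_lower (th := th) (F := fun i => sin ((a i)%:R * th / 2) ^+ 2 / 2) s0 mk f1) => i sai.
  have S0 := sqr_ge0 (sin ((a i)%:R * th / 2)).
  have S1 : sin ((a i)%:R * th / 2) ^+ 2 <= 1 by rewrite sin2cos2 gerBl sqr_ge0.
  apply: (@le_trans _ _ (ln (1 + sin ((a i)%:R * th / 2) ^+ 2))).
    by apply: ln1Dx_ge_half; rewrite S0.
  have sa0 : 0 < s * (a i)%:R by rewrite mulr_gt0.
  have := @decay_term_lower (s * (a i)%:R) ((a i)%:R * th); rewrite sa0 sai => /(_ isT) D.
  have h : sin ((a i)%:R * th / 2) ^+ 2 <= 2 * radius a s i * (1 - cos ((a i)%:R * th)) / (1 - radius a s i) ^+ 2.
    apply: le_trans D.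
    rewrite ler_pdivlMr ?exprn_gt0// ler_piMr// expr_le1// ltW//.
  rewrite ler_ln ?posrE ?lerD2l//; first by rewrite ltr_wpDr.
  by rewrite ltr_wpDr// (le_trans S0).
apply: le_trans hs; rewrite -mulr_suml ler_pdivlMr//; apply: le_trans Hm.
have := ler_wpM2l (ltW c0) f3; apply: le_trans.
by rewrite le_eqVlt; apply/orP; left; apply/eqP; field; rewrite !gt_eqF.
Qed.
End DecayBounds.

(** * The local limit theorem *)

Section GaussianDomination.
Context {R : realType}.
Local Notation mu := (@lebesgue_measure R).

Lemma gaussian_integral (A : R) : 0 < A ->
  (\int[mu]_x (expR (- (A * x ^+ 2)))%:E)%E = (Num.sqrt (pi / A))%:E.
Proof.
move=> A0; pose sg : R := (Num.sqrt (2 * A))^-1.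
have sA : 0 < Num.sqrt (2 * A) by rewrite sqrtr_gt0 mulr_gt0.
have sg0 : 0 < sg by rewrite invr_gt0.
have sgE : sg ^+ 2 = (2 * A)^-1 by rewrite exprVn sqr_sqrtr// mulr_ge0// ltW.
have pk : normal_peak sg = (Num.sqrt (pi / A))^-1.
  rewrite /normal_peak sgE; congr (_^-1); congr Num.sqrt.
  by rewrite -mulr_natr; field; rewrite gt_eqF.
have p0 : 0 < Num.sqrt (pi / A) by rewrite sqrtr_gt0 divr_gt0// pi_gt0.
have E (x : R) : expR (- (A * x ^+ 2)) = Num.sqrt (pi / A) * normal_pdf 0 sg x.
  have sgn : sg != 0 by rewrite gt_eqF.
  rewrite (normal_pdfE 0 sgn) pk [RHS]mulrA divff; last by rewrite gt_eqF.
  rewrite mul1r /normal_fun subr0 sgE.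
  by congr expR; rewrite -mulr_natr; field; rewrite gt_eqF.
under eq_integral => x _ do rewrite E EFinM.
rewrite ge0_integralZl_EFin//.
- by rewrite integral_normal_pdf mule1.
- by move=> x _; rewrite lee_fin normal_pdf_ge0.
- by apply/measurable_EFinP; exact: measurable_normal_pdf.
Qed.

Lemma integrable_cauchy_density (K : R) : 0 <= K ->
  mu.-integrable setT (EFin \o (fun x => K * (oneDsqr x)^-1)).
Proof.
move=> K0.
have cf : continuous (fun x : R => (oneDsqr x)^-1) by exact: continuous_oneDsqrV.
have ge (x : R) : 0 <= (oneDsqr x)^-1 by rewrite invr_ge0 (le_trans _ (oneDsqr_ge1 x)).
have I1 : mu.-integrable setT (EFin \o (fun x : R => (oneDsqr x)^-1)).
  apply/integrableP; split.
    by apply/measurable_EFinP; exact: continuous_measurable_fun.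
  under eq_integral => x _ do rewrite /comp/= ger0_norm//.
  rewrite ge0_symfun_integralT//; last by move=> x; rewrite /= /oneDsqr sqrrN.
  rewrite (_ : [set x | _] = `[0, +oo[%classic); last first.
    by apply/seteqP; split => x/=; rewrite in_itv/= andbT.
  by rewrite integral0y_oneDsqr -EFinM ltry.
by have := integrableZl measurableT K I1.
Qed.
End GaussianDomination.

Lemma cvg_close {R : realType} (u v w : nat -> R) (l : R) :
  (forall n, `|u n - v n| <= w n) -> w @ \oo --> (0 : R) -> v @ \oo --> l -> u @ \oo --> l.
Proof.
move=> uvw w0 vl.
have h : (fun n => u n - v n) @ \oo --> (0 : R).
  apply/cvgr0Pnorm_le => e e0; near=> n; apply: (le_trans (uvw n)).
  apply: (le_trans (ler_norm _)); near: n; exact: (cvgr0_norm_le _ w0).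
rewrite (_ : u = (fun n => (u n - v n) + v n)); last by apply/funext => n; rewrite subrK.
by rewrite -[l]add0r; exact: cvgD.
Unshelve. all: by end_near. Qed.

Section LocalLimit.
Context {R : realType}.
Variable alpha : R.
Hypotheses (alpha_gt1 : 1 < alpha) (alpha_irr : irrational alpha).
Local Notation a := (beatty_part alpha).
Local Notation mu := (@lebesgue_measure R).
Variables (s : nat -> R) (M N : nat -> nat) (A : R).
Hypotheses (A_gt0 : 0 < A) (s_gt0 : forall n, 0 < s n) (s_cvg0 : s @ \oo --> (0 : R))
  (sM : forall n, (alpha * s n)^-1 <= (M n)%:R)
  (mean_cvg : (fun n => (gf_mean a (s n) (M n) - (N n)%:R) * (s n * Num.sqrt (s n))) @ \oo --> (0 : R))
  (var_cvg : (fun n => gf_var a (s n) (M n) * s n ^+ 3) @ \oo --> 2 * A).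

Let alpha_gt0 : 0 < alpha. Proof. exact: lt_trans alpha_gt1. Qed.
Let a_ge := (beatty_part_ge alpha_gt1).
Let a_gt0 := (beatty_part_gt0 alpha_gt1).
Let q n := Num.sqrt (s n).
Let q_gt0 n : 0 < q n. Proof. by rewrite sqrtr_gt0. Qed.
Let sE n : s n = q n ^+ 2. Proof. by rewrite sqr_sqrtr// ltW. Qed.
Let delta n := s n * q n.
Let delta_gt0 n : 0 < delta n. Proof. by rewrite mulr_gt0. Qed.
Let deltaE n : delta n = q n ^+ 3. Proof. by rewrite /delta sE -exprSr. Qed.

Let q_cvg0 : q @ \oo --> (0 : R).
Proof. by rewrite -(@sqrtr0 R); apply: continuous_cvg => //; exact: sqrt_continuous. Qed.

Let delta_cvg0 : delta @ \oo --> (0 : R).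
Proof. by rewrite -(mulr0 0); exact: cvgM. Qed.

Let F n t := expR (- log_gf a (s n) (M n)) * fourier_integrand a (s n) (delta n) (M n) (N n) t.

Let FE n t : F n t = expR (- (log_decay a (s n) (M n) (delta n * t) / 2)) *
  cos (gf_phase a (s n) (M n) (delta n * t) - (N n)%:R * (delta n * t)).
Proof.
rewrite /F /fourier_integrand gf_modulusE// expRD [X in X * _]expRN.
by rewrite !mulrA mulVf ?mul1r// gt_eqF// expR_gt0.
Qed.

Let F_continuous n : continuous (F n).
Proof.
move=> t; apply: (continuous_comp (f := fourier_integrand a (s n) (delta n) (M n) (N n))).
  exact: continuous_fourier_integrand.
exact: mulrl_continuous.
Qed.

Let I n : set R := `[- (pi / delta n), pi / delta n]%classic.

(** The substitution [th = s^(3/2) t] rescales the peak of the integrand to unit width. *)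
Let count_integral n :
  (partition_count a (M n) (N n))%:R * expR (- (s n * (N n)%:R)) * expR (- log_gf a (s n) (M n)) / delta n
  = (2 * pi)^-1 * (\int[mu]_(t in I n) F n t)%R.
Proof.
rewrite /F RintegralZl; first last.
- by apply: continuous_itv_integrable; exact: continuous_fourier_integrand.
- exact: measurable_itv.
rewrite -/(fourier_coef a (s n) (delta n) (M n) (N n)) (fourier_inversion a_gt0 _ (s_gt0 n) (delta_gt0 n)).
  have := delta_gt0 n; have := @pi_gt0 R; move: (delta n) (pi : R) => d p p0 d0.
  by field; rewrite !gt_eqF.
exact: beatty_part_incr.
Qed.

Let F_pointwise t : F ^~ t @ \oo --> expR (- (A * t ^+ 2)).
Proof.
have [K1 K10 H1] := log_decay_quadratic (R := R) a_ge.
have [K2 K20 H2] := gf_phase_linear (R := R) a_ge.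
have ld : (fun n => log_decay a (s n) (M n) (delta n * t)) @ \oo --> 2 * A * t ^+ 2.
  apply: (@cvg_close _ _ (fun n => gf_var a (s n) (M n) * s n ^+ 3 * t ^+ 2) (fun n => K1 * `|t| ^+ 4 * s n)).
  - move=> n; have := H1 (s n) (M n) (delta n * t) (s_gt0 n).
    have -> : gf_var a (s n) (M n) * (delta n * t) ^+ 2 = gf_var a (s n) (M n) * s n ^+ 3 * t ^+ 2.
      by rewrite deltaE sE; ring.
    move/le_trans; apply; rewrite normrM (ger0_norm (ltW (delta_gt0 n))).
    by rewrite le_eqVlt deltaE sE; apply/orP; left; apply/eqP; field; rewrite gt_eqF.
  - by rewrite -(mulr0 (K1 * `|t| ^+ 4)); apply: cvgM => //; exact: cvg_cst.
  - by apply: cvgM => //; exact: cvg_cst.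
have ph : (fun n => gf_phase a (s n) (M n) (delta n * t) - (N n)%:R * (delta n * t)) @ \oo --> (0 : R).
  apply: (@cvg_close _ _ (fun n => (gf_mean a (s n) (M n) - (N n)%:R) * (s n * Num.sqrt (s n)) * t)
    (fun n => K2 * `|t| ^+ 3 * q n)).
  - move=> n; have := H2 (s n) (M n) (delta n * t) (s_gt0 n).
    rewrite -/(q n) -/(delta n) (_ : gf_phase _ _ _ _ - _ - _ =
      gf_phase a (s n) (M n) (delta n * t) - gf_mean a (s n) (M n) * (delta n * t)); last by ring.
    move/le_trans; apply; rewrite normrM (ger0_norm (ltW (delta_gt0 n))).
    by rewrite le_eqVlt deltaE sE; apply/orP; left; apply/eqP; field; rewrite gt_eqF.
  - by rewrite -(mulr0 (K2 * `|t| ^+ 3)); apply: cvgM => //; exact: cvg_cst.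
  - by rewrite -(mul0r t); apply: cvgM => //; exact: cvg_cst.
rewrite (_ : F ^~ t = fun n => expR (- (log_decay a (s n) (M n) (delta n * t) / 2)) *
  cos (gf_phase a (s n) (M n) (delta n * t) - (N n)%:R * (delta n * t))); last first.
  by apply/funext => n; exact: FE.
rewrite (_ : expR _ = expR (- (A * t ^+ 2)) * cos 0); last by rewrite cos0 mulr1.
apply: cvgM.
  apply: continuous_cvg; first exact: continuous_expR.
  apply: cvgN; rewrite (_ : A * t ^+ 2 = 2 * A * t ^+ 2 / 2); last by field.
  by apply: cvgM => //; exact: cvg_cst.
by apply: continuous_cvg => //; exact: continuous_cos.
Qed.

Let in_I t : \forall n \near \oo, I n t.
Proof.
have /(cvgr0_norm_le _)/(_ (pi / (`|t| + 1))) h := delta_cvg0.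
have t1 : 0 < `|t| + 1 by rewrite ltr_wpDl.
have p0 : 0 < pi / (`|t| + 1) :> R by rewrite divr_gt0// pi_gt0.
near=> n.
have : `|delta n| <= pi / (`|t| + 1) by near: n; exact: h.
rewrite ger0_norm ?(ltW (delta_gt0 n))// ler_pdivlMr// => hd.
rewrite /I/= in_itv/= -ler_norml ler_pdivlMr//.
apply: le_trans hd; rewrite mulrC ler_wpM2l ?(ltW (delta_gt0 n))//.
by rewrite lerDl.
Unshelve. all: by end_near. Qed.

(** On the major arc [e^(- c t^2/2) <= 1/(1 + c t^2/2)]; on the minor arcs [e^(- c/(2 s))]
is smaller than any power of [s], while [1 + t^2 = O(s^(-3))] there. *)
Let F_dominated : exists2 K, 0 <= K & \forall n \near \oo, forall t, I n t ->
  `|F n t| <= K * (oneDsqr t)^-1.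
Proof.
have [c1 c10 H1] := log_decay_major alpha_gt1.
have [c2 c20 [s0 s00 H2]] := log_decay_minor alpha_gt1 alpha_irr.
pose K1 := 1 + 2 / c1.
pose K2 := (1 + pi ^+ 2) * (6 * (2 / c2) ^+ 3).
have K10 : 0 <= K1 by rewrite addr_ge0// divr_ge0// ltW.
have K20 : 0 <= K2.
  by rewrite mulr_ge0 ?addr_ge0 ?sqr_ge0// mulr_ge0// exprn_ge0// divr_ge0// ltW.
exists (K1 + K2); first by rewrite addr_ge0.
near=> n => t; rewrite /I/= in_itv/= -ler_norml => tI.
have sn : s n <= s0.
  apply: (le_trans (ler_norm _)); near: n; exact: (cvgr0_norm_le _ s_cvg0).
have sn1 : s n <= 1.
  apply: (le_trans (ler_norm _)); near: n; exact: (cvgr0_norm_le _ s_cvg0).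
have sn2 : 2 * alpha * s n <= 1.
  rewrite mulrC -ler_pdivlMr ?mulr_gt0// div1r.
  apply: (le_trans (ler_norm _)); near: n; apply: (cvgr0_norm_le _ s_cvg0).
  by rewrite invr_gt0 mulr_gt0.
have D1 : 0 < oneDsqr t by rewrite (lt_le_trans _ (oneDsqr_ge1 t)).
have s3 : 0 < s n ^+ 3 by rewrite exprn_gt0.
rewrite FE normrM ger0_norm ?expR_ge0//.
apply: (@le_trans _ _ (expR (- (log_decay a (s n) (M n) (delta n * t) / 2)))).
  by rewrite ler_piMr ?expR_ge0// cos_max.
rewrite ler_pdivlMr//.
have [small|big] := leP `|delta n * t| (s n).
  have := H1 (s n) (M n) (delta n * t) (s_gt0 n) sn2 (sM n) small.
  have -> : c1 * (delta n * t) ^+ 2 / s n ^+ 3 = c1 * t ^+ 2.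
    by rewrite deltaE sE; field; rewrite gt_eqF.
  move=> h; apply: (@le_trans _ _ K1); last by rewrite lerDl.
  apply: (@le_trans _ _ ((1 + c1 * t ^+ 2 / 2)^-1 * oneDsqr t)).
    rewrite ler_wpM2r ?(ltW D1)// expRN lef_pV2 ?posrE ?expR_gt0//.
      by apply: le_trans (expR_ge1Dx _); lra.
    by rewrite ltr_wpDr// divr_ge0// mulr_ge0 ?sqr_ge0// ltW.
  have t2 := sqr_ge0 t; have ct2 : 0 <= c1 * t ^+ 2 by rewrite mulr_ge0 ?(ltW c10).
  rewrite mulrC ler_pdivrMr; last by lra.
  rewrite /K1 /oneDsqr (_ : _ * _ = 1 + t ^+ 2 + (c1 * t ^+ 2 / 2 + 2 / c1)); last by field; rewrite gt_eqF.
  by rewrite lerDl addr_ge0 ?divr_ge0 ?(ltW c10).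
have dpi : `|delta n * t| <= pi.
  by rewrite normrM (ger0_norm (ltW (delta_gt0 n))) mulrC -ler_pdivlMr.
have ssn : 0 < s n <= s0 by rewrite s_gt0.
have := H2 (s n) (M n) (delta n * t) ssn (sM n) _; rewrite (ltW big) dpi => /(_ isT) h.
apply: (@le_trans _ _ K2); last by rewrite lerDr.
have x0 : 0 <= c2 / s n / 2 by rewrite !divr_ge0 ?(ltW c20) ?(ltW (s_gt0 n)).
have xp : 0 < c2 / s n / 2 by rewrite !divr_gt0.
have e1 : (c2 / s n / 2) ^+ 3 / 6 <= expR (c2 / s n / 2).
  have := expR_ge1Dxn 2 x0; apply: le_trans.
  by rewrite (_ : 3`!%:R = 6) // lerDr.
have e2 : expR (- (log_decay a (s n) (M n) (delta n * t) / 2)) <= 6 * (2 / c2) ^+ 3 * s n ^+ 3.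
  apply: (@le_trans _ _ (expR (- (c2 / s n / 2)))).
    by rewrite ler_expR lerN2 ler_wpM2r.
  rewrite expRN (_ : 6 * _ * _ = ((c2 / s n / 2) ^+ 3 / 6)^-1); last by field; rewrite !gt_eqF.
  by rewrite lef_pV2 ?posrE ?expR_gt0// divr_gt0// exprn_gt0.
have e3 : oneDsqr t <= (1 + pi ^+ 2) / s n ^+ 3.
  rewrite ler_pdivlMr// /oneDsqr mulrDl mul1r lerD//; first by rewrite expr_le1 ?(ltW (s_gt0 n)).
  have -> : t ^+ 2 * s n ^+ 3 = `|delta n * t| ^+ 2.
    by rewrite real_normK ?num_real// deltaE sE; ring.
  by rewrite lerXn2r ?nnegrE// pi_ge0.
apply: (le_trans (ler_pM (expR_ge0 _) (ltW D1) e2 e3)).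
by rewrite /K2 le_eqVlt; apply/orP; left; apply/eqP; field; rewrite gt_eqF// gt_eqF.
Unshelve. all: by end_near. Qed.

(** The rescaled integrand tends to [e^(- A t^2)] and is dominated by a multiple of
[1/(1 + t^2)], so its integral tends to the Gaussian one. The hypothesis on the mean
says that the distance of [N] from the mean is a vanishing fraction of the standard
deviation, which is of order [s^(-3/2)]. *)
Lemma local_limit :
  (fun n => (partition_count a (M n) (N n))%:R * expR (- (s n * (N n)%:R))
     * expR (- log_gf a (s n) (M n)) / (s n * Num.sqrt (s n))) @ \oo -->
  (2 * pi)^-1 * Num.sqrt (pi / A).
Proof.
rewrite (_ : (fun n => _) = fun n => (2 * pi)^-1 * (\int[mu]_(t in I n) F n t)%R); last first.
  by apply/funext => n; exact: count_integral.
apply: cvgM; first exact: cvg_cst.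
have [K K0 [N0 _ HN]] := F_dominated.
rewrite -(cvg_shiftn N0).
pose f_ n := (EFin \o (F (n + N0) \_ (I (n + N0)))) : R -> \bar R.
have mf n : measurable_fun setT (F n \_ (I n)).
  have mI : measurable (I n) by exact: measurable_itv.
  apply/(measurable_restrictT (F n) mI).
  by apply: measurable_funTS; exact: continuous_measurable_fun.
have D : (fun n => \int[mu]_x f_ n x)%E @ \oo --> (\int[mu]_x (expR (- (A * x ^+ 2)))%:E)%E.
  apply: (@dominated_cvg _ _ _ mu setT measurableT f_ _ (EFin \o (fun x => K * (oneDsqr x)^-1))) => //.
  - by move=> n; apply/measurable_EFinP; exact: mf.
  - move=> t _; apply/fine_cvgP; split; first by near=> n.
    have : (fun n => F (n + N0)%N t) @ \oo --> expR (- (A * t ^+ 2)).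
      by rewrite (cvg_shiftn N0 (fun n => F n t)); exact: F_pointwise.
    have inI : \forall n \near \oo, I (n + N0)%N t.
      have [n0 _ Hn0] := in_I t; exists n0 => // m /= n0m; apply: Hn0 => /=.
      by rewrite (leq_trans n0m)// leq_addr.
    apply: cvg_trans; apply: near_eq_cvg; near=> n.
    by rewrite /f_/= /patch mem_set//; near: n; exact: inI.
  - exact: integrable_cauchy_density.
  - move=> n t _; rewrite /f_/= lee_fin /patch; case: ifPn => [/set_mem It|_].
      by apply: HN => //=; exact: leq_addl.
    by rewrite normr0 mulr_ge0// invr_ge0 (le_trans _ (oneDsqr_ge1 t)).
rewrite gaussian_integral// in D.
have H : (fun n => fine (\int[mu]_x f_ n x)%E) @ \oo --> Num.sqrt (pi / A) := fine_cvg D.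
rewrite (_ : (fun n => _) = fun n => (\int[mu]_(t in I (n + N0)%N) F (n + N0)%N t)%R) in H.
  exact: H.
by apply/funext => n; rewrite [RHS]Rintegral_mkcond.
Unshelve. all: by end_near. Qed.
End LocalLimit.

(** * The sum of the inverse squares *)

Lemma sum_reflect {R : realType} (u : nat -> R) (N : nat) :
  \sum_(0 <= k < N.*2) u k = \sum_(0 <= k < N) (u k + u (N.*2 - k.+1)%N).
Proof.
rewrite -addnn (sum_nat_cat u (leq_addr N N)) big_split/=; congr (_ + _).
rewrite [LHS](_ : _ = \sum_(0 + N <= m < N + N) u m)// big_addn addnK big_nat_rev/=.
by apply: eq_big_nat => k /andP[_ kN]; congr u; rewrite add0n addnBAC.
Qed.

Section Zeta2.
Context {R : realType}.
Implicit Types (x : R).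

Lemma x_cos_le_sin x : 0 <= x <= pi -> x * cos x <= sin x.
Proof.
move=> /andP[x0 xp].
have fd (y : R) : `|y| <= x -> is_derive y 1 (fun y => sin y - y * cos y) (y * sin y).
  by move=> _; apply: is_derive_eq; rewrite /GRing.scale/=; ring.
have f0 : (fun y : R => sin y - y * cos y) 0 = 0 by rewrite sin0 mul0r subrr.
have xx : `|x| <= x by rewrite ger0_norm.
have [c cx E] := @mean_value_origin R (fun y => sin y - y * cos y) (fun y => y * sin y) x x fd f0 xx.
move: E; rewrite -subr_ge0 => ->.
rewrite mulr_ge0//.
have -> : c * sin c = `|c| * sin `|c|.
  by have [_|_] := ger0P c; rewrite // sinN mulrNN.
rewrite mulr_ge0// sin_ge0_pi// normr_ge0 (le_trans cx)// ger0_norm//.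
Qed.

Lemma inv_sin_sq_bounds x : 0 < x < pi / 2 ->
  (sin x ^+ 2)^-1 - 1 <= (x ^+ 2)^-1 <= (sin x ^+ 2)^-1.
Proof.
move=> /andP[x0 xp]; have pi0 := @pi_gt0 R.
have s0 : 0 < sin x by apply: sin_gt0_pihalf; rewrite x0.
have c0 : 0 < cos x by apply: cos_gt0_pihalf; rewrite xp andbT; lra.
have h1 : sin x <= x by have := abs_sin_le x; rewrite (ger0_norm (ltW x0)) (ger0_norm (ltW s0)).
have h2 : x * cos x <= sin x by apply: x_cos_le_sin; lra.
apply/andP; split; last by rewrite lef_pV2 ?posrE ?exprn_gt0// lerXn2r ?nnegrE ?(ltW s0) ?(ltW x0).
have -> : (sin x ^+ 2)^-1 - 1 = cos x ^+ 2 / sin x ^+ 2.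
  by rewrite cos2sin2; field; rewrite gt_eqF.
rewrite ler_pdivrMr ?exprn_gt0// mulrC ler_pdivlMr ?exprn_gt0// -exprMn mulrC.
by rewrite lerXn2r ?nnegrE ?mulr_ge0 ?(ltW x0) ?(ltW c0) ?(ltW s0).
Qed.

Lemma inv_sin_sq_split x : sin x != 0 ->
  (sin x ^+ 2)^-1 = 4^-1 * ((sin (x / 2) ^+ 2)^-1 + (cos (x / 2) ^+ 2)^-1).
Proof.
have -> : sin x = 2 * (cos (x / 2) * sin (x / 2)).
  have {1}-> : x = (x / 2) *+ 2 by rewrite -mulr_natr; field.
  by rewrite sin_mulr2n -mulr_natr mulrC.
rewrite !mulf_eq0 !negb_or => /and3P[_ c0 s0].
have := cos2Dsin2 (x / 2); move: (cos _) (sin _) c0 s0 => c s c0 s0 h.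
transitivity (4^-1 * ((c ^+ 2 + s ^+ 2) / (c ^+ 2 * s ^+ 2))).
  by rewrite h; field; rewrite ?c0 ?s0.
by field; rewrite ?c0 ?s0.
Qed.

Let ang n k : R := k.*2.+1%:R * (pi / 2 ^+ n.+2).

Let ang_itv n k : (k < 2 ^ n)%N -> 0 < ang n k < pi / 2.
Proof.
move=> kn; have pi0 := @pi_gt0 R; have p2 : 0 < 2 ^+ n.+2 :> R by rewrite exprn_gt0.
rewrite /ang mulr_gt0 ?divr_gt0//= mulrA ltr_pdivrMr//.
rewrite (_ : pi / 2 * _ = 2 ^+ n.+1 * pi); last by rewrite exprS; field.
by rewrite ltr_pM2r// -natrX ltr_nat expnS mul2n -doubleS leq_double.
Qed.

(** Iterating [1/sin^2 x = (1/sin^2 (x/2) + 1/cos^2 (x/2))/4] from [x = pi/4]; the cosine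
terms are the sines of the reflected angles. *)
Lemma sum_inv_sin_sq n : \sum_(0 <= k < 2 ^ n) (sin (ang n k) ^+ 2)^-1 = 2 * 4 ^+ n.
Proof.
elim: n => [|n IH].
  rewrite expn0 big_nat1 expr0 mulr1 /ang/= mul1r.
  have h : cos ((pi / 2 ^+ 2) *+ 2) = 0 :> R.
    by rewrite -(@cos_pihalf R); congr cos; rewrite -mulr_natr; field.
  rewrite cos_mulr2n cos2sin2 -mulr_natr in h.
  rewrite -[RHS]invrK; congr (_^-1); lra.
have E k : (k < 2 ^ n)%N -> (sin (ang n k) ^+ 2)^-1 =
    4^-1 * ((sin (ang n.+1 k) ^+ 2)^-1 + (sin (ang n.+1 (2 ^ n.+1 - k.+1)) ^+ 2)^-1).
  move=> kn; have /andP[a0 a1] := ang_itv kn.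
  have s0 : sin (ang n k) != 0 by rewrite gt_eqF// sin_gt0_pihalf// a0.
  have p2 : (2 : R) ^+ n != 0 by rewrite expf_neq0.
  rewrite inv_sin_sq_split//.
  have -> : ang n k / 2 = ang n.+1 k by rewrite /ang !exprS; field.
  have <- : cos (ang n.+1 k) = sin (ang n.+1 (2 ^ n.+1 - k.+1)) => //.
  have -> : ang n.+1 (2 ^ n.+1 - k.+1) = pi / 2 - ang n.+1 k.
    have e1 : (2 ^ n.+1 - k.+1).*2.+1%:R = 2 ^+ n.+1 * 2 - k%:R * 2 - 1 :> R.
      rewrite -[LHS]natr1 -muln2 natrM natrB; last by rewrite (leq_trans kn)// leq_exp2l.
      by rewrite natrX -[k.+1%:R]natr1; ring.
    have e2 : k.*2.+1%:R = k%:R * 2 + 1 :> R by rewrite -[LHS]natr1 -muln2 natrM.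
    by rewrite /ang e1 e2 !exprS; field.
  by rewrite sinB sin_pihalf cos_pihalf mul1r mul0r subr0.
have n2 : (2 ^ n <= 2 ^ n.+1)%N by rewrite leq_exp2l.
rewrite [X in \sum_(0 <= k < X) _](_ : _ = (2 ^ n).*2)%N; last by rewrite expnS mul2n.
rewrite (sum_reflect (fun k => (sin (ang n.+1 k) ^+ 2)^-1)) exprS mulrCA -IH mulr_sumr.
rewrite !big_nat; apply: eq_bigr => k /andP[_ kn].
by rewrite E// mulrA mulfV// mul1r expnS mul2n.
Qed.

Let odd_sum N : R := \sum_(0 <= k < N) (k.*2.+1%:R ^+ 2)^-1.

Let odd_sum_bounds n : pi ^+ 2 / 8 - pi ^+ 2 / 16 * 2^-1 ^+ n <= odd_sum (2 ^ n) <= pi ^+ 2 / 8.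
Proof.
have pi0 := @pi_gt0 R; have p2 : 0 < 2 ^+ n :> R by rewrite exprn_gt0.
have E4 : 4 ^+ n = 2 ^+ n * 2 ^+ n :> R by rewrite -exprMn; congr (_ ^+ _); lra.
have E : odd_sum (2 ^ n) = pi ^+ 2 / (16 * 4 ^+ n) * \sum_(0 <= k < 2 ^ n) (ang n k ^+ 2)^-1.
  rewrite mulr_sumr; apply: eq_bigr => k _; rewrite /ang E4.
  have -> : 2 ^+ n.+2 = 4 * 2 ^+ n :> R by rewrite !exprS; ring.
  have k1 : 0 < k.*2.+1%:R :> R by [].
  move: (k.*2.+1%:R : R) (2 ^+ n) (pi : R) k1 p2 pi0 => x y z x0 y0 z0.
  by field; rewrite !gt_eqF.
have c0 : 0 <= pi ^+ 2 / (16 * 4 ^+ n) :> R.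
  by rewrite divr_ge0 ?sqr_ge0// mulr_ge0// exprn_ge0.
have S := sum_inv_sin_sq n.
have U : \sum_(0 <= k < 2 ^ n) (ang n k ^+ 2)^-1 <= 2 * 4 ^+ n.
  rewrite -S !big_nat; apply: ler_sum => k /andP[_ kn].
  by have /andP[_] := inv_sin_sq_bounds (ang_itv kn).
have L : 2 * 4 ^+ n - 2 ^+ n <= \sum_(0 <= k < 2 ^ n) (ang n k ^+ 2)^-1.
  have -> : 2 ^+ n = \sum_(0 <= k < 2 ^ n) 1 :> R by rewrite sumr_const_nat subn0 natrX.
  rewrite -S -sumrB !big_nat; apply: ler_sum => k /andP[_ kn].
  by have /andP[] := inv_sin_sq_bounds (ang_itv kn).
rewrite E; apply/andP; split.
  apply: le_trans (ler_wpM2l c0 L).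
  by rewrite le_eqVlt exprVn E4; apply/orP; left; apply/eqP; field; rewrite gt_eqF.
apply: (le_trans (ler_wpM2l c0 U)).
by rewrite le_eqVlt E4; apply/orP; left; apply/eqP; field; rewrite gt_eqF.
Qed.

Lemma cvg_subseq_ge (u : nat -> R) (phi : nat -> nat) (l : R) : (forall n, (n <= phi n)%N) ->
  u @ \oo --> l -> (fun n => u (phi n)) @ \oo --> l.
Proof.
move=> nphi ul; apply: (cvg_comp phi u) ul => A [K _ KA].
by exists K => // n /= Kn; apply: KA; exact: leq_trans Kn (nphi n).
Qed.

Lemma inv_sq_series_cvg : cvgn (series (fun k => (k.+1%:R ^+ 2)^-1 : R)).
Proof.
have h n : \sum_(0 <= k < n.+1) (k.+1%:R ^+ 2)^-1 <= 2 - n.+1%:R^-1 :> R.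
  elim: n => [|n IH]; first by rewrite big_nat1 expr1n invr1; lra.
  rewrite big_nat_recr//=; apply: (le_trans (lerD IH (lexx _))).
  have n1 : 0 < n.+1%:R :> R by [].
  have -> : n.+2%:R = n.+1%:R + 1 :> R by rewrite natr1.
  move: (n.+1%:R : R) n1 => x x0.
  have e : x^-1 - (x + 1)^-1 = (x * (x + 1))^-1 by field; rewrite !gt_eqF//; lra.
  have e2 : ((x + 1) ^+ 2)^-1 <= (x * (x + 1))^-1.
    by rewrite lef_pV2 ?posrE ?exprn_gt0 ?mulr_gt0 ?addr_gt0// expr2 ler_wpM2r ?addr_ge0 ?(ltW x0)// lerDl.
  by rewrite -e in e2; move: e2; move: (_ ^-1) (_ ^-1) (_ ^-1) => p q r; lra.
apply: (@nonneg_series_cvg _ _ 2) => [n|n]; first by rewrite invr_ge0 sqr_ge0.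
case: n => [|n]; first by rewrite big_geq.
by apply: (le_trans (h n)); rewrite gerBl invr_ge0.
Qed.

(** Comparing [1/sin^2] with [1/x^2] at the odd multiples of [pi/2^(n+2)] gives the sum of
[1/k^2] over odd [k], which is three quarters of the full sum. *)
Lemma zeta2E : limn (series (fun k => (k.+1%:R ^+ 2)^-1 : R)) = pi ^+ 2 / 6.
Proof.
set u := fun k : nat => _; set z := limn _.
have uz : series u @ \oo --> z by exact: inv_sq_series_cvg.
have split N : series u N.*2 = odd_sum N + 4^-1 * series u N.
  elim: N => [|N IH]; first by rewrite /series/= /odd_sum !big_geq// mulr0 addr0.
  have S1 n : series u n.+1 = series u n + u n by rewrite /series/= big_nat_recr.
  have S2 : odd_sum N.+1 = odd_sum N + (N.*2.+1%:R ^+ 2)^-1 by rewrite /odd_sum big_nat_recr.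
  rewrite doubleS !S1 IH S2 /u.
  rewrite -[N.*2.+2%:R]natr1 -[N.*2.+1%:R]natr1 -[N.+1%:R]natr1 -muln2 natrM.
  have : 0 <= N%:R :> R by [].
  by move: (series u N) (odd_sum N) (N%:R : R) => p q x x0; field; rewrite !gt_eqF//; lra.
have o8 : (fun n => odd_sum (2 ^ n)) @ \oo --> pi ^+ 2 / 8.
  apply: (@squeeze_cvgr _ _ _ _ (fun n => pi ^+ 2 / 8 - pi ^+ 2 / 16 * 2^-1 ^+ n) (fun=> pi ^+ 2 / 8)).
  - by apply: nearW => n; exact: odd_sum_bounds.
  - rewrite -[X in _ --> X]subr0; apply: cvgB; first exact: cvg_cst.
    by apply: (@cvg_geometric _ (pi ^+ 2 / 16) 2^-1); rewrite ger0_norm; lra.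
  - exact: cvg_cst.
have z1 : (fun n => series u (2 ^ n)%N) @ \oo --> z.
  by apply: (@cvg_subseq_ge (series u)) => // n; rewrite ltnW// ltn_expl.
have z2 : (fun n => series u (2 ^ n).*2) @ \oo --> z.
  apply: (@cvg_subseq_ge (series u) (fun n => (2 ^ n).*2)) => // n.
  by rewrite -addnn (leq_trans (ltnW (ltn_expl n (isT : 1 < 2)%N)))// leq_addl.
have z3 : (fun n => series u (2 ^ n).*2) @ \oo --> pi ^+ 2 / 8 + 4^-1 * z.
  rewrite (_ : (fun n => _) = fun n => odd_sum (2 ^ n) + 4^-1 * series u (2 ^ n)%N); last first.
    by apply/funext => n; exact: split.
  by apply: cvgD => //; apply: cvgM => //; exact: cvg_cst.
have e : z = pi ^+ 2 / 8 + 4^-1 * z :> R := cvg_unique (@norm_hausdorff _ R) z2 z3.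
have h : z - 4^-1 * z = pi ^+ 2 / 8 by rewrite {1}e addrK.
rewrite (_ : z = (z - 4^-1 * z) * (4 / 3)); last by field.
by rewrite h; field.
Qed.
End Zeta2.

(** * The constant in Stirling's formula *)

Section Wallis.
Context {R : realType}.
Local Notation mu := (@lebesgue_measure R).
Implicit Types (x : R) (n : nat).

Let I n : R := (\int[mu]_(x in `[0, (pi / 2)%R]) (sin x ^+ n))%R.

Let sinX_continuous n : continuous (fun x : R => sin x ^+ n).
Proof.
move=> x; apply: (continuous_comp (f := @sin R) (g := fun y : R => y ^+ n)).
  exact: continuous_sin.
exact: exprn_continuous.
Qed.

Let sinX_integrable n : mu.-integrable `[0, (pi / 2)%R] (EFin \o (fun x : R => sin x ^+ n)).
Proof. exact/continuous_itv_integrable/sinX_continuous. Qed.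

Let sin_itv x : x \in `[0%R, (pi / 2)%R] -> 0 <= sin x <= 1.
Proof.
rewrite in_itv/= sin_le1 andbT => /andP[x0 x1].
by apply: sin_ge0_pi; have := @pi_gt0 R; lra.
Qed.

Let recI n : n.+2%:R * I n.+2 = n.+1%:R * I n.
Proof.
have pi0 := @pi_gt0 R.
pose G x : R := - cos x * sin x ^+ n.+1.
pose g x : R := n.+2%:R * sin x ^+ n.+2 - n.+1%:R * sin x ^+ n.
have dG (x : R) : is_derive x 1 G (g x).
  have GE : G = - (@cos R) * (@sin R ^+ n.+1) by apply/funext => y; rewrite !fctE.
  rewrite GE /g; apply: is_derive_eq; rewrite !fctE /GRing.scale/=.
  have c2 : cos x * cos x = 1 - sin x ^+ 2 by rewrite -cos2sin2 expr2.
  transitivity (- (cos x * cos x) * (n.+1%:R * sin x ^+ n) + sin x ^+ n.+2); first by rewrite !exprS; ring.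
  by rewrite c2 -[n.+2%:R]natr1 !exprS; ring.
have cm c k : continuous (fun x : R => c * sin x ^+ k).
  by move=> x; apply: cvgMr; exact: sinX_continuous.
have cg : continuous g by move=> x; apply: cvgB; exact: cm.
have cG : continuous G by move=> x; apply: differentiable_continuous; apply/derivable1_diffP; apply: ex_derive.
have E : (\int[mu]_(x in `[0, (pi / 2)%R]) g x)%R = 0.
  rewrite /Rintegral (@continuous_FTC2 _ _ G)//.
  - by rewrite /= /G cos_pihalf sin0 oppr0 mul0r expr0n/= mulr0 subr0.
  - lra.
  - exact: continuous_subspaceT.
  - split; first by move=> x _; apply: ex_derive.
    + exact: cvg_at_right_filter (cG _).
    + exact: cvg_at_left_filter (cG _).
  - by move=> x _; rewrite derive1E; exact: derive_val.
apply/eqP; rewrite -subr_eq0 -E /I -!RintegralZl// -RintegralB//.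
all: exact/continuous_itv_integrable/cm.
Qed.

Let I0 : I 0 = pi / 2.
Proof.
rewrite /I; under eq_Rintegral => t _ do rewrite expr0.
pose J : set R := `[0, (pi / 2)%R]%classic.
rewrite [LHS](_ : _ = 1 * fine (mu J)); last exact: Rintegral_cst.
rewrite lebesgue_measure_itv/= lte_fin ifT ?mul1r/= ?subr0//.
by rewrite divr_gt0 ?pi_gt0.
Qed.

Let I1 : I 1 = 1.
Proof.
have pi0 := @pi_gt0 R.
have dG (x : R) : is_derive x 1 (fun x => - cos x) (sin x ^+ 1).
  by apply: is_derive_eq; rewrite opprK.
have cG : continuous (fun x : R => - cos x) by move=> x; apply: differentiable_continuous; apply/derivable1_diffP; apply: ex_derive.
rewrite /I /Rintegral (@continuous_FTC2 _ _ (fun x => - cos x))//.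
- by rewrite cos_pihalf cos0 oppr0/=; lra.
- lra.
- exact/continuous_subspaceT/sinX_continuous.
- split; first by move=> x _; apply: ex_derive.
  + exact: cvg_at_right_filter (cG _).
  + exact: cvg_at_left_filter (cG _).
- by move=> x _; rewrite derive1E; exact: derive_val.
Qed.

Let decI n : I n.+1 <= I n.
Proof.
apply: le_Rintegral => // x; rewrite /= => /sin_itv/andP[s0 s1].
by rewrite exprS ler_piMl ?exprn_ge0.
Qed.

Let prodI n : n.+1%:R * (I n * I n.+1) = pi / 2.
Proof.
elim: n => [|n IH]; first by rewrite I0 I1; lra.
by rewrite -IH mulrCA recI; ring.
Qed.

Let oddI n : I n.*2.+1 = \prod_(k < n) (k.*2.+2%:R / k.*2.+3%:R).
Proof.
elim: n => [|n IH]; first by rewrite big_ord0 I1.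
rewrite big_ord_recr/= -IH doubleS; apply: (mulfI (_ : n.*2.+3%:R != 0)); first by rewrite pnatr_eq0.
by rewrite recI mulrCA [_ * (_ / _)]mulrC divfK ?pnatr_eq0// mulrC.
Qed.

(** The integrals [I n] of [sin^n] over a quarter period decrease and satisfy
[(n + 1) I_n I_(n+1) = pi/2]; the product is [I_(2n+1)], whose square lies between two
neighbouring products. *)
Lemma wallis_bounds n (w : R := \prod_(k < n) (k.*2.+2%:R / k.*2.+3%:R)) :
  pi / (4 * (n%:R + 1)) <= w ^+ 2 <= pi / (4 * (n%:R + 2^-1)).
Proof.
have wE : w = I n.*2.+1 by rewrite oddI.
have w0 : 0 <= w by rewrite /w prodr_ge0// => i _; rewrite divr_ge0.
have n0 : 0 <= n%:R :> R by [].
have e2 : n.*2.+2%:R = 2 * (n%:R + 1) :> R by rewrite -addn2 natrD -muln2 natrM; ring.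
have e1 : n.*2.+1%:R = 2 * (n%:R + 2^-1) :> R by rewrite -addn1 natrD -muln2 natrM; field.
have p1 := prodI n.*2; have p2 := prodI n.*2.+1.
rewrite e1 in p1; rewrite e2 in p2.
have d1 := decI n.*2; have d2 := decI n.*2.+1; rewrite -wE in p1 p2 d1 d2.
apply/andP; split.
  rewrite ler_pdivrMr; last by lra.
  have h : w * I n.*2.+2 <= w ^+ 2 by rewrite expr2 ler_wpM2l.
  move: h p2; move: (w * _) (w ^+ 2) => a b h p2.
  have h' := ler_wpM2l (_ : 0 <= 4 * (n%:R + 1)) h.
  by have := h' ltac:(lra); lra.
rewrite ler_pdivlMr; last by lra.
have h : w ^+ 2 <= I n.*2 * w by rewrite expr2 ler_wpM2r.
move: h p1; move: (_ * w) (w ^+ 2) => a b h p1.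
have h' := ler_wpM2l (_ : 0 <= 4 * (n%:R + 2^-1)) h.
by have := h' ltac:(lra); lra.
Qed.
End Wallis.

Section Stirling.
Context {R : realType}.
Implicit Types n : nat.

(** The error of the midpoint rule for the integral of [ln] over an interval of length 1
centred at [n + 1]. *)
Definition stirling_term n : R :=
  (n%:R + 3 / 2) * ln (n%:R + 3 / 2) - (n%:R + 2^-1) * ln (n%:R + 2^-1) - ln n.+1%:R - 1.

Let lnfact n : R := \sum_(0 <= k < n) ln k.+1%:R.

Let stirling_sum n : series stirling_term n =
  (n%:R + 2^-1) * ln (n%:R + 2^-1) + 2^-1 * ln 2 - n%:R - lnfact n.
Proof.
rewrite /series/=/lnfact; elim: n => [|n IH].
  by rewrite !big_geq// add0r lnV ?posrE//; lra.
rewrite !big_nat_recr//= IH /stirling_term -[n.+1%:R]natr1.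
have -> : n%:R + 1 + 2^-1 = n%:R + 3 / 2 :> R by field.
ring.
Qed.

Let w n : R := \prod_(k < n) (k.*2.+2%:R / k.*2.+3%:R).

Let w_gt0 n : 0 < w n.
Proof. by rewrite /w prodr_gt0// => i _; rewrite divr_gt0. Qed.

Let ln_w n : ln (w n) = 2 * n%:R * ln 2 + 2 * lnfact n - lnfact n.*2.+1.
Proof.
elim: n => [|n IH].
  by rewrite /w big_ord0 /lnfact big_nat1 big_geq// ln1; ring.
have e2 : n.*2.+2%:R = 2 * n.+1%:R :> R by rewrite -doubleS -muln2 natrM mulrC.
rewrite /w big_ord_recr/= -/(w n) lnM ?posrE ?divr_gt0// ln_div ?posrE// IH.
rewrite /lnfact doubleS !big_nat_recr//= e2 lnM ?posrE//.
have -> : 2 * n.+1%:R * ln 2 = 2 * n%:R * ln 2 + 2 * ln 2 :> R by rewrite -[n.+1%:R]natr1; ring.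
ring.
Qed.

(** The partial sums are [- ln N!] up to elementary terms, so twice the [N]-th one less the
[(2 N + 1)]-st is the logarithm of a Wallis product, again up to elementary terms. *)
Lemma stirling_constant : cvgn (series stirling_term) ->
  limn (series stirling_term) = 2^-1 - 2^-1 * ln pi.
Proof.
move=> cS; set L := limn _; have pi0 := @pi_gt0 R.
pose v n : R := 2 * series stirling_term n.*2.+1 - 4 * series stirling_term n + 1.
have cv : v n @[n --> \oo] --> 2 * L - 4 * L + 1.
  apply: cvgD; last exact: cvg_cst.
  apply: cvgB; apply: cvgMr; last exact: cS.
  by apply: (cvg_subseq_ge (phi := fun n => n.*2.+1)) cS => n; lia.
pose e n : R := 2 * n.+1%:R^-1.
have ce : e n @[n --> \oo] --> 0.
  by rewrite -[X in _ --> X](mulr0 2); apply: cvgMr; exact: cvg_harmonic.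
have close n : `|ln pi - v n| <= e n.
  have /andP[] := @wallis_bounds R n; rewrite -/(w n).
  have n0 : 0 <= n%:R :> R by [].
  have n34 : 0 < n%:R + 3 / 4 :> R by lra.
  set q := n%:R + 2^-1 :> R; have q0 : 0 < q by rewrite /q; lra.
  rewrite ler_pdivrMr; last by lra.
  rewrite ler_pdivlMr; last by lra.
  move=> lo hi.
  pose W := w n ^+ 2 * (4 * q); have W0 : 0 < W by rewrite mulr_gt0 ?exprn_gt0//; lra.
  have lnW : ln W = 2 * ln (w n) + 2 * ln 2 + ln q.
    have l4 : ln 4 = 2 * ln 2 :> R.
      have -> : 4 = 2 * 2 :> R by ring.
      by rewrite lnM ?posrE//; ring.
    rewrite /W lnM ?posrE ?exprn_gt0//; last by lra.
    by rewrite expr2 !lnM ?posrE// l4; ring.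
  have hW1 : ln W <= ln pi by rewrite ler_ln ?posrE.
  have hW2 : ln pi <= ln W + (2 * q)^-1.
    have h1 : pi <= W * (1 + (2 * q)^-1).
      have -> : W * (1 + (2 * q)^-1) = w n ^+ 2 * (4 * (n%:R + 1)).
        by rewrite /W /q; field; lra.
      exact: lo.
    have i0 : 0 < (2 * q)^-1 by rewrite invr_gt0; lra.
    have h2 : ln pi <= ln (W * (1 + (2 * q)^-1)).
      by rewrite ler_ln ?posrE// mulr_gt0//; lra.
    apply: le_trans h2 _; rewrite lnM ?posrE//; last by lra.
    by rewrite lerD2l le_ln1Dx//; lra.
  pose x := (4 * q)^-1; have x0 : 0 < x by rewrite invr_gt0; lra.
  have qx : q * x = 4^-1 by rewrite /x; field; lra.
  pose Y := (4 * q + 1) * ln (1 + x).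
  have Y1 : 1 <= Y.
    have := ln1Dx_ge (ltW x0); rewrite ler_pdivrMr; last by lra.
    move=> h; have := ler_wpM2l (ltW q0) h.
    have -> : q * (ln (1 + x) * (1 + x)) = ln (1 + x) * (q + q * x) by ring.
    by rewrite qx /Y => h'; lra.
  have Y2 : Y <= 1 + x.
    have h : ln (1 + x) <= x by rewrite le_ln1Dx//; lra.
    have := ler_wpM2l (_ : 0 <= 4 * q + 1) h.
    have -> : (4 * q + 1) * x = 4 * (q * x) + x by ring.
    by rewrite qx /Y => h'; have := h' ltac:(lra); lra.
  have YE : ln (n%:R + 3 / 4) = ln q + ln (1 + x).
    rewrite -lnM ?posrE//; last by lra.
    by congr ln; rewrite mulrDr qx /q; field.
  have vE : ln W = v n + 1 - Y.
    rewrite lnW ln_w /v !stirling_sum.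
    have -> : n.*2.+1%:R = 2 * n%:R + 1 :> R by rewrite -addn1 natrD -muln2 natrM mulrC.
    have -> : 2 * n%:R + 1 + 2^-1 = 2 * (n%:R + 3 / 4) :> R by field.
    rewrite lnM ?posrE//.
    rewrite YE -/q /Y; have nE : n%:R = q - 2^-1 by rewrite /q; ring.
    move: (ln q) (ln (1 + x)) (lnfact n) (lnfact n.*2.+1) (ln 2) => lq lx a b c.
    by rewrite nE; field.
  have eE : e n = 2 * (q + 2^-1)^-1 by rewrite /e -[n.+1%:R]natr1 /q; congr (_ * _^-1); field.
  have h1 : (2 * q)^-1 + x <= e n.
    have -> : (2 * q)^-1 + x = 3 / (4 * q) by rewrite /x; field; lra.
    rewrite eE ler_pdivrMr; last by lra.
    have q2 : 2^-1 <= q by rewrite /q; lra.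
    have -> : 2 / (q + 2^-1) * (4 * q) = 8 * q / (q + 2^-1) by field; lra.
    rewrite ler_pdivlMr; last by lra.
    by clear eE vE YE; lra.
  have i0 : 0 < (2 * q)^-1 by rewrite invr_gt0; lra.
  move: h1 hW1 hW2 Y1 Y2 vE i0; move: ((2 * q)^-1) (e n) (ln W) (ln pi) (v n) Y => a b c d f g *.
  by rewrite ler_norml; lra.
have cpi : (fun _ : nat => ln pi : R) @ \oo --> 2 * L - 4 * L + 1.
  exact: cvg_close close ce cv.
have E : 2 * L - 4 * L + 1 = ln pi.
  by apply/esym; rewrite -(cvg_lim _ cpi)// lim_cst.
lra.
Qed.
End Stirling.

(** * The modes of the generating function near zero *)

Lemma mvt_derive {R : realType} (f df : R -> R) (x y : R) : x <= y ->
  (forall z : R, x <= z <= y -> is_derive z 1 f (df z)) ->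
  exists2 c, x <= c <= y & f y - f x = df c * (y - x).
Proof.
move=> xy fd.
have der (z : R) : z \in `]x, y[ -> is_derive z 1 f (df z).
  by rewrite in_itv/= => /andP[/ltW xz /ltW zy]; apply: fd; rewrite xz.
have cf : {within `[x, y], continuous f}.
  apply: derivable_within_continuous => z; rewrite in_itv/= => /fd zd.
  by apply: ex_derive.
have [c] := MVT_segment xy der cf.
by rewrite in_itv/= => cxy ->; exists c.
Qed.

Lemma norm_limn_le {R : realType} (u : nat -> R) (l B : R) :
  u @ \oo --> l -> (forall n, `|u n| <= B) -> `|l| <= B.
Proof.
move=> ul uB.
have nl : (fun n => `|u n|) @ \oo --> `|l| by exact: (cvg_norm ul).
rewrite -(cvg_lim _ nl)//; apply: limr_le; first by apply/cvg_ex; exists `|l|.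
by apply: nearW => n; exact: uB.
Qed.

Section BoseModes.
Context {R : realType}.
Implicit Types (x y : R) (m n : nat).

(** [- log] of a factor [1 - e^(-x)] of the generating function; [bose x = 1/(e^x - 1)] is
minus its derivative. *)
Definition mode_log x : R := - ln (1 - expR (- x)).
Definition bose x : R := expR (- x) / (1 - expR (- x)).

Lemma is_derive_mode_log x : 0 < x -> is_derive x 1 mode_log (- bose x).
Proof.
move=> x0; have q0 := expN_lt1 x0.
have lnD : is_derive ((fun z : R => 1 - expR (- z)) x) 1 (@ln R) (1 - expR (- x))^-1.
  exact: is_derive1_ln.
have -> : mode_log = (fun z => - ((@ln R) \o (fun z : R => 1 - expR (- z))) z) by [].
by apply: is_derive_eq; rewrite /bose /GRing.scale/=; field; rewrite gt_eqF.
Qed.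

Lemma is_derive_bose x : 0 < x ->
  is_derive x 1 bose (- (expR (- x) / (1 - expR (- x)) ^+ 2)).
Proof.
move=> x0; have q0 := expN_lt1 x0.
have wn : (fun z : R => 1 - expR (- z)) x != 0 by rewrite gt_eqF.
by apply: is_derive_eq; rewrite /GRing.scale/=; field; rewrite gt_eqF.
Qed.

Lemma bose_gt0 x : 0 < x -> 0 < bose x.
Proof. by move=> x0; rewrite divr_gt0 ?expR_gt0 ?expN_lt1. Qed.

Lemma mode_log_mvt x y : 0 < x -> x <= y ->
  exists2 c, x <= c <= y & mode_log x - mode_log y = bose c * (y - x).
Proof.
move=> x0 xy.
have [z /andP[xz _]|c cxy E] := @mvt_derive R mode_log (fun z => - bose z) x y xy.
  by apply: is_derive_mode_log; exact: lt_le_trans xz.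
by exists c => //; rewrite -opprB E mulNr opprK.
Qed.

Lemma bose_le_inv x : 0 < x -> bose x <= x^-1.
Proof.
move=> x0; have q0 := expN_lt1 x0.
rewrite ler_pdivrMr// -ler_pdivrMl ?invr_gt0// invrK.
have h := expR_ge1Dx x; have e0 := expR_gt0 (- x).
have := ler_wpM2r (ltW e0) h; rewrite -expRD subrr expR0; lra.
Qed.

Lemma mul_bose_bounds x : 0 < x -> 1 - x <= x * bose x <= 1.
Proof.
move=> x0; apply/andP; split; last first.
  by rewrite -ler_pdivlMl// mulr1 bose_le_inv.
have q0 := expN_lt1 x0; have h := expR_ge1Dx (- x).
rewrite mulrA ler_pdivlMr//; have e0 := expR_gt0 (- x).
have h2 : 1 - expR (- x) <= x by lra.
have h3 := ler_wpM2l (ltW e0) h2.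
by have := ler_wpM2r (ltW q0) h; lra.
Qed.

Lemma bose_lipschitz : exists2 K : R, 0 < K & forall x y, 0 < x -> x <= y ->
  0 <= bose x - bose y <= K * (y - x) / x ^+ 2.
Proof.
have [K K0 HK] := @radius_weight_bound R; exists K => // x y x0 xy.
have [z /andP[xz _]|c /andP[xc _] E] :=
  @mvt_derive R bose (fun z => - (expR (- z) / (1 - expR (- z)) ^+ 2)) x y xy.
  by apply: is_derive_bose; exact: lt_le_trans xz.
have c0 : 0 < c by exact: lt_le_trans xc.
have -> : bose x - bose y = expR (- c) / (1 - expR (- c)) ^+ 2 * (y - x).
  by rewrite -opprB E mulNr opprK.
have yx : 0 <= y - x by rewrite subr_ge0.
rewrite mulr_ge0 ?divr_ge0 ?expR_ge0 ?exprn_ge0 ?(ltW (expN_lt1 c0))//=.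
rewrite [leRHS]mulrAC ler_wpM2r//; apply: (le_trans (HK 2 c isT c0)).
have h1 : expR (- (c / 2)) <= 1 by rewrite expR_le1; lra.
have h2 : (c ^+ 2)^-1 <= (x ^+ 2)^-1.
  by rewrite lef_pV2 ?posrE ?exprn_gt0// lerXn2r ?nnegrE ?(ltW x0) ?(ltW c0).
rewrite -mulrA ler_wpM2l ?(ltW K0)// -[leRHS]mul1r.
by rewrite ler_pM ?expR_ge0 ?invr_ge0 ?exprn_ge0 ?(ltW c0).
Qed.

Lemma mode_log_ge0 x : 0 < x -> 0 <= mode_log x.
Proof.
move=> x0; rewrite oppr_ge0 ln_le0// lerBlDr lerDl; exact: expR_ge0.
Qed.

Lemma mode_log_le_bose x : 0 < x -> mode_log x <= bose x.
Proof.
move=> x0; have q0 := expN_lt1 x0; have b0 := bose_gt0 x0.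
rewrite /mode_log -lnV ?posrE//.
have -> : (1 - expR (- x))^-1 = 1 + bose x by rewrite /bose; field; rewrite gt_eqF.
by apply: le_ln1Dx; lra.
Qed.

Lemma mode_log_near0 x : 0 < x -> 0 <= mode_log x + ln x <= x.
Proof.
move=> x0; have q0 := expN_lt1 x0.
have h1 := expR_ge1Dx (- x); have h2 := one_sub_expN_ge (ltW x0).
have l1 : ln (1 - expR (- x)) <= ln x by rewrite ler_ln ?posrE//; lra.
have l2 : ln (x / (1 + x)) <= ln (1 - expR (- x)).
  by rewrite ler_ln ?posrE// divr_gt0//; lra.
move: l2; rewrite ln_div ?posrE//; last by lra.
have h3 : ln (1 + x) <= x by apply: le_ln1Dx; lra.
by rewrite /mode_log; lra.
Qed.

Lemma mul_bose_decr x y : 0 < x -> x <= y -> y * bose y <= x * bose x.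
Proof.
move=> x0 xy.
have [z /andP[xz _]|c /andP[xc _] E] :=
  @mvt_derive R (fun z => z * bose z) (fun z => bose z - z * (expR (- z) / (1 - expR (- z)) ^+ 2)) x y xy.
  have dz := is_derive_bose (lt_le_trans x0 xz).
  by apply: is_derive_eq; rewrite /GRing.scale/=; ring.
rewrite -subr_le0 E; have c0 : 0 < c by exact: lt_le_trans xc.
have q0 := expN_lt1 c0; have e0 := expR_gt0 (- c); have h := expR_ge1Dx (- c).
rewrite mulr_le0_ge0 ?subr_ge0//.
have -> : bose c - c * (expR (- c) / (1 - expR (- c)) ^+ 2)
   = expR (- c) / (1 - expR (- c)) ^+ 2 * (1 - c - expR (- c)).
  by rewrite /bose; field; rewrite gt_eqF.
by rewrite mulr_ge0_le0 ?divr_ge0 ?expR_ge0 ?exprn_ge0 ?(ltW q0)//; lra.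
Qed.

Lemma mul_bose_cvg1 (t : R^nat) c : 0 < c -> (forall n, 0 < t n) -> t @ \oo --> (0 : R) ->
  (fun n => c * t n * bose (c * t n)) @ \oo --> (1 : R).
Proof.
move=> c0 t0 tc; apply: (@cvg_close _ _ (fun=> 1) (fun n => c * t n)) => [n||].
- have ct : 0 < c * t n by rewrite mulr_gt0.
  by have := mul_bose_bounds ct; rewrite ler_norml; lra.
- by rewrite -[X in _ --> X](mulr0 c); exact: cvgMr.
- exact: cvg_cst.
Qed.

Lemma mode_log_sub_cvg (t : R^nat) a b : 0 < a -> 0 < b -> (forall n, 0 < t n) -> t @ \oo --> (0 : R) ->
  (fun n => mode_log (a * t n) - mode_log (b * t n)) @ \oo --> ln b - ln a.
Proof.
move=> a0 b0 t0 tc; apply: (@cvg_close _ _ (fun=> ln b - ln a) (fun n => (a + b) * t n)) => [n||].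
- have := t0 n => tn0.
  have := mode_log_near0 (mulr_gt0 a0 tn0); have := mode_log_near0 (mulr_gt0 b0 tn0).
  by rewrite !lnM ?posrE// ler_norml; move: (mode_log _) (mode_log _) => p q; lra.
- by rewrite -[X in _ --> X](mulr0 (a + b)); exact: cvgMr.
- exact: cvg_cst.
Qed.
End BoseModes.

Lemma tannery_inv_sq {R : realType} (u : nat -> nat -> R) (l : nat -> R) (K : R) (M : nat -> nat) :
  (forall n m, `|u n m| <= K * (m.+1%:R ^+ 2)^-1) ->
  (forall m, u ^~ m @ \oo --> l m) -> (forall k, \forall n \near \oo, (k <= M n)%N) ->
  cvgn (series l) /\ (\sum_(0 <= m < M n) u n m @[n --> \oo] --> limn (series l)).
Proof.
move=> ub ul Moo; apply: (@tannery R u l (fun m => K * (m.+1%:R ^+ 2)^-1)) => //.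
  by apply: nearW => n m _; exact: ub.
exact/is_cvg_seriesZ/inv_sq_series_cvg.
Qed.

Section BoseSums.
Context {R : realType}.
Variables (t : nat -> R) (M : nat -> nat).
Hypotheses (t_gt0 : forall n, 0 < t n) (t_cvg0 : t @ \oo --> (0 : R))
  (tM : forall n, 1 <= t n ^+ 2 * (M n)%:R).

(** The condition [1 <= t^2 M] forces more than this: [t M >= 1/t], so that the modes left
out are exponentially small. *)
Lemma size_cvg_oo K : \forall n \near \oo, (K <= M n)%N.
Proof.
near=> n; rewrite leqNgt; apply/negP => MK.
have K1 : 0 < K.+1%:R^-1 :> R by rewrite invr_gt0.
have tK : t n <= K.+1%:R^-1.
  by apply: (le_trans (ler_norm _)); near: n; exact: (cvgr0_norm_le _ t_cvg0).
have := tM n; apply/negP; rewrite -ltNge.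
have t0 := t_gt0 n.
apply: (@le_lt_trans _ _ (K.+1%:R^-1 ^+ 2 * K%:R)).
  rewrite ler_pM ?sqr_ge0// ?ler_nat ?(ltnW MK)//.
  by rewrite lerXn2r ?nnegrE ?(ltW t0) ?(ltW K1).
rewrite exprVn -ltr_pdivlMl ?invr_gt0 ?exprn_gt0// invrK mulr1 -natrX ltr_nat; nia.
Unshelve. all: by end_near.
Qed.

Let size_gt0 n : 0 < (M n)%:R :> R.
Proof.
have := tM n; case: (M n) => [|k] //; rewrite mulr0 => h.
by have := lt_le_trans (@ltr01 R) h; rewrite ltxx.
Qed.

Lemma tail_inv_le n : (t n * (M n)%:R)^-1 <= t n.
Proof.
have t0 := t_gt0 n; have M0 := size_gt0 n.
have h := tM n; have p : 0 < t n * (M n)%:R by rewrite mulr_gt0.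
by rewrite -[leLHS]mulr1 ler_pdivrMl// mulrAC -expr2.
Qed.

Let K_exists := @bose_lipschitz R.

Lemma euler_gamma_series : let l m := m.+1%:R^-1 - (ln m.+2%:R - ln m.+1%:R) : R in
  cvgn (series l) -> limn (series l) = euler_gamma.
Proof.
move=> l cl; apply/esym; apply: cvg_lim => //.
rewrite -cvg_shiftS.
have E n : series harmonic n.+1 - ln n.+1%:R = series l n + n.+1%:R^-1 :> R.
  rewrite /series/= /l; elim: n => [|n IH].
    by rewrite big_nat1 big_geq// ln1 /harmonic/= invr1; ring.
  rewrite big_nat_recr//= [in RHS]big_nat_recr//=.
  move: IH; rewrite /harmonic/=; move: (\sum_(0 <= i < n.+1) _) (\sum_(0 <= i < n) _) => a b h.
  by rewrite (_ : a = b + n.+1%:R^-1 + ln n.+1%:R); [ring|rewrite -h; ring].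
rewrite (_ : [sequence _]_n = (fun n => series l n + n.+1%:R^-1)); last by apply/funext.
have h : series l n + n.+1%:R^-1 @[n --> \oo] --> limn (series l) + 0.
  by apply: cvgD => //; exact: cvg_harmonic.
by move: h; rewrite addr0.
Qed.

(** The term [t bose (t j)] differs by [O(1/j^2)] from the decrement of [mode_log] over
[t j, t (j + 1)]. The decrements telescope to [- ln t + o(1)], and the differences tend to
[1/j - ln ((j + 1)/j)], whose sum is the Euler constant. *)
Lemma bose_sum_cvg :
  (fun n => \sum_(0 <= m < M n) t n * bose (t n * m.+1%:R) + ln (t n)) @ \oo
    --> (euler_gamma : R).
Proof.
have [K K0 HK] := K_exists.
pose l m : R := m.+1%:R^-1 - (ln m.+2%:R - ln m.+1%:R).
pose u n m := t n * bose (t n * m.+1%:R)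
  - (mode_log (t n * m.+1%:R) - mode_log (t n * m.+2%:R)).
have p n m : 0 < t n * m.+1%:R by rewrite mulr_gt0.
have ub n m : `|u n m| <= K * (m.+1%:R ^+ 2)^-1.
  have t0 := t_gt0 n.
  have le2 : t n * m.+1%:R <= t n * m.+2%:R by rewrite ler_pM2l// ler_nat.
  have [c /andP[c1 c2] E] := mode_log_mvt (p n m) le2.
  have d2 : t n * m.+2%:R - t n * m.+1%:R = t n by rewrite -[m.+2%:R]natr1; ring.
  rewrite /u E d2 mulrC -mulrBl.
  have /andP[h0 h1] := HK _ _ (p n m) c1.
  rewrite normrM !ger0_norm ?(ltW t0)//.
  have h2 : K * (c - t n * m.+1%:R) / (t n * m.+1%:R) ^+ 2 <= K * t n / (t n * m.+1%:R) ^+ 2.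
    rewrite ler_wpM2r ?invr_ge0 ?sqr_ge0// ler_wpM2l ?(ltW K0)//; lra.
  have := ler_wpM2r (ltW t0) (le_trans h1 h2).
  move/le_trans; apply; rewrite le_eqVlt; apply/orP; left; apply/eqP.
  have j0 : m.+1%:R != 0 :> R by rewrite pnatr_eq0.
  by move: (m.+1%:R : R) j0 => j j0; field; rewrite ?j0 ?gt_eqF.
have ul m : u ^~ m @ \oo --> l m.
  apply: cvgB.
    have h := mul_bose_cvg1 (ltr0Sn R m) t_gt0 t_cvg0.
    rewrite -[X in _ --> X]mulr1 (_ : (fun n => _) = (fun n => m.+1%:R^-1 * (m.+1%:R * t n * bose (m.+1%:R * t n)))).
      exact: cvgMr.
    have j0 : m.+1%:R != 0 :> R by rewrite pnatr_eq0.
    by apply/funext => n; move: (m.+1%:R : R) j0 => j j0; rewrite [j * t n]mulrC; field.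
  have h := mode_log_sub_cvg (ltr0Sn R m) (ltr0Sn R m.+1) t_gt0 t_cvg0.
  rewrite (_ : (fun n => _) = (fun n => mode_log (m.+1%:R * t n) - mode_log (m.+2%:R * t n))) //.
  by apply/funext => n; rewrite ![t n * _]mulrC.
have [cl cu] := tannery_inv_sq ub ul size_cvg_oo.
rewrite -(euler_gamma_series cl).
apply: cvg_close cu => [n|].
- instantiate (1 := fun n => 2 * t n).
  have t0 := t_gt0 n; have M0 := size_gt0 n.
  have tele : \sum_(0 <= m < M n) (mode_log (t n * m.+1%:R) - mode_log (t n * m.+2%:R))
      = mode_log (t n) - mode_log (t n * (M n).+1%:R).
    elim: (M n) => [|k IH]; first by rewrite big_geq// mulr1 subrr.
    by rewrite big_nat_recr//= IH; ring.
  rewrite /u sumrB tele.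
  have := mode_log_near0 t0.
  have a0 : 0 < t n * (M n).+1%:R by rewrite mulr_gt0.
  have := mode_log_ge0 a0.
  have : mode_log (t n * (M n).+1%:R) <= t n.
    apply: (le_trans (mode_log_le_bose a0)); apply: (le_trans (bose_le_inv a0)).
    apply: le_trans (tail_inv_le n); rewrite lef_pV2 ?posrE ?mulr_gt0//.
    by rewrite ler_wpM2l ?(ltW t0)// ler_nat.
  by move: (mode_log _) (mode_log _) (\sum_(0 <= i < _) _) (ln _) => a b c d; rewrite ler_norml; lra.
- by rewrite -[X in _ --> X](mulr0 2); exact: cvgMr.
Qed.

(** [x bose x] is decreasing and tends to 1 at 0, so these sums regularize the series
of the [b m/(m + 1)] in the sense of Abel. *)
Lemma abel_bose_sum (b : nat -> R) : cvgn (series (fun m => b m / m.+1%:R)) ->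
  (fun n => \sum_(0 <= m < M n) t n * bose (t n * m.+1%:R) * b m) @ \oo
    --> limn (series (fun m => b m / m.+1%:R)).
Proof.
move=> cb.
pose k n m := t n * m.+1%:R * bose (t n * m.+1%:R).
have p n m : 0 < t n * m.+1%:R by rewrite mulr_gt0.
have h1 : \forall n \near \oo, (forall m, 0 <= k n m.+1 <= k n m) /\ 0 <= k n 0%N <= 1.
  apply: nearW => n; split=> [m|].
    rewrite mulr_ge0 ?(ltW (p _ _)) ?(ltW (bose_gt0 (p _ _)))//=.
    by apply: mul_bose_decr => //; rewrite ler_pM2l// ler_nat.
  rewrite mulr_ge0 ?(ltW (p _ _)) ?(ltW (bose_gt0 (p _ _)))//=.
  by have /andP[] := mul_bose_bounds (p n 0%N).
have h2 m : k ^~ m @ \oo --> (1 : R).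
  have h := mul_bose_cvg1 (ltr0Sn R m) t_gt0 t_cvg0.
  rewrite (_ : k ^~ m = (fun n => m.+1%:R * t n * bose (m.+1%:R * t n)))//.
  by apply/funext => n; rewrite /k [t n * _]mulrC.
have h3 := @abel_summation_limit R (fun m => b m / m.+1%:R) k M cb h1 h2 size_cvg_oo.
move: h3; rewrite [X in X @ \oo --> _ -> _](_ : _ = (fun n => \sum_(0 <= m < M n) t n * bose (t n * m.+1%:R) * b m))//.
apply/funext => n; apply: eq_bigr => m _; rewrite /k.
have j0 : m.+1%:R != 0 :> R by rewrite pnatr_eq0.
by move: (m.+1%:R : R) j0 => j j0; field.
Qed.
End BoseSums.

(** * Riemann sums of the logarithmic modes *)

Section Dilogarithm.
Context {R : realType}.
Implicit Types (x y z d : R) (k N : nat).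

(** As a function of [q = e^(-y)] the remainder vanishes at 0 and has derivative
[q^N/(1 - q)]. *)
Lemma mode_log_series y : 0 < y ->
  series (fun k => expR (- y) ^+ k.+1 / k.+1%:R) @ \oo --> mode_log y.
Proof.
move=> y0; pose q := expR (- y).
have q0 : 0 < q by exact: expR_gt0.
have q1 : q < 1 by rewrite expR_lt1 oppr_lt0.
pose phi N z := - ln (1 - z) - \sum_(0 <= k < N) z ^+ k.+1 / k.+1%:R.
have dphi N z : 0 <= z <= q -> is_derive z 1 (phi N) (z ^+ N / (1 - z)).
  move=> /andP[z0 zq]; have z1 : 0 < 1 - z by lra.
  elim: N => [|N IH].
    have lnD : is_derive ((fun z : R => 1 - z) z) 1 (@ln R) (1 - z)^-1 by exact: is_derive1_ln.
    have -> : phi 0%N = (fun z => - ((@ln R) \o (fun z : R => 1 - z)) z).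
      by apply/funext => w; rewrite /phi big_geq// subr0.
    by apply: is_derive_eq; rewrite expr0 /GRing.scale/=; field; rewrite gt_eqF.
  have -> : phi N.+1 = (fun w => phi N w - w ^+ N.+1 / N.+1%:R).
    by apply/funext => w; rewrite /phi big_nat_recr//=; ring.
  have dX : is_derive z 1 (fun w : R => w ^+ N.+1 / N.+1%:R) (z ^+ N).
    have := is_deriveZ (N.+1%:R^-1) (is_deriveX N.+1 (is_derive_id (z : R) 1)).
    set g := (X in is_derive _ _ X _); set v1 := (X in is_derive _ _ _ X).
    have -> : g = (fun w : R => w ^+ N.+1 / N.+1%:R).
      by apply/funext => w; rewrite /g !fctE/= mulrC.
    have -> // : v1 = z ^+ N.
    by rewrite /v1 /GRing.scale/= mulr1 mulrA mulVf ?mul1r// pnatr_eq0.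
  have := is_deriveB IH dX; set v1 := (X in is_derive _ _ _ X).
  have -> : v1 = z ^+ N.+1 / (1 - z) by rewrite /v1 exprS; field; rewrite gt_eqF.
  by [].
have close N : `|mode_log y - series (fun k => q ^+ k.+1 / k.+1%:R) N| <= (1 - q)^-1 * q ^+ N.
  have E0 : phi N 0 = 0.
    rewrite /phi subr0 ln1 big1 ?oppr0 ?addr0// => k _; by rewrite expr0n/= mul0r.
  have [c /andP[c0 cq] E] := mvt_derive (ltW q0) (dphi N).
  move: E; rewrite E0 !subr0 => E.
  have -> : mode_log y - series (fun k => q ^+ k.+1 / k.+1%:R) N = c ^+ N / (1 - c) * q by exact: E.
  have c1 : 0 < 1 - c by lra.
  rewrite ger0_norm; last by rewrite !mulr_ge0 ?exprn_ge0 ?invr_ge0 ?(ltW c1) ?(ltW q0).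
  have h1 : c ^+ N <= q ^+ N by rewrite lerXn2r ?nnegrE ?(ltW q0).
  have h2 : (1 - c)^-1 <= (1 - q)^-1 by rewrite lef_pV2 ?posrE; lra.
  apply: (@le_trans _ _ (q ^+ N / (1 - q) * 1)).
    rewrite ler_pM ?(ltW q0) ?(ltW q1)//; first by rewrite mulr_ge0 ?exprn_ge0 ?invr_ge0 ?(ltW c1).
    by rewrite ler_pM ?exprn_ge0 ?invr_ge0 ?(ltW c1).
  by rewrite mulr1 mulrC.
apply: (@cvg_close _ _ (fun=> mode_log y) (fun N => (1 - q)^-1 * q ^+ N)) => [N||].
- by rewrite distrC; exact: close.
- rewrite -[X in _ --> X](mulr0 (1 - q)^-1); apply: cvgMr; apply: cvg_expr.
  by rewrite ger0_norm ?(ltW q0).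
- exact: cvg_cst.
Qed.

Lemma sum_geometric_le y N : 0 < y -> \sum_(0 <= k < N) expR (- y) ^+ k.+1 <= y^-1.
Proof.
move=> y0; apply: le_trans (@sum_expN_le R S y N (fun i => ltnSn i) y0).
rewrite big_mkord le_eqVlt; apply/orP; left; apply/eqP; apply: eq_bigr => i _.
by rewrite -expRM_natl mulrN mulrC.
Qed.

(** [j <= (2/y) e^(j y/2)] reduces to a geometric sum of half the rate. *)
Lemma sum_natmul_geometric_le y N : 0 < y ->
  \sum_(0 <= k < N) k.+1%:R * expR (- y) ^+ k.+1 <= 4 / y ^+ 2.
Proof.
move=> y0; have y2 : 0 < y / 2 by lra.
apply: (@le_trans _ _ (\sum_(0 <= k < N) 2 / y * expR (- (y / 2)) ^+ k.+1)); last first.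
  rewrite -mulr_sumr; have := ler_wpM2l (_ : 0 <= 2 / y) (sum_geometric_le N y2).
  move/(_ (ltW (divr_gt0 (ltr0Sn R 1) y0)))/le_trans; apply.
  by rewrite le_eqVlt; apply/orP; left; apply/eqP; field; rewrite gt_eqF.
apply: ler_sum => k _.
have -> : expR (- y) = expR (- (y / 2)) * expR (- (y / 2)) by rewrite -expRD; congr expR; field.
rewrite exprMn mulrA ler_wpM2r ?exprn_ge0 ?expR_ge0//.
rewrite -ler_pdivlMr ?exprn_gt0 ?expR_gt0// -exprVn -expRN opprK -expRM_natl.
have h := expR_ge1Dx (k.+1%:R * (y / 2)).
have h2 : k.+1%:R * (y / 2) <= expR (k.+1%:R * (y / 2)) by lra.
have := ler_wpM2l (_ : 0 <= 2 / y) h2.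
move=> /(_ (ltW (divr_gt0 (ltr0Sn R 1) y0))); apply: le_trans.
by rewrite le_eqVlt; apply/orP; left; apply/eqP; field; rewrite gt_eqF.
Qed.

Lemma expR_sub_expRN_bounds z : 0 <= z ->
  0 <= expR z - expR (- z) - 2 * z <= z ^+ 3 * expR z.
Proof.
move=> z0.
have [w _|c /andP[c0 cz]] := @mvt_derive R (fun z => expR z - expR (- z) - 2 * z)
  (fun z => expR z + expR (- z) - 2) 0 z z0.
  by apply: is_derive_eq; rewrite /GRing.scale/=; ring.
rewrite oppr0 !expR0 subrr mulr0 !(subr0, addr0) => ->.
have -> : expR c + expR (- c) - 2 = (expR c - 1) ^+ 2 * expR (- c).
  by rewrite expRN; have := expR_gt0 c; move: (expR c) => v v0; field; rewrite gt_eqF.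
apply/andP; split; first by rewrite mulr_ge0// mulr_ge0 ?sqr_ge0 ?expR_ge0.
rewrite [z ^+ 3]exprS -[leRHS]mulrA [leLHS]mulrC ler_wpM2l//.
have h1 : expR c - 1 <= c * expR c.
  have := expR_ge1Dx (- c); have e := expR_gt0 c => h.
  have := ler_wpM2l (ltW e) h; rewrite expRN divff ?gt_eqF//; lra.
have h0 : 0 <= expR c - 1 by have := expR_ge1Dx c; lra.
apply: (@le_trans _ _ ((c * expR c) ^+ 2 * expR (- c))).
  by rewrite ler_wpM2r ?expR_ge0// lerXn2r ?nnegrE// mulr_ge0 ?expR_ge0.
rewrite exprMn expr2 expRN; have -> : c ^+ 2 * (expR c * expR c) / expR c = c ^+ 2 * expR c.
  by have := expR_gt0 c; move: (expR c) => v v0; field; rewrite gt_eqF.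
by rewrite ler_pM ?sqr_ge0 ?expR_ge0// ?ler_expR// lerXn2r ?nnegrE.
Qed.

(** [Li_2 (e^(-y))], a primitive of [- mode_log]. *)
Definition dilog y : R := limn (series (fun k => expR (- y) ^+ k.+1 / k.+1%:R ^+ 2)).

Lemma dilog_term_le y k : 0 <= y ->
  0 <= expR (- y) ^+ k.+1 / k.+1%:R ^+ 2 <= expR (- y) * (k.+1%:R ^+ 2)^-1.
Proof.
move=> y0; rewrite divr_ge0 ?exprn_ge0 ?expR_ge0//= ler_wpM2r ?invr_ge0 ?sqr_ge0//.
by rewrite exprS ler_piMr ?expR_ge0// exprn_ile1 ?expR_ge0// expR_le1; lra.
Qed.

Lemma dilog_cvg y : 0 <= y -> series (fun k => expR (- y) ^+ k.+1 / k.+1%:R ^+ 2) @ \oo --> dilog y.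
Proof.
move=> y0; apply: (series_le_cvg _ _ _ (is_cvg_seriesZ (k := expR (- y)) inv_sq_series_cvg)) => k.
- by case/andP: (dilog_term_le k y0).
- by rewrite mulr_ge0 ?expR_ge0 ?invr_ge0 ?sqr_ge0.
- by case/andP: (dilog_term_le k y0).
Qed.

Lemma dilog_bounds y : 0 <= y -> 0 <= dilog y <= expR (- y) * (pi ^+ 2 / 6).
Proof.
move=> y0; have c := dilog_cvg y0; apply/andP; split.
  apply: (@limr_ge _ _ _ _ 0 _ c); apply: nearW => N; apply: sumr_ge0 => k _.
  by case/andP: (dilog_term_le k y0).
have cz : series (fun k => expR (- y) * (k.+1%:R ^+ 2)^-1 : R) @ \oo --> expR (- y) * (pi ^+ 2 / 6).
  have h0 : series (fun k => (k.+1%:R ^+ 2)^-1 : R) @ \oo --> (pi ^+ 2 / 6 : R).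
    by rewrite -zeta2E; exact: inv_sq_series_cvg.
  have h1 : (fun N => expR (- y) * series (fun k => (k.+1%:R ^+ 2)^-1 : R) N) @ \oo
      --> expR (- y) * (pi ^+ 2 / 6) by exact: cvgMr.
  rewrite (_ : series _ = (fun N => expR (- y) * series (fun k => (k.+1%:R ^+ 2)^-1 : R) N))//.
  by apply/funext => N; rewrite /series/= mulr_sumr.
apply: (ler_cvg_to c cz); apply: nearW => N; apply: ler_sum => k _.
by case/andP: (dilog_term_le k y0).
Qed.

(** The error of the midpoint rule for [mode_log], through its primitive: the mode
[e^(-k x)/k] errs by at most [d^3 k e^(-k (x - d))]. *)
Lemma dilog_midpoint x d : 0 < d -> d <= x / 2 ->
  `|dilog (x - d) - dilog (x + d) - 2 * d * mode_log x| <= 16 * d ^+ 3 / x ^+ 2.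
Proof.
move=> d0 dx; have x0 : 0 < x by lra.
have y1 : 0 <= x - d by lra. have y2 : 0 <= x + d by lra.
have c3 : (fun N => 2 * d * series (fun k => expR (- x) ^+ k.+1 / k.+1%:R) N) @ \oo
  --> 2 * d * mode_log x by apply: cvgMr; exact: mode_log_series.
have c : (fun N => series (fun k => expR (- (x - d)) ^+ k.+1 / k.+1%:R ^+ 2) N
    - series (fun k => expR (- (x + d)) ^+ k.+1 / k.+1%:R ^+ 2) N
    - 2 * d * series (fun k => expR (- x) ^+ k.+1 / k.+1%:R) N) @ \oo
  --> dilog (x - d) - dilog (x + d) - 2 * d * mode_log x.
  by apply: cvgB => //; apply: cvgB; exact: dilog_cvg.
apply: norm_limn_le c _ => N.
have -> : series (fun k => expR (- (x - d)) ^+ k.+1 / k.+1%:R ^+ 2) N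
    - series (fun k => expR (- (x + d)) ^+ k.+1 / k.+1%:R ^+ 2) N
    - 2 * d * series (fun k => expR (- x) ^+ k.+1 / k.+1%:R) N
  = \sum_(0 <= k < N) (expR (k.+1%:R * d) - expR (- (k.+1%:R * d)) - 2 * (k.+1%:R * d)) * expR (- x) ^+ k.+1 / k.+1%:R ^+ 2.
  rewrite /series/= mulr_sumr -!sumrB; apply: eq_bigr => k _.
  have -> : expR (- (x - d)) ^+ k.+1 = expR (k.+1%:R * d) * expR (- x) ^+ k.+1.
    by rewrite -!expRM_natl -expRD; congr expR; ring.
  have -> : expR (- (x + d)) ^+ k.+1 = expR (- (k.+1%:R * d)) * expR (- x) ^+ k.+1.
    by rewrite -!expRM_natl -expRD; congr expR; ring.
  have j0 : k.+1%:R != 0 :> R by rewrite pnatr_eq0.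
  by move: (k.+1%:R : R) (expR (_ * d)) (expR (- (_ * d))) (expR (- x) ^+ _) j0 => j a b e j0; field.
apply: le_trans (ler_norm_sum _ _ _) _.
apply: (@le_trans _ _ (\sum_(0 <= k < N) d ^+ 3 * (k.+1%:R * expR (- (x - d)) ^+ k.+1))).
  apply: ler_sum => k _.
  have j0 : 0 < k.+1%:R :> R by [].
  have /andP[b0 b1] := expR_sub_expRN_bounds (mulr_ge0 (ltW j0) (ltW d0)).
  rewrite ger0_norm; last by rewrite !mulr_ge0 ?exprn_ge0 ?expR_ge0 ?invr_ge0.
  have -> : expR (- (x - d)) ^+ k.+1 = expR (k.+1%:R * d) * expR (- x) ^+ k.+1.
    by rewrite -!expRM_natl -expRD; congr expR; ring.
  have e0 : 0 <= expR (- x) ^+ k.+1 / k.+1%:R ^+ 2 by rewrite divr_ge0 ?exprn_ge0 ?expR_ge0.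
  rewrite -[leLHS]mulrA; apply: (le_trans (ler_wpM2r e0 b1)).
  rewrite le_eqVlt; apply/orP; left; apply/eqP.
  have j1 : k.+1%:R != 0 :> R by rewrite pnatr_eq0.
  by move: (k.+1%:R : R) (expR (_ * d)) (expR (- x) ^+ _) j1 => j a b j1; field.
rewrite -mulr_sumr (_ : 16 * d ^+ 3 / x ^+ 2 = d ^+ 3 * (16 / x ^+ 2)); last by field; rewrite gt_eqF.
rewrite ler_wpM2l ?exprn_ge0 ?(ltW d0)//.
apply: le_trans (sum_natmul_geometric_le _ _) _; first by lra.
have -> : 16 / x ^+ 2 = 4 / (x / 2) ^+ 2 by field; rewrite gt_eqF.
rewrite ler_wpM2l// lef_pV2 ?posrE ?exprn_gt0//; [|lra|lra].
by rewrite lerXn2r ?nnegrE; lra.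
Qed.
End Dilogarithm.

Section DilogarithmNearZero.
Context {R : realType}.
Implicit Types (y z : R) (k N : nat).

Let E z : R := (1 - expR (- z)) / z.
Let D z : R := (1 - expR (- z) * (1 + z)) / z ^+ 2.

Let E_deriv z : 0 < z -> is_derive z 1 E (- D z).
Proof.
move=> z0; have zn : (id : R -> R) z != 0 by rewrite /= gt_eqF.
have -> : E = (fun z : R => (1 - expR (- z)) * ((id : R -> R) z)^-1) by [].
have dV : is_derive z 1 (fun z : R => ((id : R -> R) z)^-1) (- z ^- 2 *: 1).
  exact: (is_deriveV zn (is_derive_id (z : R) 1)).
have d1 : is_derive z 1 (fun z : R => 1 - expR (- z)) (expR (- z)).
  by apply: is_derive_eq; rewrite /GRing.scale/=; ring.
have := is_deriveM d1 dV; set g := (X in is_derive _ _ X _); set v := (X in is_derive _ _ _ X).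
have -> : g = (fun z => (1 - expR (- z)) * ((id : R -> R) z)^-1) by [].
have -> // : v = - D z.
by rewrite /v /D /GRing.scale/=; field; rewrite gt_eqF.
Qed.

Let quad z : 0 <= z -> expR (- z) * (z ^+ 2 + 2 * z + 2) <= 2.
Proof.
move=> z0.
have [w _|c /andP[c0 cz]] := @mvt_derive R (fun z => expR (- z) * (z * z + 2 * z + 2))
  (fun z => - (expR (- z) * z ^+ 2)) 0 z z0.
  by apply: is_derive_eq; rewrite /GRing.scale/=; ring.
rewrite oppr0 expR0 !(mulr0, subr0, addr0, add0r, mul1r) -expr2 => h.
by rewrite -subr_le0 h mulNr oppr_le0 mulr_ge0// mulr_ge0 ?expR_ge0 ?sqr_ge0.
Qed.

Let D_decr (x z : R) : 0 < x -> x <= z -> D z <= D x.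
Proof.
move=> x0 xz.
have dD (w : R) : 0 < w -> is_derive w 1 D ((expR (- w) * (w ^+ 2 + 2 * w + 2) - 2) / w ^+ 3).
  move=> w0; pose sq (z : R) : R := z * z.
  have wn : sq w != 0 by rewrite /sq mulf_neq0 ?gt_eqF.
  have -> : D = (fun z : R => (1 - expR (- z) * (1 + z)) * (sq z)^-1).
    by apply/funext => v; rewrite /D /sq expr2.
  have d2 : is_derive w 1 sq (2 * w).
    by rewrite /sq; apply: is_derive_eq; rewrite /GRing.scale/=; ring.
  have dV := is_deriveV (f := sq) wn d2.
  have d1 : is_derive w 1 (fun z : R => 1 - expR (- z) * (1 + z)) (expR (- w) * w).
    by apply: is_derive_eq; rewrite /GRing.scale/=; ring.
  have := is_deriveM d1 dV; set g := (X in is_derive _ _ X _); set v := (X in is_derive _ _ _ X).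
  have -> : g = (fun z : R => (1 - expR (- z) * (1 + z)) * (sq z)^-1) by [].
  have -> // : v = (expR (- w) * (w ^+ 2 + 2 * w + 2) - 2) / w ^+ 3.
  by rewrite /v /sq /GRing.scale/=; field; rewrite gt_eqF.
have der (w : R) : x <= w <= z -> is_derive w 1 D ((expR (- w) * (w ^+ 2 + 2 * w + 2) - 2) / w ^+ 3).
  by case/andP=> xw _; apply: dD; exact: lt_le_trans xw.
have [c /andP[xc _] h] := mvt_derive xz der.
have c0 : 0 < c by exact: lt_le_trans xc.
rewrite -subr_le0 h mulr_le0_ge0 ?subr_ge0// mulr_le0_ge0 ?invr_ge0 ?exprn_ge0 ?(ltW c0)//.
by rewrite subr_le0 quad// ltW.
Qed.

Let E_sub (x z : R) : 0 < x -> x <= z -> D z * (z - x) <= E x - E z <= D x * (z - x).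
Proof.
move=> x0 xz.
have der (w : R) : x <= w <= z -> is_derive w 1 E (- D w).
  by case/andP=> xw _; apply: E_deriv; exact: lt_le_trans xw.
have [c /andP[xc cz] h] := mvt_derive xz der.
have c0 : 0 < c by exact: lt_le_trans xc.
have -> : E x - E z = D c * (z - x) by rewrite -opprB h mulNr opprK.
by rewrite !ler_wpM2r ?subr_ge0// D_decr.
Qed.

Let E_le z : 0 < z -> E z <= 1 /\ E z <= z^-1.
Proof.
move=> z0; have e0 := expR_gt0 (- z); have h := expR_ge1Dx (- z); split.
  by rewrite /E ler_pdivrMr//; lra.
by rewrite -[leRHS]mul1r ler_wpM2r ?invr_ge0 ?(ltW z0)//; lra.
Qed.

Let E_ge z : 0 < z -> 1 - z <= E z.
Proof.
move=> z0; rewrite ler_pdivlMr//; apply: le_trans (one_sub_expN_ge (ltW z0)).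
by rewrite ler_pdivlMr; [|lra]; have := mulr_ge0 (ltW z0) (sqr_ge0 z); rewrite expr2; lra.
Qed.

(** With [E z = (1 - e^(-z))/z] and [D = - E'], the sum over [k] of [y D(k y)] equals
[(pi^2/6 - dilog y)/y - mode_log y]. Since [D] decreases, it is a Riemann sum within [y]
of the total variation of [E], which falls from 1 to 0. *)
Lemma dilog_near0 y : 0 < y -> `|dilog y - (pi ^+ 2 / 6 + y * ln y - y)| <= 2 * y ^+ 2.
Proof.
move=> y0.
pose S N := \sum_(0 <= k < N) y * D (k.+1%:R * y).
have p k : 0 < k.+1%:R * y by rewrite mulr_gt0.
have step k : k.+1%:R * y <= k.+2%:R * y by rewrite ler_wpM2r ?(ltW y0)// ler_nat.
have len k : k.+2%:R * y - k.+1%:R * y = y by rewrite -[k.+2%:R]natr1; ring.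
have S_lo N : E y - E (N.+1%:R * y) <= S N.
  elim: N => [|N IH]; first by rewrite mul1r subrr /S big_geq.
  rewrite /S big_nat_recr//= -/(S N); have /andP[_] := E_sub (p N) (step N).
  by rewrite len; lra.
have S_hi N : S N.+1 <= y * D y + E y - E (N.+1%:R * y).
  elim: N => [|N IH]; first by rewrite /S big_nat1 mul1r addrK.
  rewrite /S big_nat_recr//= -/(S N.+1); have /andP[+ _] := E_sub (p N) (step N).
  by rewrite len; lra.
have yD : y * D y <= y.
  have -> : y * D y = E y - expR (- y) by rewrite /D /E; field; rewrite gt_eqF.
  by have := expR_ge1Dx (- y); have [] := E_le y0; lra.
have S_close N : `|S N.+1 - 1| <= y + y^-1 * N.+1%:R^-1.
  have [_ h1] := E_le (p N); have [h2 _] := E_le y0.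
  have E0 : 0 <= E (N.+1%:R * y).
    by rewrite divr_ge0 ?(ltW (p N)) ?(ltW (expN_lt1 (p N))).
  have [_ h3] := E_le (p N.+1).
  have h4 : (N.+2%:R * y)^-1 <= y^-1 * N.+1%:R^-1.
    rewrite -invfM mulrC lef_pV2 ?posrE ?mulr_gt0//.
    by rewrite ler_wpM2l ?(ltW y0)// ler_nat.
  have i0 : 0 <= y^-1 * N.+1%:R^-1 by rewrite mulr_ge0 ?invr_ge0 ?(ltW y0).
  have h5 := E_ge y0; have := S_lo N.+1; have := S_hi N.
  move: (le_trans h3 h4) E0 i0 h2 h5 yD; clear h1 h3 h4.
  move: (S N.+1) (E (N.+2%:R * y)) (E (N.+1%:R * y)) (E y) (y^-1 * _) (y * D y) => a b c d e f *.
  by rewrite ler_norml; lra.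
have cS : S @ \oo --> (pi ^+ 2 / 6 - dilog y) / y - mode_log y.
  have h0 : series (fun k => (k.+1%:R ^+ 2)^-1 : R) @ \oo --> (pi ^+ 2 / 6 : R).
    by rewrite -zeta2E; exact: inv_sq_series_cvg.
  have -> : S = (fun N => (series (fun k => (k.+1%:R ^+ 2)^-1 : R) N
      - series (fun k => expR (- y) ^+ k.+1 / k.+1%:R ^+ 2) N) / y
      - series (fun k => expR (- y) ^+ k.+1 / k.+1%:R) N).
    apply/funext => N; rewrite /S /series/= -sumrB mulr_suml -sumrB; apply: eq_bigr => k _.
    have -> : expR (- y) ^+ k.+1 = expR (- (k.+1%:R * y)) by rewrite -expRM_natl mulrN.
    have j0 : k.+1%:R != 0 :> R by rewrite pnatr_eq0.
    rewrite /D; move: (expR _) => e; move: (k.+1%:R : R) j0 => j j0.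
    by field; rewrite j0 gt_eqF.
  apply: cvgB; last exact: mode_log_series.
  by apply: cvgMl; apply: cvgB => //; apply: dilog_cvg; exact: ltW.
have lim1 : `|(pi ^+ 2 / 6 - dilog y) / y - mode_log y - 1| <= y.
  have c1 : (fun N => `|S N.+1 - 1|) @ \oo --> `|(pi ^+ 2 / 6 - dilog y) / y - mode_log y - 1|.
    apply: cvg_norm; apply: cvgB; last exact: cvg_cst.
    by have := cS; rewrite -cvg_shiftS.
  have c2 : (fun N => y + y^-1 * N.+1%:R^-1) @ \oo --> y + y^-1 * 0.
    by apply: cvgD; [exact: cvg_cst|apply: cvgMr; exact: cvg_harmonic].
  have := ler_cvg_to c1 c2; rewrite mulr0 addr0; apply.
  by apply: nearW => N; exact: S_close.
have /andP[m0 m1] := mode_log_near0 y0.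
have E1 : dilog y - (pi ^+ 2 / 6 + y * ln y - y)
  = - y * (((pi ^+ 2 / 6 - dilog y) / y - mode_log y - 1) + (mode_log y + ln y)).
  by field; rewrite gt_eqF.
rewrite E1 normrM normrN (ger0_norm (ltW y0)) expr2 mulrCA ler_wpM2l ?(ltW y0)//.
by apply: (le_trans (ler_normD _ _)); rewrite (ger0_norm m0); lra.
Qed.
End DilogarithmNearZero.

Lemma telescope_sub {V : zmodType} (f : nat -> V) N :
  \sum_(0 <= m < N) (f m - f m.+1) = f 0%N - f N.
Proof.
elim: N => [|N IH]; first by rewrite big_geq// subrr.
by rewrite big_nat_recr//= IH addrA subrK.
Qed.

Section ModeLogSum.
Context {R : realType}.
Variables (t : nat -> R) (M : nat -> nat).
Hypotheses (t_gt0 : forall n, 0 < t n) (t_cvg0 : t @ \oo --> (0 : R))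
  (tM : forall n, 1 <= t n ^+ 2 * (M n)%:R).

(** Subtracting from each term the increment of [dilog] over the interval of length [t]
around [t (m + 1)] leaves corrections of order [1/(m + 1)^2], which tend to the errors of
the midpoint rule for [ln]; their sum is the Stirling constant. The increments telescope to
[dilog (t/2)/t], which carries the divergent terms. *)
Lemma mode_log_sum_cvg :
  (fun n => \sum_(0 <= m < M n) mode_log (t n * m.+1%:R)
     - (pi ^+ 2 / 6 / t n + 2^-1 * ln (t n / (2 * pi)))) @ \oo --> (0 : R).
Proof.
have pi0 := @pi_gt0 R.
pose h m : R := m%:R + 2^-1.
have h0 m : 0 < h m by rewrite /h ltr_wpDl.
have hS m : h m.+1 = m%:R + 3 / 2 by rewrite /h -[m.+1%:R]natr1; field.
have h_mid m : h m = m.+1%:R - 2^-1 /\ h m.+1 = m.+1%:R + 2^-1.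
  by split=> //; rewrite /h -[m.+1%:R]natr1; field.
pose u n m := mode_log (t n * m.+1%:R) - (t n)^-1 * (dilog (t n * h m) - dilog (t n * h m.+1)).
have ub n m : `|u n m| <= 2 * (m.+1%:R ^+ 2)^-1.
  have t0 := t_gt0 n; have j1 : 1 <= m.+1%:R :> R by rewrite ler1n.
  have j0 : 0 < m.+1%:R :> R by [].
  have d0 : 0 < t n / 2 by lra.
  have dx : t n / 2 <= t n * m.+1%:R / 2.
    by rewrite ler_wpM2r// -[leLHS]mulr1 ler_wpM2l// ltW.
  have := dilog_midpoint d0 dx; have [e1 e2] := h_mid m.
  have -> : t n * m.+1%:R - t n / 2 = t n * h m by rewrite e1; ring.
  have -> : t n * m.+1%:R + t n / 2 = t n * h m.+1 by rewrite e2; ring.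
  move=> H; rewrite /u.
  set F := dilog _ - dilog _ in H *.
  have -> : mode_log (t n * m.+1%:R) - (t n)^-1 * F = - ((t n)^-1 * (F - 2 * (t n / 2) * mode_log (t n * m.+1%:R))).
    by field; rewrite gt_eqF.
  rewrite normrN normrM ger0_norm ?invr_ge0 ?(ltW t0)// mulrC ler_pdivrMr//.
  apply: (le_trans H); rewrite le_eqVlt; apply/orP; left; apply/eqP.
  have j2 : m.+1%:R != 0 :> R by rewrite pnatr_eq0.
  by move: (m.+1%:R : R) j2 => j j2; field; rewrite j2 gt_eqF.
have ul m : u ^~ m @ \oo --> (stirling_term m : R).
  pose C : R := m.+1%:R + 2 * h m ^+ 2 + 2 * h m.+1 ^+ 2.
  apply: (@cvg_close _ _ (fun=> stirling_term m) (fun n => C * t n)) => [n||].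
  - have t0 := t_gt0 n; have j0 : 0 < m.+1%:R :> R by [].
    have := mode_log_near0 (mulr_gt0 t0 j0).
    have := dilog_near0 (mulr_gt0 t0 (h0 m)); have := dilog_near0 (mulr_gt0 t0 (h0 m.+1)).
    rewrite !lnM ?posrE//.
    set F1 := dilog _; set F2 := dilog _; set z := pi ^+ 2 / 6; set f := mode_log _.
    move=> H2 H1 H0.
    pose r2 := F1 - (z + t n * h m.+1 * (ln (t n) + ln (h m.+1)) - t n * h m.+1).
    pose r1 := F2 - (z + t n * h m * (ln (t n) + ln (h m)) - t n * h m).
    have E : u n m - stirling_term m = (f + (ln (t n) + ln m.+1%:R)) + (t n)^-1 * (r2 - r1).
      rewrite /u -/f -/F1 -/F2 /stirling_term -hS -/(h m) /r1 /r2.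
      have hh : h m.+1 = h m + 1 by rewrite /h -[m.+1%:R]natr1; ring.
      move: (ln (t n)) (ln (h m.+1)) (ln m.+1%:R) (ln (h m)) => a b c e; rewrite hh.
      by field; rewrite gt_eqF.
    rewrite E; apply: (le_trans (ler_normD _ _)).
    have /andP[f0 f1] := H0; rewrite (ger0_norm f0).
    have hr : `|(t n)^-1 * (r2 - r1)| <= t n * (2 * h m ^+ 2 + 2 * h m.+1 ^+ 2).
      rewrite normrM ger0_norm ?invr_ge0 ?(ltW t0)// mulrC ler_pdivrMr//.
      apply: (le_trans (ler_normB _ _)).
      move: H1 H2; rewrite -/r1 -/r2 !exprMn; lra.
    apply: (le_trans (lerD f1 hr)); rewrite /C; lra.
  - by rewrite -[X in _ --> X](mulr0 C); exact: cvgMr.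
  - exact: cvg_cst.
have [cl cu] := tannery_inv_sq ub ul (size_cvg_oo t_gt0 t_cvg0 tM).
pose z : R := pi ^+ 2 / 6; have z0 : 0 <= z by rewrite /z divr_ge0 ?sqr_ge0.
apply: (@cvg_close _ _ (fun n => \sum_(0 <= m < M n) u n m - (2^-1 - 2^-1 * ln pi))
   (fun n => (1 + 4 * z) * t n)) => [n||].
- have t0 := t_gt0 n.
  have tele : \sum_(0 <= m < M n) (dilog (t n * h m) - dilog (t n * h m.+1))
      = dilog (t n * h 0%N) - dilog (t n * h (M n)).
    exact: (telescope_sub (fun m => dilog (t n * h m))).
  have h00 : h 0%N = 2^-1 by rewrite /h add0r.
  rewrite /u sumrB -mulr_sumr tele h00.
  have H1 := dilog_near0 (mulr_gt0 t0 (h0 0%N)).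
  have Y0 : 0 < t n * h (M n) by rewrite mulr_gt0.
  have /andP[F0 F1] := dilog_bounds (ltW Y0).
  rewrite h00 lnM ?posrE// lnV ?posrE// in H1.
  have lnE : ln (t n / (2 * pi)) = ln (t n) - ln 2 - ln pi.
    by rewrite ln_div ?posrE ?mulr_gt0// lnM ?posrE//; ring.
  have tY : (t n)^-1 <= t n * h (M n).
    have := tM n; have : (M n)%:R <= h (M n) by rewrite /h lerDl invr_ge0.
    move=> hM HM; rewrite -[leLHS]mulr1 ler_pdivrMl// mulrA -expr2.
    by apply: (le_trans HM); rewrite ler_wpM2l ?sqr_ge0.
  have e4 : expR (- (t n * h (M n))) <= 4 * t n ^+ 2.
    rewrite expRN -[leRHS]invrK lef_pV2 ?posrE ?expR_gt0 ?invr_gt0 ?mulr_gt0 ?exprn_gt0//.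
    have h1 := expR_ge1Dx (t n * h (M n) / 2).
    have -> : (4 * t n ^+ 2)^-1 = ((t n)^-1 / 2) ^+ 2 by field; rewrite gt_eqF.
    have -> : expR (t n * h (M n)) = expR (t n * h (M n) / 2) ^+ 2.
      by rewrite expr2 -expRD; congr expR; field.
    by rewrite lerXn2r ?nnegrE ?expR_ge0 ?mulr_ge0 ?invr_ge0 ?(ltW t0)//; lra.
  pose r1 := dilog (t n / 2) - (z + t n * 2^-1 * (ln (t n) - ln 2) - t n * 2^-1).
  rewrite -/z -/r1 in H1; rewrite -/z in F1.
  have E : \sum_(0 <= i < M n) mode_log (t n * i.+1%:R) - (z / t n + 2^-1 * ln (t n / (2 * pi))) -
     (\sum_(0 <= i < M n) mode_log (t n * i.+1%:R) -
     (t n)^-1 * (dilog (t n / 2) - dilog (t n * h (M n))) - (2^-1 - 2^-1 * ln pi))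
     = (t n)^-1 * (r1 - dilog (t n * h (M n))).
    rewrite lnE /r1; move: (\sum_(_ <= _ < _) _) (ln (t n)) (ln 2) (ln pi) => a b c d.
    by field; rewrite gt_eqF.
  rewrite E normrM ger0_norm ?invr_ge0 ?(ltW t0)// mulrC ler_pdivrMr//.
  apply: (le_trans (ler_normB _ _)); rewrite (ger0_norm F0).
  have F2 := le_trans F1 (ler_wpM2r z0 e4).
  clear tY e4 lnE E F1 tele.
  have t2 : 0 <= t n ^+ 2 by rewrite sqr_ge0.
  by move: H1 F2; rewrite exprMn; move: (`|r1|) (dilog _) => a b; nra.
- by rewrite -[X in _ --> X](mulr0 (1 + 4 * z)); exact: cvgMr.
- rewrite -[X in _ --> X](subrr (2^-1 - 2^-1 * ln pi)); apply: cvgB; last exact: cvg_cst.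
  by rewrite -(stirling_constant cl).
Qed.
End ModeLogSum.

(** * Expansion of the generating function at the saddle point *)

Section LogGeneratingFunction.
Context {R : realType}.
Variable alpha : R.
Hypothesis alpha_gt1 : 1 < alpha.
Local Notation a := (beatty_part alpha).

Definition rel_frac m : R := frac (alpha * m.+1%:R) / (alpha * m.+1%:R).

Let aj_gt1 m : 1 < alpha * m.+1%:R.
Proof. by have h := alpha_gt1; rewrite (lt_le_trans h)// ler_peMr ?ler1n//; lra. Qed.

Let rel_frac_itv m : 0 <= rel_frac m < 1.
Proof.
have h := aj_gt1 m; have h0 : 0 < alpha * m.+1%:R by lra.
rewrite /rel_frac divr_ge0 ?frac_ge0 ?(ltW h0)//= ltr_pdivrMr// mul1r.
by apply: lt_trans h; exact: frac_lt1.
Qed.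

(** Second-order effect of rounding [alpha j] down to its integer part, [j = m + 1]. *)
Definition rounding_term m : R := - ln (1 - rel_frac m) - rel_frac m.

Section Corrections.
Variables (s : nat -> R) (M : nat -> nat).
Hypotheses (s_gt0 : forall n, 0 < s n) (s_cvg0 : s @ \oo --> (0 : R))
  (sM : forall n, 1 <= s n ^+ 2 * (M n)%:R).

(** Moving the argument from [s alpha j] down by [s] times the fractional part changes
[mode_log] by that amount times [bose], up to a second-order error, [O(1/j^2)] because
[bose] is Lipschitz with constant [O(1/x^2)]. *)
Lemma floor_correction_cvg : cvgn (series rounding_term) /\
  \sum_(0 <= m < M n) (mode_log (s n * (a m)%:R) - mode_log (s n * (alpha * m.+1%:R))
    - s n * frac (alpha * m.+1%:R) * bose (s n * (alpha * m.+1%:R))) @[n --> \oo]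
  --> limn (series rounding_term).
Proof.
have [K K0 HK] := @bose_lipschitz R.
apply: (@tannery_inv_sq R _ rounding_term K); last exact: (size_cvg_oo s_gt0 s_cvg0 sM).
- move=> n m; have s0 := s_gt0 n.
  have aE := beatty_part_frac alpha_gt1 m; have aj := beatty_part_ge alpha_gt1 m.
  have th0 := frac_ge0 (alpha * m.+1%:R); have th1 := frac_lt1 (alpha * m.+1%:R).
  set th := frac _ in aE th0 th1 *; set x := alpha * m.+1%:R in aE *.
  have a0 : 0 < (a m)%:R :> R by rewrite ltr0n (leq_trans _ aj).
  have yx : s n * (a m)%:R <= s n * x by rewrite ler_wpM2l ?(ltW s0)// aE; lra.
  have [c /andP[c1 c2] ->] := mode_log_mvt (mulr_gt0 s0 a0) yx.
  have d0 : s n * x - s n * (a m)%:R = s n * th by rewrite aE; ring.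
  have c0 : 0 < c by apply: lt_le_trans c1; rewrite mulr_gt0.
  have /andP[h0 h1] := HK _ _ c0 c2.
  rewrite d0 -[s n * th * bose _]mulrC -mulrBl.
  have st0 : 0 <= s n * th by rewrite mulr_ge0 ?(ltW s0).
  rewrite normrM !ger0_norm//.
  have j0 : 0 < m.+1%:R :> R by [].
  have cj : s n * m.+1%:R <= c by apply: le_trans c1; rewrite ler_wpM2l ?(ltW s0)// ler_nat.
  have sj : 0 < s n * m.+1%:R by rewrite mulr_gt0.
  have h2 : K * (s n * x - c) / c ^+ 2 <= K * s n / (s n * m.+1%:R) ^+ 2.
    have e0 : 0 <= s n * x - c by rewrite subr_ge0.
    have e1 : s n * x - c <= s n.
      have : s n * th <= s n by rewrite -[leRHS]mulr1 ler_wpM2l ?(ltW s0) ?(ltW th1).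
      lra.
    rewrite ler_pM ?mulr_ge0 ?invr_ge0 ?sqr_ge0 ?(ltW K0)//; first by rewrite ler_wpM2l ?(ltW K0).
    by rewrite lef_pV2 ?posrE ?exprn_gt0// lerXn2r ?nnegrE ?(ltW sj) ?(ltW c0).
  apply: (@le_trans _ _ (K * s n / (s n * m.+1%:R) ^+ 2 * s n)).
    rewrite ler_pM//; first exact: le_trans h2.
    by rewrite -[leRHS]mulr1 ler_wpM2l ?(ltW s0) ?(ltW th1).
  rewrite le_eqVlt; apply/orP; left; apply/eqP.
  have j2 : m.+1%:R != 0 :> R by rewrite pnatr_eq0.
  by move: (m.+1%:R : R) j2 => j j2; field; rewrite j2 gt_eqF.
- move=> m; have h := aj_gt1 m; have h0 : 0 < alpha * m.+1%:R by lra.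
  have aE := beatty_part_frac alpha_gt1 m; have aj := beatty_part_ge alpha_gt1 m.
  have a0 : 0 < (a m)%:R :> R by rewrite ltr0n (leq_trans _ aj).
  have /andP[u0 u1] := rel_frac_itv m.
  have aE2 : (a m)%:R = alpha * m.+1%:R * (1 - rel_frac m).
    by rewrite aE /rel_frac; move: h0; move: (alpha * _) (frac _) => x th x0; field; rewrite gt_eqF.
  have E : ln (alpha * m.+1%:R) - ln (a m)%:R = - ln (1 - rel_frac m).
    rewrite aE2 [ln (_ * (1 - _))]lnM ?posrE ?subr_gt0//.
    by rewrite opprD addrA subrr add0r.
  apply: cvgB.
    rewrite -E; have c1 := mode_log_sub_cvg a0 h0 s_gt0 s_cvg0.
    rewrite [X in X @ \oo --> _](_ : _ = (fun n => mode_log ((a m)%:R * s n) - mode_log (alpha * m.+1%:R * s n)))//.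
    by apply/funext => n; rewrite ![s n * _]mulrC.
  have c2 := mul_bose_cvg1 h0 s_gt0 s_cvg0.
  have c3 : (fun n => rel_frac m * (alpha * m.+1%:R * s n * bose (alpha * m.+1%:R * s n))) @ \oo --> rel_frac m * 1 by exact: cvgMr.
  rewrite mulr1 in c3; move: c3; rewrite [X in X @ \oo --> _ -> _](_ : _ = (fun n => s n * frac (alpha * m.+1%:R) * bose (s n * (alpha * m.+1%:R))))//.
  apply/funext => n; rewrite [_ * s n]mulrC /rel_frac.
  by move: h0; move: (alpha * _) (bose _) (frac _) => x b th x0; field; rewrite gt_eqF.
Qed.
End Corrections.

Hypothesis J_cvg : cvgn (series (fun m => B1 (alpha * m.+1%:R) / m.+1%:R)).
Local Notation J := (limn (series (fun m => B1 (alpha * m.+1%:R) / m.+1%:R))).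

Let rounding_series_cvg : cvgn (series rounding_term).
Proof.
pose s n : R := n.+1%:R^-1.
have [|||] // := @floor_correction_cvg s (fun n => (n.+1 ^ 2)%N).
- by move=> n; rewrite invr_gt0.
- exact: cvg_harmonic.
- by move=> n; rewrite natrX exprVn mulVf// expf_neq0// pnatr_eq0.
Qed.

(** The fractional part is [B1 + 1/2], so the logarithm of a factor is minus the rounding
term minus [B1/(alpha j)]. *)
Lemma prod_partial_cvg :
  prod_partial alpha @ \oo --> expR (- limn (series rounding_term) - alpha^-1 * J).
Proof.
have E N : prod_partial alpha N = expR (- series rounding_term N
   - alpha^-1 * series (fun m => B1 (alpha * m.+1%:R) / m.+1%:R) N).
  rewrite /prod_partial /series/=; elim: N => [|N IH].
    by rewrite !big_geq// oppr0 mulr0 subr0 expR0.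
  rewrite big_nat_recr//= IH !(big_nat_recr N)//= mulrDr !opprD.
  move: (\sum_(_ <= _ < _) _) (\sum_(_ <= _ < _) _) => x y.
  have /andP[u0 u1] := rel_frac_itv N.
  rewrite -/(rel_frac N) -[1 - rel_frac N in LHS]lnK ?posrE ?subr_gt0// -!expRD.
  congr expR; rewrite /rounding_term /B1.
  have h := aj_gt1 N; have al : alpha != 0 by have h1 := alpha_gt1; rewrite gt_eqF; lra.
  have j2 : N.+1%:R != 0 :> R by rewrite pnatr_eq0.
  move: (ln (1 - rel_frac N)) => p; rewrite /rel_frac; move: (frac _) => th.
  move: (N.+1%:R : R) j2 => j j2.
  by field; rewrite j2 al.
rewrite (funext E : prod_partial alpha = _).
apply: continuous_cvg; first exact: continuous_expR.
by apply: cvgB; [apply: cvgN; exact: rounding_series_cvg|apply: cvgMr; exact: J_cvg].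
Qed.

(** Write each part as [alpha j] minus its fractional part [B1 + 1/2]: the logarithm of
the generating function splits into the rounding sum, the sum of [mode_log] over a
progression, the regularized sawtooth series, and half of the sum of [bose]. *)
Lemma log_gf_cvg (s : nat -> R) (M : nat -> nat) :
  (forall n, 0 < s n) -> s @ \oo --> (0 : R) -> (forall n, 1 <= s n ^+ 2 * (M n)%:R) ->
  (fun n => log_gf a (s n) (M n) - (pi ^+ 2 / 6 / (alpha * s n) + 2^-1 * ln (alpha * s n / (2 * pi))
     + (2 * alpha)^-1 * (euler_gamma - ln (alpha * s n)))) @ \oo
  --> - ln (limn (prod_partial alpha)).
Proof.
move=> s0 sc sM; have h1 := alpha_gt1; have al0 : 0 < alpha by lra.
have aln : alpha != 0 by rewrite gt_eqF.
pose t n := alpha * s n.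
have t0 n : 0 < t n by rewrite mulr_gt0.
have tc : t @ \oo --> (0 : R).
  by rewrite -[X in _ --> X](mulr0 alpha); exact: cvgMr.
have tM n : 1 <= t n ^+ 2 * (M n)%:R.
  apply: (le_trans (sM n)); rewrite ler_wpM2r// lerXn2r ?nnegrE ?(ltW (s0 n)) ?(ltW (t0 n))//.
  by rewrite /t ler_peMl ?(ltW (s0 n))//; lra.
have [_ c1] := @floor_correction_cvg s M s0 sc sM.
have c2 := mode_log_sum_cvg t0 tc tM.
have c3 := bose_sum_cvg t0 tc tM.
have c4 := abel_bose_sum t0 tc tM J_cvg.
rewrite (cvg_lim _ prod_partial_cvg)// expRK.
have -> : - (- limn (series rounding_term) - alpha^-1 * J) = limn (series rounding_term) + 0 + alpha^-1 * J + (2 * alpha)^-1 * (euler_gamma - euler_gamma) by ring.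
have E n : log_gf a (s n) (M n) - (pi ^+ 2 / 6 / (alpha * s n) + 2^-1 * ln (alpha * s n / (2 * pi))
     + (2 * alpha)^-1 * (euler_gamma - ln (alpha * s n))) =
  \sum_(0 <= m < M n) (mode_log (s n * (a m)%:R) - mode_log (s n * (alpha * m.+1%:R))
    - s n * frac (alpha * m.+1%:R) * bose (s n * (alpha * m.+1%:R)))
  + (\sum_(0 <= m < M n) mode_log (t n * m.+1%:R) - (pi ^+ 2 / 6 / t n + 2^-1 * ln (t n / (2 * pi))))
  + alpha^-1 * (\sum_(0 <= m < M n) t n * bose (t n * m.+1%:R) * B1 (alpha * m.+1%:R))
  + (2 * alpha)^-1 * (\sum_(0 <= m < M n) t n * bose (t n * m.+1%:R) + ln (t n) - euler_gamma).
  have -> : log_gf a (s n) (M n) = \sum_(0 <= m < M n) (mode_log (s n * (a m)%:R) - mode_log (s n * (alpha * m.+1%:R))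
    - s n * frac (alpha * m.+1%:R) * bose (s n * (alpha * m.+1%:R)))
    + \sum_(0 <= m < M n) mode_log (t n * m.+1%:R)
    + alpha^-1 * (\sum_(0 <= m < M n) t n * bose (t n * m.+1%:R) * B1 (alpha * m.+1%:R))
    + (2 * alpha)^-1 * (\sum_(0 <= m < M n) t n * bose (t n * m.+1%:R)).
    rewrite /log_gf -(big_mkord xpredT (fun i => - ln (1 - radius a (s n) i))).
    rewrite !mulr_sumr -!big_split/=; apply: eq_bigr => m _.
    rewrite /t /B1 -[- ln (1 - radius a (s n) m)]/(mode_log (s n * (a m)%:R)).
    have -> : alpha * s n * m.+1%:R = s n * (alpha * m.+1%:R) by ring.
    move: (mode_log _) (mode_log _) (bose _) (frac _) => p q b th.
    by field; rewrite aln.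
  rewrite -/(t n).
  move: (\sum_(_ <= _ < _) _) (\sum_(_ <= _ < _) _) (\sum_(_ <= _ < _) _) (\sum_(_ <= _ < _) _) => x y z w.
  ring.
rewrite (funext E); apply: cvgD.
  by apply: cvgD; [exact: cvgD|exact: cvgMr].
by apply: cvgMr; apply: cvgB => //; exact: cvg_cst.
Qed.
End LogGeneratingFunction.

(** * The saddle point *)

Lemma ln_sqrt {R : realType} (x : R) : 0 < x -> ln (Num.sqrt x) = 2^-1 * ln x.
Proof.
move=> x0; have r0 : 0 < Num.sqrt x by rewrite sqrtr_gt0.
by rewrite -[x in RHS](sqr_sqrtr (ltW x0)) expr2 lnM ?posrE//; field.
Qed.

Section SaddlePoint.
Context {R : realType}.
Variable alpha : R.
Hypotheses (alpha_gt1 : 1 < alpha) (alpha_irr : irrational alpha)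
  (J_cvg : cvgn (series (fun m => B1 (alpha * m.+1%:R) / m.+1%:R))).
Local Notation a := (beatty_part alpha).

Let A : R := pi ^+ 2 / 6 / alpha.
Let kappa : R := - ln (limn (prod_partial alpha)).

Let alpha_gt0 : 0 < alpha. Proof. by have h := alpha_gt1; lra. Qed.
Let A_gt0 : 0 < A. Proof. by rewrite !divr_gt0 ?exprn_gt0 ?pi_gt0. Qed.

Let s n : R := Num.sqrt (A / n.+1%:R).
Let r n : R := Num.sqrt (s n).
(** Relative distance of the auxiliary points [s (1 - h)] and [s (1 + h)] from [s]. It has
the order of [r], the square root of [s], at which the Taylor error [h^3/s] and the
unknown [o(1)] terms are both negligible against [h^2/s]; the
denominator keeps it below [1/2] for every [n]. *)
Let h n : R := r n / (1 + 2 * r n).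
(** Chosen so that [s^2 M >= 4], which leaves [x^2 M >= 1] for every [x >= s/2]. *)
Let C : nat := (Num.truncn (4 / A)).+1.
Let M n : nat := (C * n.+1)%N.

Let An_gt0 n : 0 < A / n.+1%:R. Proof. by rewrite divr_gt0. Qed.
Let s_gt0 n : 0 < s n. Proof. by rewrite sqrtr_gt0. Qed.
Let r_gt0 n : 0 < r n. Proof. by rewrite sqrtr_gt0. Qed.
Let s_sq n : s n ^+ 2 = A / n.+1%:R. Proof. by rewrite sqr_sqrtr ?(ltW (An_gt0 n)). Qed.
Let r_sq n : r n ^+ 2 = s n. Proof. by rewrite sqr_sqrtr ?(ltW (s_gt0 n)). Qed.
Let h_gt0 n : 0 < h n.
Proof. by have r0 := r_gt0 n; rewrite divr_gt0//; lra. Qed.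
Let h_le n : h n <= 1 / 2.
Proof. by have r0 := r_gt0 n; rewrite ler_pdivrMr; lra. Qed.
Let h_le_r n : h n <= r n.
Proof. by have r0 := r_gt0 n; rewrite ler_pdivrMr; [rewrite ler_peMr ?(ltW r0)//|]; lra. Qed.

Let sqrt_cvg0 (u : nat -> R) : u @ \oo --> (0 : R) -> (fun n => Num.sqrt (u n)) @ \oo --> (0 : R).
Proof.
move=> u0; rewrite -[X in _ --> X](@sqrtr0 R).
by apply: continuous_cvg => //; exact: sqrt_continuous.
Qed.

Let s_cvg0 : s @ \oo --> (0 : R).
Proof.
apply: sqrt_cvg0; rewrite -[X in _ --> X](mulr0 A); apply: cvgMr; exact: cvg_harmonic.
Qed.
Let r_cvg0 : r @ \oo --> (0 : R). Proof. exact: sqrt_cvg0 s_cvg0. Qed.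
Let h_cvg0 : h @ \oo --> (0 : R).
Proof.
apply: (@cvg_close _ _ (fun=> 0) r) => [n||]; [|exact: r_cvg0|exact: cvg_cst].
by rewrite subr0 ger0_norm ?(ltW (h_gt0 n)).
Qed.

Let C_ge : 4 / A <= C%:R.
Proof. by apply/ltW; apply: truncnS_gt. Qed.

Let sM4 n : 4 <= s n ^+ 2 * (M n)%:R.
Proof.
rewrite s_sq /M natrM; have := C_ge; rewrite ler_pdivrMr// => hC.
have j0 : n.+1%:R != 0 :> R by rewrite pnatr_eq0.
have -> : A / n.+1%:R * (C%:R * n.+1%:R) = C%:R * A by move: (n.+1%:R : R) j0 => j j0; field.
exact: hC.
Qed.

Let near_saddle_sM (e : nat -> R) : (forall n, 1 / 2 <= e n) ->
  forall n, 1 <= (s n * e n) ^+ 2 * (M n)%:R.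
Proof.
move=> e2 n; rewrite exprMn mulrAC; have h4 := sM4 n.
have h5 : 1 / 4 <= e n ^+ 2.
  have -> : 1 / 4 = (1 / 2) ^+ 2 :> R by field.
  by rewrite lerXn2r ?nnegrE ?divr_ge0// (le_trans _ (e2 n)).
apply: (@le_trans _ _ (4 * (1 / 4))); first by lra.
by rewrite ler_pM.
Qed.

Let c1 : R := 2^-1 - (2 * alpha)^-1.
Let c0 : R := 2^-1 * ln (alpha / (2 * pi)) + (2 * alpha)^-1 * (euler_gamma - ln alpha).
(** The explicit part of the expansion of [log_gf] at [x]; what remains tends to
[kappa]. *)
Let Phi x : R := A / x + c1 * ln x + c0.

Let err (e : nat -> R) n : R := log_gf a (s n * e n) (M n) - Phi (s n * e n).

Let err_cvg (e : nat -> R) : (forall n, 1 / 2 <= e n <= 2) -> err e @ \oo --> kappa.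
Proof.
move=> e2; have pi0 := @pi_gt0 R.
have e_lo n : 1 / 2 <= e n by case/andP: (e2 n).
have e0 n : 0 < e n by apply: lt_le_trans (e_lo n); rewrite divr_gt0.
have p n : 0 < s n * e n by rewrite mulr_gt0.
have c : (fun n => s n * e n) @ \oo --> (0 : R).
  apply: (@cvg_close _ _ (fun=> 0) (fun n => 2 * s n)) => [n||].
  - rewrite subr0 ger0_norm ?(ltW (p n))// mulrC ler_wpM2r ?(ltW (s_gt0 n))//.
    by case/andP: (e2 n).
  - by rewrite -[X in _ --> X](mulr0 2); apply: cvgMr; exact: s_cvg0.
  - exact: cvg_cst.
have := log_gf_cvg alpha_gt1 J_cvg p c (near_saddle_sM e_lo).
rewrite [X in X @ \oo --> _ -> _](_ : _ = err e)//; apply/funext => n.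
have al0 : alpha != 0 by rewrite gt_eqF.
have pn := p n; rewrite /err /Phi /c0 /c1 /A; congr (_ - _).
rewrite !ln_div ?posrE ?mulr_gt0// [ln (alpha * _)]lnM ?posrE//.
move: (s n * e n) pn => x x0.
by move: (ln x) (ln alpha) (ln (2 * pi)) => lx la lp; field; rewrite al0 gt_eqF.
Qed.

Let g n (x : R) : R := log_gf a x (M n).
Let mean n : R := gf_mean a (s n) (M n).
Let var n : R := gf_var a (s n) (M n).

Let e_plus n : R := 1 + h n.
Let e_minus n : R := 1 - h n.
Let one (n : nat) : R := 1.

Let err_one : err one @ \oo --> kappa. Proof. by apply: err_cvg => n; rewrite /one; lra. Qed.
Let err_plus : err e_plus @ \oo --> kappa.
Proof. by apply: err_cvg => n; rewrite /e_plus; have := h_gt0 n; have := h_le n; lra. Qed.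
Let err_minus : err e_minus @ \oo --> kappa.
Proof. by apply: err_cvg => n; rewrite /e_minus; have := h_gt0 n; have := h_le n; lra. Qed.

(** Taylor's formula at the two auxiliary points; half the sum and half the difference
of the two estimates isolate variance and mean. *)
Let K_exists : exists2 K : R, 0 < K & forall n,
  `|g n (s n * e_plus n) - g n (s n) + mean n * (s n * h n) - var n * (s n * h n) ^+ 2 / 2|
     <= K * h n ^+ 3 / s n /\
  `|g n (s n * e_minus n) - g n (s n) - mean n * (s n * h n) - var n * (s n * h n) ^+ 2 / 2|
     <= K * h n ^+ 3 / s n.
Proof.
have [K K0 HK] := @log_gf_taylor R a (beatty_part_ge alpha_gt1); exists K => // n.
have s0 := s_gt0 n; have h0 := h_gt0 n; have h2 := h_le n.
have sh0 : 0 < s n * h n by rewrite mulr_gt0.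
have E3 : K * (s n * h n) ^+ 3 / s n ^+ 4 = K * h n ^+ 3 / s n by field; rewrite gt_eqF.
have dle : s n * h n <= s n / 2 by have := ler_wpM2l (ltW s0) h2; lra.
have d1 : `|s n * h n| <= s n / 2 by rewrite ger0_norm ?(ltW sh0).
have d2 : `|- (s n * h n)| <= s n / 2 by rewrite normrN.
have := HK (s n) (M n) _ s0 d1; have := HK (s n) (M n) _ s0 d2.
rewrite normrN !(ger0_norm (ltW sh0)) E3 sqrrN mulrN => H2 H1.
have -> : s n * e_plus n = s n + s n * h n by rewrite /e_plus; ring.
have -> : s n * e_minus n = s n - s n * h n by rewrite /e_minus; ring.
by split.
Qed.

Let gE (e : nat -> R) n : 0 < e n -> g n (s n * e n) = A / s n / e n + c1 * (ln (s n) + ln (e n)) + c0 + err e n.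
Proof.
move=> e0; have s0 := s_gt0 n; rewrite /err -/(g n _) /Phi lnM ?posrE//.
have -> : A / (s n * e n) = A / s n / e n by field; rewrite !gt_eqF.
ring.
Qed.

Let gE1 n : g n (s n) = A / s n + c1 * ln (s n) + c0 + err one n.
Proof.
by rewrite -{1}[s n]mulr1 (gE (e := one))// /one ln1 divr1 addr0.
Qed.

Let ep_gt0 n : 0 < e_plus n. Proof. by rewrite /e_plus; have := h_gt0 n; lra. Qed.
Let em_gt0 n : 0 < e_minus n. Proof. by rewrite /e_minus; have := h_le n; lra. Qed.
Let lnp n := ln (e_plus n).
Let lnm n := ln (e_minus n).

Let ep_cvg : e_plus @ \oo --> (1 : R).
Proof.
by rewrite -[X in _ --> X]addr0; apply: cvgD; [exact: cvg_cst|exact: h_cvg0].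
Qed.
Let em_cvg : e_minus @ \oo --> (1 : R).
Proof.
by rewrite -[X in _ --> X]subr0; apply: cvgB; [exact: cvg_cst|exact: h_cvg0].
Qed.
Let lnp_cvg : lnp @ \oo --> (0 : R).
Proof.
by rewrite -(@ln1 R); apply: continuous_cvg; [exact: continuous_ln|exact: ep_cvg].
Qed.
Let lnm_cvg : lnm @ \oo --> (0 : R).
Proof.
by rewrite -(@ln1 R); apply: continuous_cvg; [exact: continuous_ln|exact: em_cvg].
Qed.
Let w n : R := 1 + 2 * r n.
Let w_cvg : w @ \oo --> (1 : R).
Proof.
rewrite -[X in _ --> X]addr0 -[X in _ + X](mulr0 2).
by apply: cvgD; [exact: cvg_cst|apply: cvgMr; exact: r_cvg0].
Qed.
Let denom_cvg : (fun n => (e_plus n * e_minus n)^-1) @ \oo --> (1 : R).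
Proof.
rewrite -[X in _ --> X]invr1; apply: cvgV; first exact: oner_neq0.
by rewrite -[X in _ --> X](mulr1 1); apply: cvgM; [exact: ep_cvg|exact: em_cvg].
Qed.

Let var_cvg : (fun n => var n * s n ^+ 3) @ \oo --> 2 * A.
Proof.
have [K K0 HK] := K_exists.
pose v n := 2 * A * (e_plus n * e_minus n)^-1
  + w n ^+ 2 * (c1 * (lnp n + lnm n) + (err e_plus n + err e_minus n - 2 * err one n)).
apply: (@cvg_close _ _ v (fun n => 2 * K * h n)) => [n||].
- have [H1 H2] := HK n; have s0 := s_gt0 n; have h0 := h_gt0 n; have r0 := r_gt0 n.
  set R1 := (X in `|X|) in H1; set R2 := (X in `|X|) in H2.
  have p0 := ep_gt0 n; have m0 := em_gt0 n.
  have E : var n * s n ^+ 3 - v n = - ((R1 + R2) * (s n / h n ^+ 2)).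
    have shw : s n / h n ^+ 2 = w n ^+ 2.
      rewrite -r_sq /h /w; move: (r n) r0 => x x0; field; rewrite gt_eqF//=; lra.
    have shV : s n / h n ^+ 2 = s n / h n ^+ 2 by [].
    rewrite /v -shw /R1 /R2 !gE// gE1 -/(lnp n) -/(lnm n).
    move: (ln (s n)) (lnp n) (lnm n) (err one n) (err e_plus n) (err e_minus n) (mean n) (var n) => *.
    move: p0 m0; rewrite /e_plus /e_minus; move: (s n) s0 (h n) h0 => x x0 y y0 p0 m0.
    by field; rewrite !gt_eqF.
  have q0 : 0 <= s n / h n ^+ 2 by rewrite divr_ge0 ?sqr_ge0 ?(ltW s0).
  rewrite E normrN normrM (ger0_norm q0).
  have HR : `|R1 + R2| <= 2 * (K * h n ^+ 3 / s n) by apply: (le_trans (ler_normD _ _)); lra.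
  apply: (le_trans (ler_wpM2r q0 HR)); rewrite le_eqVlt; apply/orP; left; apply/eqP.
  by field; rewrite !gt_eqF.
- by rewrite -[X in _ --> X](mulr0 (2 * K)); apply: cvgMr; exact: h_cvg0.
- have -> : 2 * A = 2 * A * 1 + 1 ^+ 2 * (c1 * (0 + 0) + (kappa + kappa - 2 * kappa)) by ring.
  apply: cvgD; first exact: cvgMr.
  apply: cvgM.
    by rewrite expr2; under eq_fun do rewrite expr2; apply: cvgM; exact: w_cvg.
  apply: cvgD; first by apply: cvgMr; apply: cvgD; [exact: lnp_cvg|exact: lnm_cvg].
  apply: cvgB; first by apply: cvgD; [exact: err_plus|exact: err_minus].
  by apply: cvgMr; exact: err_one.
Qed.

Let mean_cvg : (fun n => (mean n - n.+1%:R) * (s n * Num.sqrt (s n))) @ \oo --> (0 : R).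
Proof.
have [K K0 HK] := K_exists.
pose v n := A * h n * (w n)^-1 * (e_plus n * e_minus n)^-1
  + w n / 2 * (c1 * (lnm n - lnp n) + (err e_minus n - err e_plus n)).
apply: (@cvg_close _ _ v (fun n => K * h n)) => [n||].
- have [H1 H2] := HK n; have s0 := s_gt0 n; have h0 := h_gt0 n; have r0 := r_gt0 n.
  set R1 := (X in `|X|) in H1; set R2 := (X in `|X|) in H2.
  have p0 := ep_gt0 n; have m0 := em_gt0 n.
  have w0 : 0 < w n by rewrite /w; lra.
  have hr : r n = h n * w n by rewrite /h /w divfK// gt_eqF//; lra.
  have sE : s n = (h n * w n) ^+ 2 by rewrite -hr r_sq.
  have nE : n.+1%:R = A / s n ^+ 2.
    rewrite s_sq; have j0 : n.+1%:R != 0 :> R by rewrite pnatr_eq0.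
    by have A0 := A_gt0; move: (n.+1%:R : R) j0 (A) A0 => j j0 b b0; field; rewrite j0 gt_eqF.
  have E : (mean n - n.+1%:R) * (s n * Num.sqrt (s n)) - v n = (R1 - R2) * (w n / 2).
    rewrite -/(r n) hr nE /v /R1 /R2 !gE// gE1 -/(lnp n) -/(lnm n).
    move: (ln (s n)) (lnp n) (lnm n) (err one n) (err e_plus n) (err e_minus n) (mean n) (var n) => *.
    rewrite sE; move: p0 m0; rewrite /e_plus /e_minus; move: (w n) w0 (h n) h0 => x x0 y y0 p0 m0.
    by field; rewrite !gt_eqF.
  have w2 : 0 <= w n / 2 by rewrite divr_ge0 ?(ltW w0).
  rewrite E normrM (ger0_norm w2).
  have HR : `|R1 - R2| <= 2 * (K * h n ^+ 3 / s n) by apply: (le_trans (ler_normB _ _)); lra.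
  apply: (le_trans (ler_wpM2r w2 HR)).
  have -> : 2 * (K * h n ^+ 3 / s n) * (w n / 2) = K * h n / w n.
    by rewrite sE; field; rewrite !gt_eqF.
  have w1 : 1 <= w n by rewrite /w; lra.
  by rewrite ler_pdivrMr// (ler_peMr (mulr_ge0 (ltW K0) (ltW h0))).
- by rewrite -[X in _ --> X](mulr0 K); apply: cvgMr; exact: h_cvg0.
- have -> : 0 = A * 0 * 1^-1 * 1 + 1 / 2 * (c1 * (0 - 0) + (kappa - kappa)) :> R by ring.
  apply: cvgD.
    apply: cvgM; last exact: denom_cvg.
    apply: cvgM; first by apply: cvgMr; exact: h_cvg0.
    by apply: cvgV; [exact: oner_neq0|exact: w_cvg].
  apply: cvgM; first by apply: cvgMl; exact: w_cvg.
  apply: cvgD; first by apply: cvgMr; apply: cvgB; [exact: lnm_cvg|exact: lnp_cvg].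
  by apply: cvgB; [exact: err_minus|exact: err_plus].
Qed.
Let P : R := limn (prod_partial alpha).

Let P_gt0 : 0 < P.
Proof. by rewrite /P (cvg_lim _ (prod_partial_cvg alpha_gt1 J_cvg))// expR_gt0. Qed.

Let target n : R := expR (2 * pi * Num.sqrt (n%:R / (6 * alpha)))
  / (Lambda alpha * n%:R `^ (1 - 1 / (4 * alpha))).
Let Z : R := 2 * pi * Num.sqrt (A / pi) * P.

Let Lambda_gt0 : 0 < Lambda alpha.
Proof.
by rewrite /Lambda -/P !mulr_gt0 ?sqrtr_gt0 ?powR_gt0// ?mulr_gt0 ?pi_gt0 ?expR_gt0 ?divr_gt0.
Qed.

Let target_gt0 n : 0 < target n.+1.
Proof.
apply: divr_gt0; first exact: expR_gt0.
by apply: mulr_gt0; [exact: Lambda_gt0|exact: powR_gt0].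
Qed.

Let ln_Lambda : ln (Lambda alpha) = 2 * ln 2 + 2^-1 * ln 3
  + (2 * alpha)^-1 * (ln pi - euler_gamma) + (4 * alpha)^-1 * (ln alpha - ln 2 - ln 3) + ln P.
Proof.
have pi0 := @pi_gt0 R.
have a6 : 0 < alpha / 6 by exact: divr_gt0.
have l4 : ln 4 = 2 * ln 2 :> R.
  have -> : 4 = 2 * 2 :> R by ring.
  by rewrite lnM ?posrE//; ring.
have l6 : ln 6 = ln 2 + ln 3 :> R.
  have -> : 6 = 2 * 3 :> R by ring.
  by rewrite lnM ?posrE.
rewrite /Lambda -/P !lnM ?posrE ?mulr_gt0 ?sqrtr_gt0 ?powR_gt0 ?mulr_gt0 ?expR_gt0//.
rewrite !ln_powR lnM ?posrE ?expR_gt0// expRK ln_sqrt// l4 ln_div ?posrE// l6 !div1r.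
by rewrite opprD addrA.
Qed.

(** The choice of [s] makes [s n = A/s], so the two halves of the exponent agree. *)
Let main_exponent n : pi * Num.sqrt (n.+1%:R / (6 * alpha)) = s n * n.+1%:R.
Proof.
have pi0 := @pi_gt0 R; apply/eqP.
rewrite -(@eqrXn2 _ 2)// ?mulr_ge0 ?sqrtr_ge0 ?(ltW pi0) ?(ltW (s_gt0 n))//.
have d0 : 0 <= n.+1%:R / (6 * alpha) by rewrite divr_ge0// mulr_ge0// ltW.
rewrite !exprMn s_sq sqr_sqrtr// /A; apply/eqP.
have j0 : n.+1%:R != 0 :> R by rewrite pnatr_eq0.
by move: (n.+1%:R : R) j0 => j j0; field; rewrite j0 gt_eqF.
Qed.

Let exponent_Phi n : s n * n.+1%:R = A / s n.
Proof.
have s0 := s_gt0 n; apply: (mulfI (lt0r_neq0 s0)); rewrite mulrA -expr2 s_sq divfK ?pnatr_eq0//.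
by rewrite mulrCA divff ?mulr1// gt_eqF.
Qed.

Let Z_gt0 : 0 < Z.
Proof.
have pi0 := @pi_gt0 R; apply: mulr_gt0; last exact: P_gt0.
by apply: mulr_gt0; [exact: mulr_gt0|rewrite sqrtr_gt0; exact: divr_gt0].
Qed.

(** The evaluation of the constant, done on logarithms. *)
Let target_saddle n : expR (s n * n.+1%:R + Phi (s n)) * (s n * Num.sqrt (s n)) = Z * target n.+1.
Proof.
have pi0 := @pi_gt0 R; have s0 := s_gt0 n; have r0 := r_gt0 n.
have n0 : 0 < n.+1%:R :> R by [].
have pw : 0 < n.+1%:R `^ (1 - 1 / (4 * alpha)) by exact: powR_gt0.
have T0 := target_gt0 n.
have Z0 := Z_gt0.
have Ap : 0 < A / pi by exact: divr_gt0.
have sq0 : 0 < Num.sqrt (A / pi) by rewrite sqrtr_gt0.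
have tp : 0 < 2 * pi :> R by exact: mulr_gt0.
have u0 : 0 < 2 * pi * Num.sqrt (A / pi) by exact: mulr_gt0.
have sr : 0 < s n * Num.sqrt (s n) by exact: mulr_gt0.
apply: ln_inj; rewrite ?posrE; [by rewrite mulr_gt0 ?expR_gt0|exact: mulr_gt0|].
have lns : ln (s n) = 2^-1 * (ln A - ln n.+1%:R).
  by rewrite /s ln_sqrt// ln_div ?posrE.
have lnA : ln A = 2 * ln pi - ln 2 - ln 3 - ln alpha.
  have l6 : ln 6 = ln 2 + ln 3 :> R.
    have -> : 6 = 2 * 3 :> R by ring.
    by rewrite lnM ?posrE.
  rewrite /A !ln_div ?posrE ?divr_gt0 ?exprn_gt0// expr2 lnM ?posrE// l6; ring.
have lnT : ln (target n.+1) = 2 * (A / s n) - (ln (Lambda alpha) + (1 - 1 / (4 * alpha)) * ln n.+1%:R).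
  have L0 := mulr_gt0 Lambda_gt0 pw.
  rewrite /target ln_div ?posrE ?expR_gt0// expRK lnM ?posrE// ln_powR.
  by rewrite -mulrA main_exponent exponent_Phi.
have lnZ : ln Z = ln 2 + ln pi + 2^-1 * (ln A - ln pi) + ln P.
  by rewrite /Z [ln (_ * P)]lnM ?posrE// [ln (_ * Num.sqrt _)]lnM ?posrE// lnM ?posrE// ln_sqrt// ln_div ?posrE.
rewrite lnM ?posrE ?expR_gt0// expRK lnM ?posrE// ln_sqrt//.
rewrite [ln (Z * _)]lnM ?posrE// lnT lnZ ln_Lambda exponent_Phi /Phi /c0 /c1 lns.
rewrite ln_div ?posrE ?mulr_gt0// lnM ?posrE// lnA.
have al0 : alpha != 0 by rewrite gt_eqF.
move: (A / s n) (ln P) (ln pi) (ln n.+1%:R) (ln 2) (ln 3) (ln alpha) euler_gamma => *.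
by field.
Qed.

Lemma p_beatty_ratio_cvg : (fun n => (p_beatty alpha n.+1)%:R / target n.+1) @ \oo --> (1 : R).
Proof.
have pi0 := @pi_gt0 R.
have sM n : (alpha * s n)^-1 <= (M n)%:R.
  have s0 := s_gt0 n; have h4 := sM4 n; have M1 : 1 <= (M n)%:R :> R by rewrite ler1n muln_gt0.
  rewrite -[leLHS]mulr1 ler_pdivrMl ?mulr_gt0//.
  apply: (@le_trans _ _ (s n * (M n)%:R)); last first.
    have h1 := alpha_gt1.
    by rewrite ler_wpM2r// ler_peMl ?(ltW s0)// ltW.
  have [s1|/ltW s1] := leP (s n) 1.
    apply: (@le_trans _ _ (s n ^+ 2 * (M n)%:R)); first by lra.
    by rewrite ler_wpM2r// expr2 ler_piMl// ltW.
  by rewrite mulr_ege1.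
have LL := local_limit alpha_gt1 alpha_irr A_gt0 s_gt0 s_cvg0 sM mean_cvg var_cvg.
have c : (fun n => (partition_count a (M n) n.+1)%:R * expR (- (s n * n.+1%:R)) *
     expR (- log_gf a (s n) (M n)) / (s n * Num.sqrt (s n)) * (expR (err one n) * Z)) @ \oo
  --> (2 * pi)^-1 * Num.sqrt (pi / A) * (expR kappa * Z).
  apply: cvgM; first exact: LL.
  apply: cvgMl; apply: continuous_cvg; [exact: continuous_expR|exact: err_one].
have lim1 : (2 * pi)^-1 * Num.sqrt (pi / A) * (expR kappa * Z) = 1.
  rewrite /kappa -/P expRN lnK ?posrE// /Z.
  have q : Num.sqrt (pi / A) * Num.sqrt (A / pi) = 1.
    have piA : 0 <= pi / A by exact/ltW/divr_gt0.
    rewrite -sqrtrM//.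
    have -> : pi / A * (A / pi) = 1.
      by rewrite mulrA divfK ?(lt0r_neq0 A_gt0)// divff// lt0r_neq0.
    exact: sqrtr1.
  rewrite -[RHS]q.
  have P0 := lt0r_neq0 P_gt0; have p0 := lt0r_neq0 pi0.
  move: (pi) p0 (Num.sqrt (pi / A)) (Num.sqrt _) (P) P0 => p p0 x y z z0.
  by field; rewrite z0 p0.
rewrite lim1 in c; move: c.
rewrite [X in X @ \oo --> _ -> _](_ : _ = (fun n => (p_beatty alpha n.+1)%:R / target n.+1))//.
apply/funext => n.
have s0 := s_gt0 n; have r0 := r_gt0 n.
have NM : (n.+1 <= M n)%N by rewrite leq_pmull.
rewrite (p_beattyE alpha_gt1 NM).
have T0 := target_gt0 n.
have Z0 : Z != 0 by rewrite gt_eqF// Z_gt0.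
have gE2 : log_gf a (s n) (M n) = Phi (s n) + err one n.
  by rewrite /err /one mulr1 addrC subrK.
have key := target_saddle n.
have -> : target n.+1 = expR (s n * n.+1%:R + Phi (s n)) * (s n * Num.sqrt (s n)) / Z.
  by rewrite key mulrAC mulfV ?mul1r.
rewrite gE2 -/(r n); clear key gE2; move: (Phi (s n)) (err one n) => ph er.
rewrite opprD !expRD !expRN.
move: (expR_gt0 (s n * n.+1%:R)) (expR_gt0 ph) (expR_gt0 er).
move: (expR (s n * _)) (expR ph) (expR er) (partition_count _ _ _) => e1 e2 e3 p p1 p2 p3.
move: (s n) s0 (r n) r0 (Z) Z0 => x x0 y y0 z z0.
by field; rewrite z0 !gt_eqF.
Qed.
End SaddlePoint.

Theorem corollary1p2 (R : realType) (alpha : R) (psi : R -> R)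
  (alpha_gt1 : 1 < alpha)
  (alpha_irr : irrational alpha)
  (psi_ge0 : forall x, 0 < x -> 0 <= psi x)
  (psi_decr : exists X : R, forall x y, X <= x -> x <= y -> psi y <= psi x)
  (psi_int : (\int[lebesgue_measure]_(x in `[1%R, +oo[) (psi x / x)%:E < +oo)%E)
  (alpha_dioph : forall q : nat, (1 <= q)%N ->
     q%:R^-1 * dist_int (q%:R * alpha) > expR (- (q%:R * psi q%:R))) :
  [/\ cvgn (J1_partial alpha),
      cvgn (prod_partial alpha)
    & (fun n => (p_beatty alpha n)%:R : R) ~_\oo
      (fun n => expR (2 * pi * Num.sqrt (n%:R / (6 * alpha)))
                / (Lambda alpha * n%:R `^ (1 - 1 / (4 * alpha))))].
Proof.
have al0 : 0 < alpha by lra.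
have [H [H_cvg H_ge0 H_denom]] := dioph_summable_denominators al0 psi_ge0 psi_decr psi_int alpha_dioph.
have J_cvg := sawtooth_series_cvg H_cvg H_ge0 H_denom.
split.
- by rewrite J1_partialE.
- by apply/cvg_ex; eexists; exact: prod_partial_cvg alpha_gt1 J_cvg.
apply/eqaddoP => e e0.
have c := p_beatty_ratio_cvg alpha_gt1 alpha_irr J_cvg.
have [N _ HN] := (@cvgrPdist_le _ _ _ _ _ _ _).1 c e e0.
exists N.+1 => // -[//|n] /= Nn; rewrite !fctE.
have := HN n Nn; rewrite /=; set T := _ / (Lambda alpha * _) => h.
have T0 : 0 < T.
  rewrite divr_gt0 ?expR_gt0// mulr_gt0 ?powR_gt0//.
  by rewrite !mulr_gt0 ?sqrtr_gt0 ?powR_gt0 ?mulr_gt0 ?pi_gt0 ?expR_gt0 ?divr_gt0//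
     (cvg_lim _ (prod_partial_cvg alpha_gt1 J_cvg))// expR_gt0.
rewrite (_ : (p_beatty alpha n.+1)%:R - T = - ((1 - (p_beatty alpha n.+1)%:R / T) * T)).
  by rewrite normrN normrM ler_wpM2r.
by field; rewrite gt_eqF.
Qed.
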